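(* Let $\{(d_i,n_i,c_i),i\in\mathcal I\}$ be ESP data satisfying the set-$B$ condition and the projection condition (with projection $\pi$), and let $\bar\Gamma$ be the associated extended Skorokhod map. Let $X\in\mathcal C_G$, let $(Z,Y)$ be the solution of the ESP for $X$, and let $$\tau=\inf\{t\in[0,\infty):Z(t)\in\mathcal W\}.$$ Suppose $(Z,Y)$ satisfies the boundary jitter property on $[0,\tau)$. Then for all $\psi\in\mathcal C$: 1. $\nabla_\psi\bar\Gamma(X)$ exists on $[0,\tau)$ and lies in $\mathcal D_{\ell,r}([0,\tau):\mathbb R^J)$; 2. there exists a unique solution $(\phi,\eta)$ to the derivative problem associated with $Z$ for $\psi$ on $[0,\tau)$; 3. $\phi(t)=\nabla_\psi\bar\Gamma(X)(t+)$ for all $t\in[0,\tau)$; 4. $\nabla_\psi\bar\Gamma(X)(0)=\nabla_{\psi(0)}\pi(X(0))$ and $\nabla_\psi\bar\Gamma(X)=\Theta_Z(\phi)$ on $(0,\tau)$. Moreover, if for each $x\in\partial G$ the vectors $\{d_i,i\in\mathcal I(x)\}$ are linearly independent, then $\tau=\infty$.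
   Context: Notation. $\mathrm{cone}(A)$ is the set of finite nonnegative linear combinations of elements of $A\subseteq\mathbb R^J$, $\mathrm{span}(A)$ the linear span; both equal $\{0\}$ if $A=\emptyset$. $\inf\emptyset=\infty$. $\mathcal C$ is the space of continuous functions $[0,\infty)\to\mathbb R^J$ (uniform convergence on compacts), $\mathcal C_G=\{f\in\mathcal C: f(0)\in G\}$. For $T\in(0,\infty]$, $\mathcal D_{\ell,r}([0,T):\mathbb R^J)$ is the set of $f:[0,T)\to\mathbb R^J$ having finite left limits $f(t-)$ on $(0,T)$, finite right limits $f(t+)$ on $[0,T)$, and which at each $t\in(0,T)$ are left continuous and/or right continuous; $\mathcal D_r([0,T):\mathbb R^J)$ is the subset of right continuous functions. ESP data. $\mathcal I=\{1,\dots,N\}$; $n_i\in\mathbb R^J$ are unit vectors, $d_i\in\mathbb R^J$ with $\langle d_i,n_i\rangle=1$, $c_i\in\mathbb R$, and $G=\bigcap_{i\in\mathcal I}\{x:\langle x,n_i\rangle\ge c_i\}$ is the closure of a nonempty convex polyhedral domain. $F_i=\{x\in\partial G:\langle x,n_i\rangle=c_i\}$; for $x\in G$, $\mathcal I(x)=\{i:x\in F_i\}$; $d(x)=\mathrm{cone}(\{d_i:i\in\mathcal I(x)\})$ for $x\in\partial G$ and $d(x)=\{0\}$ for $x\in G^\circ$. $\mathcal S=\{x\in\partial G:|\mathcal I(x)|=1\}$, $\mathcal N=\partial G\setminus\mathcal S$. $H_x=\bigcap_{i\in\mathcal I(x)}\{y:\langle y,n_i\rangle=0\}$ for $x\in\partial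 G$, $H_x=\mathbb R^J$ for $x\in G^\circ$. $\mathcal W=\{x\in\mathcal N:\mathrm{span}(H_x\cup d(x))\ne\mathbb R^J\}$. ESP (extended Skorokhod problem). $(Z,Y)\in\mathcal C\times\mathcal C$ solves the ESP for $X\in\mathcal C$ if $Y(0)\in d(Z(0))$ and for all $t\ge0$: $Z(t)=X(t)+Y(t)$; $Z(t)\in G$; and $Y(t)-Y(s)\in\mathrm{cone}[\cup_{u\in(s,t]}d(Z(u))]$ for all $s\in[0,t)$. Set-$B$ condition: there exist $\delta>0$ and a compact, convex, symmetric set $B$ with $0\in B^\circ$ such that for every $i\in\mathcal I$: if $z\in\partial B$ and $|\langle z,n_i\rangle|<\delta$ then $\langle\nu,d_i\rangle=0$ for all $\nu\in\nu_B(z)$, where $\nu_B(z)=\{\nu:|\nu|=1,\ \langle\nu,y-z\rangle\ge0\ \forall y\in B\}$. Projection condition: there is $\pi:\mathbb R^J\to G$ with $\pi(x)=x$ for $x\in G$ and $\pi(x)-x\in d(\pi(x))$ for $x\notin G$. Under these two conditions the ESP has a unique solution $(Z,Y)$ for every $X\in\mathcal C$, and $\bar\Gamma(X):=Z$ defines the extended Skorokhod map. Also, for $x\in G$, $v\in\mathbb R^J$, the limit $\nabla_v\pi(x):=\lim_{\varepsilon\downarrow0}(\pi(x+\varepsilon v)-\pi(x))/\varepsilon$ exists. Directional derivative. For $X,\psi\in\mathcal C$, $\nabla_\psi\bar\Gamma(X)(t):=\lim_{\varepsilon\downarrow0}\varepsilon^{-1}[\bar\Gamma(X+\varepsilon\psi)(t)-\bar\Gamma(X)(t)]$;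 it exists on $[0,T)$ if the limit exists for all $t\in[0,T)$. Boundary jitter property of $(Z,Y)$ on $[0,T)$: (1) if $t\in[0,T)$ and $Z(t)\in\mathcal S$, then for all $s<t<u<T$, $Y$ is nonconstant on $(s\vee0,u)$; (2) $\int_0^T1_{\mathcal N}(Z(t))\,dt=0$; (3) if $Z(0)\in\mathcal N$, then for each $i\in\mathcal I(Z(0))$ and $\delta\in(0,T)$ there is $u\in(0,\delta)$ with $\mathcal I(Z(u))=\{i\}$; (4) if $t\in(0,T)$ and $Z(t)\in\mathcal N$, then for each $i\in\mathcal I(Z(t))$ and $\delta\in(0,t)$ there is $s\in(t-\delta,t)$ with $\mathcal I(Z(s))=\{i\}$. Derivative problem (DP). $(\phi,\eta)\in\mathcal D_r([0,T):\mathbb R^J)^2$ solves the DP associated with $Z$ for $\psi$ on $[0,T)$ if $\eta(0)\in\mathrm{span}[d(Z(0))]$ and for all $t\in[0,T)$: $\phi(t)=\psi(t)+\eta(t)$; $\phi(t)\in H_{Z(t)}$; and $\eta(t)-\eta(s)\in\mathrm{span}[\cup_{u\in(s,t]}d(Z(u))]$ for all $s\in[0,t)$. Functional $\Theta_Z$. For $x\in\mathcal S$ with $\mathcal I(x)=\{i_x\}$ let $G_x=\{y:\langle y,n_{i_x}\rangle\ge0\}$. For $f\in\mathcal D_r([0,\tau):\mathbb R^J)$ and $t\in(0,\tau)$: $\Theta_Z(f)(t)=f(t-)$ if $Z(t)\in\mathcal S$ and $f(t-)\in G_{Z(t)}$, and $\Theta_Z(f)(t)=f(t)$ otherwise. 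*)

(* Defs.v *)
From HB Require Import structures.
From mathcomp Require Import all_boot all_order all_algebra.
From mathcomp Require Import all_classical all_reals all_analysis.

Set Implicit Arguments.
Unset Strict Implicit.
Unset Printing Implicit Defensive.

Import Order.TTheory GRing.Theory Num.Theory.
Import numFieldNormedType.Exports.

Local Open Scope classical_set_scope.
Local Open Scope ring_scope.

Section euclidean.
Context {R : realType} {J : nat}.
Implicit Types (u v : 'rV[R]_J) (A : set 'rV[R]_J).

Definition dot u v : R := \sum_(k < J) u ord0 k * v ord0 k.

(* The Euclidean norm; `|v| is the library's max-norm, which induces the same
   topology. *)
Definition enorm v : R := Num.sqrt (dot v v).

(* The empty combination (m = 0) puts 0 in cone A and span A, so that both
   are [set 0] when A = set0. *)
Definition cone A : set 'rV[R]_J :=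
  [set v | exists (m : nat) (a : 'I_m -> R) (w : 'I_m -> 'rV[R]_J),
    [/\ forall k, 0 <= a k, forall k, A (w k) & v = \sum_(k < m) a k *: w k]].

Definition span A : set 'rV[R]_J :=
  [set v | exists (m : nat) (a : 'I_m -> R) (w : 'I_m -> 'rV[R]_J),
    (forall k, A (w k)) /\ v = \sum_(k < m) a k *: w k].

Definition boundary A : set 'rV[R]_J := closure A `\` interior A.

(* Inward unit normals to B at z. *)
Definition normals_at A (z : 'rV[R]_J) : set 'rV[R]_J :=
  [set nu | enorm nu = 1 /\ forall y, A y -> 0 <= dot nu (y - z)].

End euclidean.

(* A path [0, oo) -> R^J is a function on all of R whose values at negative
   times are never used; a path on [0, T), with T in [0, oo], likewise. *)
Section paths.
Context {R : realType} {J : nat}.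
Implicit Types (T : \bar R) (f : R -> 'rV[R]_J).

Definition continuous_path f := {within [set t : R | 0 <= t], continuous f}.

Definition in_itv0 T (t : R) : Prop := 0 <= t /\ (t%:E < T)%E.

Definition in_oitv0 T (t : R) : Prop := 0 < t /\ (t%:E < T)%E.

Definition D_lr T f : Prop :=
  [/\ forall t, in_oitv0 T t -> cvg (f @ t^'-),
      forall t, in_itv0 T t -> cvg (f @ t^'+) &
      forall t, in_oitv0 T t -> f @ t^'- --> f t \/ f @ t^'+ --> f t].

Definition D_r T f : Prop :=
  D_lr T f /\ forall t, in_itv0 T t -> f @ t^'+ --> f t.

End paths.

Record esp_data (R : realType) (J N : nat) := EspData {
  nrm : 'I_N -> 'rV[R]_J ;
  dir : 'I_N -> 'rV[R]_J ;
  cst : 'I_N -> R }.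

Section esp.
Context {R : realType} {J N : nat} (D : esp_data R J N).
Implicit Types (x y z v : 'rV[R]_J) (i : 'I_N) (T : \bar R).
Implicit Types (X Y Z phi eta psi f : R -> 'rV[R]_J).

Definition Gset : set 'rV[R]_J := [set x | forall i, cst D i <= dot x (nrm D i)].

(* A convex open set U with closure U = Gset is necessarily the interior of
   Gset, so the domain whose closure is Gset is interior Gset. *)
Definition is_esp_data : Prop :=
  [/\ forall i, enorm (nrm D i) = 1,
      forall i, dot (dir D i) (nrm D i) = 1,
      interior Gset !=set0 &
      Gset = closure (interior Gset)].

Definition face i : set 'rV[R]_J :=
  [set x | boundary Gset x /\ dot x (nrm D i) = cst D i].

(* Faces lie in the boundary, so active x = set0 off the boundary of Gset;
   hence dcone x = [set 0] and Hset x = setT for x in the interior. *)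
Definition active x : set 'I_N := [set i | face i x].

Definition dcone x : set 'rV[R]_J := cone [set dir D i | i in active x].

Definition Hset x : set 'rV[R]_J :=
  [set y | forall i, active x i -> dot y (nrm D i) = 0].

Definition smooth_part : set 'rV[R]_J :=
  [set x | boundary Gset x /\ exists i, active x = [set i]].

Definition nonsmooth_part : set 'rV[R]_J := boundary Gset `\` smooth_part.

Definition Wset : set 'rV[R]_J :=
  [set x | nonsmooth_part x /\ span (Hset x `|` dcone x) <> setT].

Definition solves_ESP X Z Y : Prop :=
  [/\ continuous_path Z, continuous_path Y, dcone (Z 0) (Y 0) &
      forall t, 0 <= t ->
        [/\ Z t = X t + Y t,
            Gset (Z t) &
            forall s, 0 <= s < t ->
              cone (\bigcup_(u in [set u | s < u <= t]) dcone (Z u))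
                   (Y t - Y s)]].

Definition set_B_condition : Prop :=
  exists (delta : R) (B : set 'rV[R]_J),
    [/\ 0 < delta,
        [/\ compact B, convex_set B, (forall y, B y -> B (- y)) &
            interior B 0] &
        forall i z, boundary B z -> `|dot z (nrm D i)| < delta ->
          forall nu, normals_at B z nu -> dot nu (dir D i) = 0].

Definition is_projection (proj : 'rV[R]_J -> 'rV[R]_J) : Prop :=
  [/\ forall x, Gset (proj x),
      forall x, Gset x -> proj x = x &
      forall x, ~ Gset x -> dcone (proj x) (proj x - x)].

(* Under the set-B and projection conditions solutions of the ESP are unique,
   so this determines Gam X on [0, oo) for every continuous path X. *)
Definition is_ESM (Gam : (R -> 'rV[R]_J) -> R -> 'rV[R]_J) : Prop :=
  forall X, continuous_path X -> exists Y, solves_ESP X (Gam X) Y.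

Definition boundary_jitter T Z Y : Prop :=
  [/\ forall t, in_itv0 T t -> smooth_part (Z t) ->
        forall s u, s < t -> t < u -> (u%:E < T)%E ->
          ~ exists y, forall r, Num.max s 0 < r < u -> Y r = y,
      (\int[@lebesgue_measure R]_(t in in_itv0 T)
          (\1_nonsmooth_part (Z t))%:E = 0)%E,
      nonsmooth_part (Z 0) ->
        forall i, active (Z 0) i -> forall delta, in_oitv0 T delta ->
          exists u, 0 < u < delta /\ active (Z u) = [set i] &
      forall t, in_oitv0 T t -> nonsmooth_part (Z t) ->
        forall i, active (Z t) i -> forall delta, 0 < delta < t ->
          exists s, t - delta < s < t /\ active (Z s) = [set i]].

Definition solves_DP T Z psi phi eta : Prop :=
  [/\ D_r T phi, D_r T eta, span (dcone (Z 0)) (eta 0) &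
      forall t, in_itv0 T t ->
        [/\ phi t = psi t + eta t,
            Hset (Z t) (phi t) &
            forall s, 0 <= s < t ->
              span (\bigcup_(u in [set u | s < u <= t]) dcone (Z u))
                   (eta t - eta s)]].

Definition tau_W Z : \bar R :=
  ereal_inf [set t%:E | t in [set t : R | 0 <= t /\ Wset (Z t)]].

(* G_x for x in the smooth part. *)
Definition half_space x : set 'rV[R]_J :=
  [set y | exists i, active x = [set i] /\ 0 <= dot y (nrm D i)].

Definition Theta Z f (t : R) : 'rV[R]_J :=
  if `[< smooth_part (Z t) /\ half_space (Z t) (lim (f @ t^'-)) >]
  then lim (f @ t^'-) else f t.

End esp.

Section directional_derivatives.
Context {R : realType} {J : nat}.

Definition proj_quot (proj : 'rV[R]_J -> 'rV[R]_J) (x v : 'rV[R]_J) (e : R) :=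
  e^-1 *: (proj (x + e *: v) - proj x).

Definition proj_deriv proj (x v : 'rV[R]_J) : 'rV[R]_J :=
  lim (proj_quot proj x v @ 0^'+).

Definition ESM_quot (Gam : (R -> 'rV[R]_J) -> R -> 'rV[R]_J)
    (X psi : R -> 'rV[R]_J) (t e : R) : 'rV[R]_J :=
  e^-1 *: (Gam (fun s => X s + e *: psi s) t - Gam X t).

Definition ESM_deriv Gam (X psi : R -> 'rV[R]_J) (t : R) : 'rV[R]_J :=
  lim (ESM_quot Gam X psi t @ 0^'+).

End directional_derivatives.

(* Main.v *)
(* All estimates are carried out in the norm [g] whose unit ball is the set B.
   Let v_e = (Z_e - Z) / e, where Z_e solves the ESP for X + e psi. Up to the
   oscillation of psi, v_e moves only along directions d_i of active faces, and
   only when <v_e, n_i> has the sign that makes g(v_e) decrease; hence v_e is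
   bounded, and it has limits D(t) along every ultrafilter of e -> 0+.

   If all the faces active at Z(t) are pushed in a time interval near t, then the
   component of v_e along the span of the d_i contracts by a uniform factor
   al < 1: a functional norming v_e at the end of the interval also nearly norms
   it at every earlier time, which forces the functional to vanish on each d_i.
   By the boundary jitter property this happens infinitely often before t (or,
   at time 0 and at a first contact with a smooth face, after t), so that the
   one-sided limits of D exist and satisfy the derivative problem. The solution
   of the latter is unique, for the same reason as for the ESP, and it determines
   D through Theta_Z. Thus D does not depend on the ultrafilter, and v_e
   converges. *)
Require Import Defs.
From mathcomp Require Import all_boot all_order all_algebra.
From mathcomp Require Import all_classical all_reals all_analysis.
From mathcomp Require Import ring lra.
Import Order.TTheory GRing.Theory Num.Theory.
Import numFieldNormedType.Exports.
Local Open Scope classical_set_scope.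
Local Open Scope ring_scope.
Set Implicit Arguments.
Unset Strict Implicit.
Unset Printing Implicit Defensive.

(** Solutions of the ESP need not have bounded variation, so no selection principle of Helly type
    applies to the difference quotients. An ultrafilter finer than the right neighbourhoods of 0
    gives limits at all times at once from boundedness alone; what passes to such a limit are closed
    conditions, namely bounds on [g] and membership in spans of directions. Arguments over time
    intervals run backwards: a functional norming the value at the end of a step bounds the value at
    its start from below, and the increment of Y over a short step ending at r lies in the cone of
    the faces active at r. Before tau every vector splits into a part in H_{Z(t)} and a part in span
    d(Z(t)). The set-B condition makes the splitting unique and the projection onto H_{Z(t)}
    nonexpansive for [g]. Near t the H-part of D moves with psi alone, so only the other part has to
    be estimated. *)

Lemma cvg_big_sum {R : realType} {V : normedModType R} {T I : Type}
    {F : set_system T} {FF : Filter F} (r : seq I) (f : I -> T -> V) (l : I -> V) :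
  (forall i, f i @ F --> l i) ->
  (fun x => \sum_(i <- r) f i x) @ F --> \sum_(i <- r) l i.
Proof.
move=> h; elim: r => [|i r IHr].
  by under eq_fun do rewrite big_nil; rewrite big_nil; exact: cvg_cst.
by under eq_fun do rewrite big_cons; rewrite big_cons; exact: cvgD.
Qed.

(** * Algebra and continuity of the dot product *)

Section dot_product.
Context {R : realType} {J : nat}.
Implicit Types (u v w : 'rV[R]_J) (a : R).

Lemma dotC u v : dot u v = dot v u.
Proof. by apply: eq_bigr => k _; rewrite mulrC. Qed.

Lemma dotDl u v w : dot (u + v) w = dot u w + dot v w.
Proof. by rewrite -big_split /=; apply: eq_bigr => k _; rewrite mxE mulrDl. Qed.

Lemma dotZl a u w : dot (a *: u) w = a * dot u w.
Proof. by rewrite mulr_sumr; apply: eq_bigr => k _; rewrite mxE mulrA. Qed.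

Lemma dotDr u v w : dot w (u + v) = dot w u + dot w v.
Proof. by rewrite dotC dotDl !(dotC w). Qed.

Lemma dotZr a u w : dot w (a *: u) = a * dot w u.
Proof. by rewrite dotC dotZl (dotC w). Qed.

Lemma dotNl u w : dot (- u) w = - dot u w.
Proof. by rewrite -scaleN1r dotZl mulN1r. Qed.

Lemma dotNr u w : dot w (- u) = - dot w u.
Proof. by rewrite dotC dotNl (dotC w). Qed.

Lemma dotBl u v w : dot (u - v) w = dot u w - dot v w.
Proof. by rewrite dotDl dotNl. Qed.

Lemma dotBr u v w : dot w (u - v) = dot w u - dot w v.
Proof. by rewrite dotDr dotNr. Qed.

Lemma dot0l w : dot 0 w = 0.
Proof. by rewrite -(scale0r 0) dotZl mul0r. Qed.

Lemma dot0r w : dot w 0 = 0.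
Proof. by rewrite dotC dot0l. Qed.

Lemma dot_suml n (F : 'I_n -> 'rV[R]_J) w :
  dot (\sum_(k < n) F k) w = \sum_(k < n) dot (F k) w.
Proof.
elim/big_rec2: _ => [|k x y _ <-]; first by rewrite dot0l.
by rewrite dotDl.
Qed.

Lemma dot_sumr n (F : 'I_n -> 'rV[R]_J) w :
  dot w (\sum_(k < n) F k) = \sum_(k < n) dot w (F k).
Proof. by rewrite dotC dot_suml; apply: eq_bigr => k _; rewrite dotC. Qed.

Lemma dot_ge0 u : 0 <= dot u u.
Proof. by apply: sumr_ge0 => k _; rewrite -expr2 sqr_ge0. Qed.

Lemma dot_gt0 u : u != 0 -> 0 < dot u u.
Proof.
move=> u0; rewrite lt_neqAle dot_ge0 andbT eq_sym; apply: contraNneq u0.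
move=> /eqP; rewrite psumr_eq0; last by move=> k _; rewrite -expr2 sqr_ge0.
move=> /allP h; apply/eqP/rowP => k; rewrite mxE.
have := h k (mem_index_enum k).
by rewrite /= mulf_eq0 orbb => /eqP.
Qed.

Lemma normr_coord u k : `|u ord0 k| <= `|u|.
Proof.
rewrite [leRHS]/Num.Def.normr /= mx_normrE; apply/bigmax_geP; right => /=.
by exists (ord0, k).
Qed.

Lemma normr_row_le u a : 0 <= a -> (forall k, `|u ord0 k| <= a) -> `|u| <= a.
Proof.
move=> a0 h; rewrite [leLHS]/Num.Def.normr /= mx_normrE; apply/bigmax_leP; split => //.
by move=> [i k] _ /=; rewrite ord1.
Qed.

Lemma dot_le_norm v : exists2 C, 0 <= C & forall u, `|dot u v| <= C * `|u|.
Proof.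
exists (\sum_(k < J) `|v ord0 k|); first exact: sumr_ge0.
move=> u; rewrite (le_trans (ler_norm_sum _ _ _))// mulr_suml ler_sum// => k _.
by rewrite normrM mulrC ler_wpM2l// normr_coord.
Qed.

Lemma continuous_dotr v : continuous (fun u => dot u v).
Proof.
move=> u; rewrite /dot; apply: (@cvg_big_sum _ _ _ _ _ (nbhs_filter u)) => k.
by apply: continuousM; [exact: coord_continuous|exact: cst_continuous].
Qed.

End dot_product.

(** * Polar sets and separation *)

Section polar.
Context {R : realType} {J : nat}.
Implicit Types (u v w y nu : 'rV[R]_J) (B : set 'rV[R]_J).

Definition polar B : set 'rV[R]_J := [set nu | forall y, B y -> dot nu y <= 1].

Lemma interior_normP B y : interior B y ->
  exists2 r : R, 0 < r & forall v, `|y - v| <= r -> B v.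
Proof.
rewrite /interior => /nbhs_ballP[r r0 h]; exists (r / 2); first by rewrite divr_gt0.
move=> v hv; apply: h; rewrite -ball_normE /ball_ /= (le_lt_trans hv)//.
by rewrite gtr_pMr// invf_lt1// ltr1n.
Qed.

Lemma compact_norm_bound B : compact B -> exists2 M : R, 0 < M & forall y, B y -> `|y| <= M.
Proof.
move=> /compact_bounded[M [_ hM]]; exists (`|M| + 1); first by rewrite ltr_wpDl.
by move=> y; apply: hM; rewrite (le_lt_trans (ler_norm M))// ltrDl.
Qed.

(** The point [p] of [B] nearest to [v] in Euclidean distance gives the separating direction
    [v - p]. It is rescaled to take the value 1 at [p], which is possible because [B] contains a
    ball around 0. *)
Lemma polar_separation B v : compact B -> convex_set B -> interior B 0 -> ~ B v ->
  exists2 nu, polar B nu & 1 < dot nu v.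
Proof.
move=> cB convB /interior_normP[r r0 hr] nBv.
have B0 : B 0 by apply: hr; rewrite subr0 normr0 ltW.
pose f y := dot (y - v) (y - v).
have cf : continuous f.
  move=> y; rewrite /f /dot; apply: (@cvg_big_sum _ _ _ _ _ (nbhs_filter y)) => k.
  have h : {for y, continuous (fun x : 'rV[R]_J => (x - v) ord0 k)}.
    apply: (@continuous_comp _ _ _ (fun x : 'rV[R]_J => x - v) (fun x => x ord0 k)).
      by apply: continuousB; [exact: cvg_id|exact: cst_continuous].
    exact: coord_continuous.
  exact: (continuousM h h).
have [p] := EVT_min_rV (ex_intro _ _ B0) cB (continuous_subspaceT cf).
rewrite inE => Bp min_p; have [a aE] : exists a, a = v - p by exists (v - p).
have a0 : a != 0 by rewrite aE subr_eq0; apply: contra_notN nBv => /eqP ->.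
have sep y : B y -> dot a y <= dot a p.
  move=> By; rewrite -subr_ge0 -dotBr.
  have key l : 0 < l -> l <= 1 -> 0 <= dot a (p - y) *+ 2 + l * dot (p - y) (p - y).
    move=> l0 l1; have := convB y p (Itv01 (ltW l0) l1).
    rewrite !inE => /(_ By Bp); rewrite /conv /= => /mem_set/min_p.
    rewrite /f (_ : l *: y + unstable.onem l *: p - v = - (a + l *: (p - y))); last first.
      by apply/rowP => k; rewrite aE /unstable.onem !mxE; ring.
    have <- : - a = p - v by rewrite aE opprB.
    rewrite !dotNl !dotNr !opprK; move: (p - y) => w.
    rewrite !dotDl !dotDr !dotZl !dotZr (dotC w a) -(pmulr_rge0 _ l0) -subr_ge0.
    by congr (0 <= _); ring.
  set d := dot a (p - y); set q := dot (p - y) (p - y).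
  have q0 : 0 <= q := dot_ge0 _.
  rewrite leNgt; apply/negP => d0.
  (* The inequality [key] is tested at [l = 1] if [q <= - d], and otherwise at [l = - d / q], where
     its right side equals [d]. *)
  have [q1|q1] := leP q (- d).
    by have := key 1 ltr01 (lexx _); rewrite -/d -/q; lra.
  have qp : 0 < q by lra.
  have := key (- d / q); rewrite -/d -/q divfK ?gt_eqF// ler_pdivrMr// mul1r divr_gt0//; last lra.
  by move=> /(_ isT (ltW q1)); lra.
have ap0 : 0 < dot a p.
  have na : 0 < `|a| by rewrite normr_gt0.
  have : B ((r / `|a|) *: a).
    apply: hr; rewrite sub0r normrN normrZ normrM ger0_norm ?(ltW r0)//.
    by rewrite normfV normr_id divfK// gt_eqF.
  move=> /sep; rewrite dotZr; apply: lt_le_trans.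
  by rewrite mulr_gt0 ?divr_gt0 ?dot_gt0.
exists ((dot a p)^-1 *: a).
  by move=> y /sep h; rewrite dotZl ler_pdivrMl// mulr1.
rewrite dotZl ltr_pdivlMl// mulr1 -subr_gt0 -dotBr -aE; exact: dot_gt0.
Qed.

Lemma polar_le_norm B (r : R) nu v : 0 < r -> (forall y, `|y| <= r -> B y) ->
  polar B nu -> dot nu v <= r^-1 * `|v|.
Proof.
move=> r0 hr Qnu; have [->|v0] := eqVneq v 0; first by rewrite dot0r normr0 mulr0.
have nv : 0 < `|v| by rewrite normr_gt0.
have /Qnu : B ((r / `|v|) *: v).
  by apply: hr; rewrite normrZ normrM ger0_norm ?(ltW r0)// normfV normr_id divfK// gt_eqF.
by rewrite dotZr mulrAC ler_pdivrMr// mul1r mulrC -ler_pdivlMr// mulrC.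
Qed.

Lemma polar_compact B : interior B 0 -> compact (polar B).
Proof.
move=> /interior_normP[r r0 hr]; apply: bounded_closed_compact.
  exists r^-1; split=> [|x rx nu Qnu]; first by rewrite num_real.
  apply: (le_trans _ (ltW rx)); apply: normr_row_le; first by rewrite invr_ge0 ltW.
  have hd j : `|delta_mx ord0 j : 'rV[R]_J| <= 1.
    apply: normr_row_le => // k; rewrite mxE; case: (_ && _); by rewrite ?normr1 ?normr0.
  have dotd j : dot nu (delta_mx ord0 j) = nu ord0 j.
    rewrite /dot (bigD1 j)//= big1 ?addr0 ?mxE ?eqxx ?mulr1// => k /negbTE kj.
    by rewrite mxE eqxx kj mulr0.
  have key (e : R) j : `|e| = 1 -> e * nu ord0 j <= r^-1.
    move=> e1; rewrite -dotd -dotZr.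
    have hr' y : `|y| <= r -> B y by move=> yr; apply: hr; rewrite sub0r normrN.
    rewrite (le_trans (polar_le_norm _ r0 hr' Qnu))// normrZ e1 mul1r.
    by rewrite ler_piMr// invr_ge0 ltW.
  move=> k; rewrite ler_norml lerNl -mulN1r key ?normrN1//.
  by rewrite -[_ ord0 k]mul1r key ?normr1.
rewrite (_ : polar B = \bigcap_(y in B) [set nu | dot nu y <= 1]); last first.
  by apply/seteqP; split => nu h y; exact: h.
apply: closed_bigI => y _.
by apply: (preimage_closed _ (@closed_le _ 1)) => nu _; exact: continuous_dotr.
Qed.

End polar.

(* [adapted_flat] is the set-B condition for the norm with unit ball B: from any
   point that is not far inside the [i]-th half-space, B can be followed along
   [dir i] without leaving it. *)
Record adapted_norm {R : realType} {J N : nat} (D : esp_data R J N)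
    (g : 'rV[R]_J -> R) (rho K : R) : Prop := AdaptedNorm {
  adapted_D : forall u v, g (u + v) <= g u + g v ;
  adapted_Z : forall a v, g (a *: v) = `|a| * g v ;
  adapted_le : forall v, g v <= K * `|v| ;
  adapted_ge : forall v, `|v| <= K * g v ;
  adapted_nrm : forall i v, `|dot v (nrm D i)| <= K * g v ;
  adapted_supp : forall v, exists nu,
    (forall w, dot nu w <= g w) /\ dot nu v = g v ;
  adapted_rho : 0 < rho ;
  adapted_K : 0 < K ;
  adapted_flat : forall i v, dot v (nrm D i) <= rho * g v ->
    g (v + (rho * g v) *: dir D i) <= g v }.

(** * Construction of the adapted norm from the set B *)

Section adapted_norm_existence.
Context {R : realType} {J N : nat} (D : esp_data R J N).
Implicit Types (u v w y z nu mu : 'rV[R]_J) (i : 'I_N).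

(** [g] is the gauge of [B], written as the support function of the polar of [B]: in this form the
    maximiser [f v] is at hand as the functional norming [v]. *)
Lemma set_B_adapted_norm : (forall i, dot (dir D i) (nrm D i) = 1) ->
  set_B_condition D -> exists g rho K, adapted_norm D g rho K.
Proof.
move=> dn1 [delta [B [delta0 [cB convB symB intB] normB]]].
have [r r0 hr] := interior_normP intB.
have {}hr y : `|y| <= r -> B y by move=> yr; apply: hr; rewrite sub0r normrN.
have [M M0 hM] := compact_norm_bound cB.
pose Q := polar B.
have Q0 : Q 0 by move=> y _; rewrite dot0l ler01.
have QN nu : Q nu -> Q (- nu).
  by move=> Qnu y By; rewrite dotNl -dotNr; apply/Qnu/symB.
have ex_max v : exists nu, Q nu /\ forall mu, Q mu -> dot mu v <= dot nu v.
  have [nu] := EVT_max_rV (ex_intro _ _ Q0) (polar_compact intB)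
    (continuous_subspaceT (@continuous_dotr _ _ v)).
  rewrite inE => Qnu h; exists nu; split=> // mu Qmu.
  by apply: h; rewrite inE.
have [f hf] := choice ex_max.
pose g v := dot (f v) v.
have Qf v : Q (f v) by have [] := hf v.
have gmax mu v : Q mu -> dot mu v <= g v by have [_] := hf v; exact.
have g0 v : 0 <= g v by rewrite -(dot0l v) gmax.
have gZ a v : g (a *: v) = `|a| * g v.
  wlog a0 : a / 0 <= a.
    move=> h; have [|/ltW a0] := leP 0 a; first exact: h.
    rewrite -normrN -h ?oppr_ge0// scaleNr.
    have gN u : g u <= g (- u).
      by rewrite {1}/g -{2}[u]opprK dotNr -dotNl gmax//; exact/QN/Qf.
    by apply/eqP; rewrite eq_le gN -{2}[_ *: _]opprK gN.
  rewrite ger0_norm//; apply/eqP; rewrite eq_le; apply/andP; split.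
    by rewrite {1}/g dotZr ler_wpM2l// gmax.
  by rewrite {1}/g -dotZr gmax.
have gD u v : g (u + v) <= g u + g v.
  by rewrite {1}/g dotDr lerD// gmax.
have g_le v : g v <= r^-1 * `|v| by apply: (polar_le_norm v r0 hr); exact: Qf.
have g_ge v : `|v| <= M * g v.
  apply: normr_row_le => [|k]; first by rewrite mulr_ge0// ltW.
  have dotd w : dot (delta_mx ord0 k) w = w ord0 k.
    rewrite /dot (bigD1 k)//= big1 ?addr0 ?mxE ?eqxx ?mul1r// => j /negbTE kj.
    by rewrite mxE eqxx kj mul0r.
  have Qd : Q (M^-1 *: delta_mx ord0 k).
    move=> y /hM By; rewrite dotZl dotd ler_pdivrMl// mulr1.
    by rewrite (le_trans _ By)// (le_trans (ler_norm _))// normr_coord.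
  rewrite -ler_pdivrMl//; have h1 := gmax _ v Qd.
  have h2 := gmax _ v (QN _ Qd).
  move: h1 h2; rewrite dotNl dotZl dotd => h1 h2.
  case: (ger0P (v ord0 k)) => _ //; by rewrite mulrN.
have g_eq0 v : g v = 0 -> v = 0.
  by move=> gv; apply/eqP; rewrite -normr_le0 (le_trans (g_ge v))// gv mulr0.
have inB v : g v <= 1 -> B v.
  move=> gv; apply: contrapT => nBv.
  have [nu Qnu] := polar_separation cB convB intB nBv.
  by apply/negP; rewrite -leNgt (le_trans (gmax _ _ Qnu)).
(* The set-B condition in dual form: if [nu] norms [u], then [u / g u] is a boundary point of [B]
   and [- nu] is, up to scaling, an inward normal there. *)
have perp i u nu : Q nu -> 0 < g u -> dot nu u = g u ->
    `|dot u (nrm D i)| < delta * g u -> dot nu (dir D i) = 0.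
  move=> Qnu gu nuu un; pose z := (g u)^-1 *: u.
  have gz : g z = 1 by rewrite gZ gtr0_norm ?invr_gt0// mulVf ?gt_eqF.
  have nuz : dot nu z = 1 by rewrite dotZr nuu mulVf ?gt_eqF.
  have nu0 : nu != 0.
    by apply: contra_eq_neq nuz => ->; rewrite dot0l eq_sym oner_eq0.
  have sq0 : 0 < enorm nu by rewrite sqrtr_gt0 dot_gt0.
  have bz : boundary B z.
    split; first by apply: subset_closure; apply: inB; rewrite gz.
    move=> /interior_normP[e e0 he].
    have nz : 0 < `|z|.
      by rewrite normr_gt0; apply: contra_eq_neq nuz => ->; rewrite dot0r eq_sym oner_eq0.
    have /Qnu : B ((1 + e / `|z|) *: z).
      apply: he; rewrite scalerDl scale1r opprD addrA subrr sub0r normrN normrZ.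
      by rewrite normrM (gtr0_norm e0) normfV normr_id divfK// gt_eqF.
    rewrite dotZr nuz mulr1 -subr_ge0 opprD addrA subrr sub0r oppr_ge0.
    by rewrite leNgt divr_gt0.
  have nz : normals_at B z (- (enorm nu)^-1 *: nu).
    split.
      rewrite /enorm dotZl dotZr mulrA mulrNN -expr2 sqrtrM ?sqr_ge0//.
      by rewrite sqrtr_sqr gtr0_norm ?invr_gt0// mulVf// gt_eqF.
    move=> y /Qnu nuy; rewrite dotZl dotBr nuz mulNr oppr_ge0.
    by rewrite pmulr_rle0 ?invr_gt0// subr_le0.
  have zn : `|dot z (nrm D i)| < delta.
    by rewrite /z dotZl normrM gtr0_norm ?invr_gt0// ltr_pdivrMl// mulrC.
  have /eqP := normB i z bz zn _ nz.
  by rewrite dotZl mulNr oppr_eq0 mulf_eq0 invr_eq0 gt_eqF//= => /eqP.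
(* As [w] is orthogonal to [nrm D i], a functional norming [w] kills [dir D i] and takes the same
   value at [w] and at [v]. *)
have proj_le i v : g (v - dot v (nrm D i) *: dir D i) <= g v.
  set w := v - _.
  have wn : dot w (nrm D i) = 0 by rewrite dotBl dotZl dn1 mulr1 subrr.
  have := g0 w; rewrite le_eqVlt => /predU1P[<-//|gw].
  have h := perp i w (f w) (Qf w) gw erefl; rewrite wn normr0 in h.
  have {}h := h (mulr_gt0 delta0 gw).
  by rewrite {1}/g {2}/w dotBr dotZr h mulr0 subr0 gmax.
have [K1 K10 hK1] : exists2 K1, 0 <= K1 & forall i v, `|dot v (nrm D i)| <= K1 * g v.
  have exC i : exists c, 0 <= c /\ forall u, `|dot u (nrm D i)| <= c * `|u|.
    by have [c c0 hc] := dot_le_norm (nrm D i); exists c.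
  have [C hC] := choice exC.
  exists ((\sum_i C i) * M).
    by rewrite mulr_ge0 ?(ltW M0)// sumr_ge0// => i _; have [] := hC i.
  move=> i v; have [Ci0 hCi] := hC i; rewrite (le_trans (hCi v))// -mulrA.
  apply: ler_pM => //.
  by rewrite (bigD1 i)//= lerDl sumr_ge0// => j _; have [] := hC j.
(* With [rho = delta / 3], the point [u] below satisfies [dot u (nrm D i) <= 2 * rho * g v], which
   stays under [delta * g u] as soon as [g v < g u]. *)
exists g, (delta / 3), (Num.max M (Num.max r^-1 K1)); split=> //.
- by move=> v; rewrite (le_trans (g_le v))// ler_wpM2r// !le_max lexx orbT.
- by move=> v; rewrite (le_trans (g_ge v))// ler_wpM2r// !le_max lexx.
- by move=> i v; rewrite (le_trans (hK1 i v))// ler_wpM2r// !le_max lexx !orbT.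
- by move=> v; exists (f v); split=> // w; exact: gmax.
- by rewrite divr_gt0.
- by rewrite lt_max M0.
move=> i v hv; set u := v + _.
have := g0 u; rewrite le_eqVlt => /predU1P[<-//|gu].
rewrite leNgt; apply/negP => gvu.
have gu_def : g u = dot (f u) u by [].
have udi : dot (f u) (dir D i) <= 0.
  have un : dot u (nrm D i) < delta * g u.
    rewrite dotDl dotZl dn1 mulr1; have := g0 v; nra.
  have [un'|un'] := ltP (- (delta * g u)) (dot u (nrm D i)).
    by rewrite (perp i u)// ltr_norml un' un.
  have un0 : dot u (nrm D i) < 0 by rewrite (le_lt_trans un')// oppr_lt0 mulr_gt0.
  (* Beyond the strip where the set-B condition applies, comparing [u] with its projection along
     [dir D i] still gives the sign of [dot (f u) (dir D i)]. *)
  have := gmax (f u) (u - dot u (nrm D i) *: dir D i) (Qf u).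
  move=> /le_trans/(_ (proj_le i u)); rewrite dotBr -gu_def dotZr.
  by rewrite lerBlDr lerDl nmulr_rge0.
move: gvu; rewrite ltNge => /negP; apply.
rewrite gu_def dotDr dotZr; have := gmax (f u) v (Qf u).
have := mulr_ge0_le0 (mulr_ge0 (ltW (divr_gt0 delta0 (ltr0n _ 3))) (g0 v)) udi.
by move=> h1 h2; rewrite -[leRHS]addr0 lerD.
Qed.

End adapted_norm_existence.

(** Real induction downwards from [t]: the infimum of the times above which [P] holds is attained by
    the limit hypothesis and, if above [s], passed by the step hypothesis. Steps reach to the left
    of [r] because increments of the constraining terms are controlled by the faces active at their
    final time. *)
Lemma backward_induction {R : realType} (P : R -> Prop) (s t : R) : s <= t -> P t ->
  (forall r, s < r <= t -> P r ->
    exists2 r0, r0 < r & forall r', r0 <= r' < r -> s <= r' -> P r') ->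
  (forall r, s <= r < t -> (forall r', r < r' <= t -> P r') -> P r) ->
  forall r, s <= r <= t -> P r.
Proof.
move=> st Pt step lim.
pose A := [set r | s <= r <= t /\ forall r', r <= r' <= t -> P r'].
have At : A t by split=> [|r']; rewrite ?st ?lexx// => r't; rewrite -(le_anti r't).
have lbA : lbound A s by move=> r [/andP[]].
have infA : has_inf A by split; [exists t|exists s].
pose a := inf A.
have sa : s <= a by apply: lb_le_inf => //; exists t.
have at_ : a <= t by apply: ge_inf => //; exists s.
have Pgt r' : a < r' <= t -> P r'.
  move=> /andP[ar' r't]; have r'a0 : 0 < r' - a by rewrite subr_gt0.
  have [r [_ Ar]] := inf_adherent r'a0 infA; rewrite -/a addrC subrK => rr'.
  by apply: Ar; rewrite (ltW rr').
have Pa : P a.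
  move: at_; rewrite le_eqVlt => /predU1P[->//|lt_at].
  by apply: lim => //; rewrite sa.
have Age r' : a <= r' <= t -> P r'.
  by rewrite le_eqVlt => /andP[/predU1P[<-//|ar'] r't]; apply: Pgt; rewrite ar'.
move: sa; rewrite le_eqVlt => /predU1P[-> //|sa].
have [|r0 r0a hr0] := step a _ Pa; first by rewrite sa.
have : A (Num.max r0 s).
  split; first by rewrite le_max lexx orbT/= ge_max (le_trans (ltW r0a))// st.
  move=> r' /andP[]; rewrite ge_max => /andP[r0r' sr'] r't.
  have [ar'|r'a] := leP a r'; first by apply: Age; rewrite ar'.
  by apply: hr0 => //; rewrite r0r'.
by move=> /(ge_inf (ex_intro _ s lbA)); rewrite -/a leNgt gt_max r0a sa.
Qed.

(** * Spans of directions and the subspaces orthogonal to normals *)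

Section linear_spans.
Context {R : realType} {J N : nat} (D : esp_data R J N).
Implicit Types (u v w : 'rV[R]_J) (P : set 'I_N).

(** Coefficients are indexed by all of ['I_N] with support in [P], so that combinations add
    coefficientwise without reindexing. *)
Definition lin P : set 'rV[R]_J :=
  [set v | exists a : 'I_N -> R, (forall i, a i != 0 -> P i) /\
    v = \sum_i a i *: dir D i].

(** For [P = active D x] this is [Hset D x]. *)
Definition annih P : set 'rV[R]_J := [set v | forall i, P i -> dot v (nrm D i) = 0].

Lemma lin0 P : lin P 0.
Proof.
exists (fun=> 0); split=> [i|]; first by rewrite eqxx.
by rewrite big1// => i _; rewrite scale0r.
Qed.

Lemma linD P u v : lin P u -> lin P v -> lin P (u + v).
Proof.
move=> [a [aP ->]] [b [bP ->]]; exists (fun i => a i + b i); split=> [i|].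
  have [a0|/aP//] := eqVneq (a i) 0; have [b0|/bP//] := eqVneq (b i) 0.
  by rewrite a0 b0 addr0 eqxx.
by rewrite -big_split; apply: eq_bigr => i _; rewrite scalerDl.
Qed.

Lemma linZ P c v : lin P v -> lin P (c *: v).
Proof.
move=> [a [aP ->]]; exists (fun i => c * a i); split=> [i|].
  by rewrite mulf_eq0 negb_or => /andP[_ /aP].
by rewrite scaler_sumr; apply: eq_bigr => i _; rewrite scalerA.
Qed.

Lemma linN P v : lin P v -> lin P (- v).
Proof. by rewrite -scaleN1r; exact: linZ. Qed.

Lemma linB P u v : lin P u -> lin P v -> lin P (u - v).
Proof. by move=> Pu /linN; exact: linD. Qed.

Lemma lin_sub P P' v : P `<=` P' -> lin P v -> lin P' v.
Proof. by move=> PP' [a [aP ->]]; exists a; split=> // i /aP /PP'. Qed.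

Lemma lin_dir P i : P i -> lin P (dir D i).
Proof.
move=> Pi; exists (fun j => (j == i)%:R); split=> [j|].
  by have [->//|_] := eqVneq j i; rewrite eqxx.
rewrite (bigD1 i)//= big1 ?addr0 ?eqxx ?scale1r// => j /negbTE ->.
by rewrite scale0r.
Qed.

Lemma lin_sum P n (a : 'I_n -> R) (w : 'I_n -> 'rV[R]_J) :
  (forall k, lin P (w k)) -> lin P (\sum_k a k *: w k).
Proof. by move=> h; elim/big_ind: _ => [|u v|k _]; [exact: lin0|exact: linD|exact: linZ]. Qed.

(** [lin P] is the row space of a matrix, hence cut out by the finitely many linear equations given
    by the columns of [cokermx M]. *)
Lemma closed_lin P : closed (lin P).
Proof.
pose M : 'M[R]_(N, J) := \matrix_i (if `[< P i >] then dir D i else 0).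
have linE v : lin P v <-> v *m cokermx M = 0.
  split=> [[a [aP ->]]|/eqP h].
    rewrite mulmx_suml big1// => i _; rewrite -scalemxAl.
    have [->|/aP Pi] := eqVneq (a i) 0; first by rewrite scale0r.
    have : (dir D i <= M)%MS.
      have -> : dir D i = row i M by rewrite rowK asboolT.
      exact: row_sub.
    by rewrite submxE => /eqP ->; rewrite scaler0.
  have /submxP[a ->] : (v <= M)%MS by rewrite submxE h.
  rewrite mulmx_sum_row; apply: lin_sum => i; rewrite rowK.
  by case: asboolP => [Pi|_]; [exact: lin_dir|exact: lin0].
rewrite (_ : lin P = \bigcap_(k in setT) [set v | dot v (col k (cokermx M))^T = 0]).
  apply: closed_bigI => k _; apply: (preimage_closed _ (@closed_eq _ 0)) => v _.
  exact: continuous_dotr.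
have dotE v k : dot v (col k (cokermx M))^T = (v *m cokermx M) ord0 k.
  by rewrite !mxE; apply: eq_bigr => j _; rewrite !mxE.
apply/seteqP; split=> v.
  by move=> /linE h k _ /=; rewrite dotE h mxE.
by move=> h; apply/linE/rowP => k; rewrite -dotE mxE; exact: h.
Qed.

End linear_spans.

(** * Monotonicity of the adapted norm along constrained increments *)

Section adapted_norm_theory.
Context {R : realType} {J N : nat} (D : esp_data R J N) (g : 'rV[R]_J -> R) (rho K : R).
Hypothesis gA : adapted_norm D g rho K.
Implicit Types (u v w k : 'rV[R]_J) (P : set 'I_N).

Lemma adapted0 : g 0 = 0.
Proof. by rewrite -(scale0r 0) (adapted_Z gA) normr0 mul0r. Qed.

Lemma adapted_ge0 v : 0 <= g v.
Proof. by rewrite -(pmulr_rge0 _ (adapted_K gA)) (le_trans _ (adapted_ge gA v)). Qed.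

Lemma adapted_eq0 v : g v = 0 -> v = 0.
Proof.
by move=> h; apply/eqP; rewrite -normr_le0 (le_trans (adapted_ge gA v))// h mulr0.
Qed.

Lemma adaptedN v : g (- v) = g v.
Proof. by rewrite -scaleN1r (adapted_Z gA) normrN1 mul1r. Qed.

Lemma adaptedB u v : g (u - v) <= g u + g v.
Proof. by rewrite -(adaptedN v) (adapted_D gA). Qed.

Lemma adaptedC u v : g (u - v) = g (v - u).
Proof. by rewrite -adaptedN opprB. Qed.

(* The infinitesimal form of [adapted_flat]: a functional that is nearly norming
   at [v] is nearly nonpositive on [dir i] as soon as [v] is not far inside the
   [i]-th half-space. *)
Lemma supp_le nu v i : (forall w, dot nu w <= g w) ->
  dot v (nrm D i) <= rho * g v ->
  rho * g v * dot nu (dir D i) <= g v - dot nu v.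
Proof.
move=> nug /(adapted_flat gA) h; have := le_trans (nug _) h.
by rewrite dotDr dotZr lerBrDl.
Qed.

Lemma supp_ge nu v i : (forall w, dot nu w <= g w) ->
  - (rho * g v) <= dot v (nrm D i) ->
  - (rho * g v * dot nu (dir D i)) <= g v - dot nu v.
Proof.
move=> nug h; have nug' w : dot (- nu) w <= g w by rewrite dotNl -dotNr -(adaptedN w).
have := @supp_le (- nu) (- v) i nug'.
by rewrite adaptedN !dotNl dotNr opprK mulrN lerNl => /(_ h).
Qed.

(** By [supp_le] and [supp_ge] a functional norming [h] vanishes on every [dir D i] with [i] in [P],
    so it takes the value [g h] at [v] as well. Thus the projection onto [annih] along [lin] has
    norm at most 1. *)
Lemma annih_le P h v : annih D P h -> lin D P (v - h) -> g h <= g v.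
Proof.
move=> Ph [a [aP e]]; have [nu [nug nuh]] := adapted_supp gA h.
have [h0|h0] := eqVneq (g h) 0; first by rewrite h0 adapted_ge0.
have gh : 0 < rho * g h.
  by rewrite mulr_gt0 ?(adapted_rho gA)// lt_neqAle eq_sym h0 adapted_ge0.
rewrite -nuh (_ : dot nu h = dot nu v)//.
apply/esym/eqP; rewrite -subr_eq0 -dotBr e dot_sumr big1// => i _; rewrite dotZr.
have [->|/aP Pi] := eqVneq (a i) 0; first by rewrite mul0r.
have hi : dot h (nrm D i) = 0 by exact: Ph.
have := @supp_le nu h i nug; rewrite hi nuh subrr ltW// => /(_ isT).
have := @supp_ge nu h i nug; rewrite hi nuh subrr oppr_le0 ltW// => /(_ isT).
rewrite oppr_le0 pmulr_rge0// pmulr_rle0// => h1 h2.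
by rewrite (_ : dot _ _ = 0) ?mulr0//; apply/eqP; rewrite eq_le h1 h2.
Qed.

(** [annih_le] compares [v] with 0. Hence a splitting along [annih] and [lin] is unique. *)
Lemma annih_lin0 P v : annih D P v -> lin D P v -> v = 0.
Proof.
move=> Pv Lv; apply: adapted_eq0; apply/eqP; rewrite eq_le adapted_ge0 andbT.
by rewrite -adapted0 (annih_le Pv)// sub0r; exact: linN.
Qed.

(* Two solutions of the ESP, with constraining terms Y1 and Y2: the difference
   k = Y2 - Y1 can move along [+ dir i] only when the second path is on face [i],
   hence <k, nrm i> <= om, where [om] bounds the difference of the drivers, and
   along [- dir i] only in the symmetric situation. *)
Definition sgn_step P (om : R) (k1 k0 : 'rV[R]_J) : Prop :=
  exists a : 'I_N -> R, [/\ k1 - k0 = \sum_i a i *: dir D i,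
    forall i, a i != 0 -> P i,
    forall i, 0 < a i -> dot k1 (nrm D i) <= om &
    forall i, a i < 0 -> - om <= dot k1 (nrm D i)].

(** A functional norming the later value [k1] is nonpositive on each term [a i *: dir D i], so its
    value at [k0] is at least [g k1]. *)
Lemma sgn_step_le P om k1 k0 : sgn_step P om k1 k0 -> 
  om <= rho * g k1 -> g k1 <= g k0.
Proof.
move=> [a [e _ ap an]] omk; have [nu [nug nuh]] := adapted_supp gA k1.
have [k10|k10] := eqVneq (g k1) 0; first by rewrite k10 adapted_ge0.
have gh : 0 < rho * g k1.
  by rewrite mulr_gt0 ?(adapted_rho gA)// lt_neqAle eq_sym k10 adapted_ge0.
rewrite -nuh; apply: le_trans (nug k0); rewrite -subr_le0 -dotBr e dot_sumr.
apply: sumr_le0 => i _; rewrite dotZr; case: (ltgtP (a i) 0) => ai.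
- apply: mulr_le0_ge0; first exact: ltW.
  have := @supp_ge nu k1 i nug; rewrite nuh subrr oppr_le0 pmulr_rge0//; apply.
  by rewrite (le_trans _ (an i ai))// lerN2.
- apply: mulr_ge0_le0; first exact: ltW.
  have := @supp_le nu k1 i nug; rewrite nuh subrr pmulr_rle0//; apply.
  by rewrite (le_trans (ap i ai)).
- by rewrite ai mul0r.
Qed.

(** The two clauses feed the step and the limit hypotheses of [backward_induction]; the second is
    right continuity of [k]. *)
Definition resolving P (om s t : R) (k : R -> 'rV[R]_J) : Prop :=
  (forall r, s < r <= t -> exists2 r0, r0 < r & forall r', r0 <= r' < r -> s <= r' ->
     sgn_step P om (k r) (k r')) /\
  (forall r e, s <= r < t -> 0 < e -> exists2 r1, r < r1 & forall r', r < r' < r1 ->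
     r' <= t -> g (k r' - k r) <= e).

(** If [g (k t)] exceeded [m], then going backwards [g (k r)] would stay above [m], where the
    threshold of [sgn_step_le] is met; this contradicts the bound at [s]. *)
Lemma resolving_le P om s t (k : R -> 'rV[R]_J) m : s <= t -> resolving P om s t k ->
  g (k s) <= m -> om <= rho * m -> g (k t) <= m.
Proof.
move=> st [stp cont] gs omm; rewrite leNgt; apply/negP => gt.
suff : g (k t) <= g (k s) by rewrite leNgt (le_lt_trans gs).
apply: (@backward_induction _ (fun r => g (k t) <= g (k r)) s t); rewrite ?lexx ?st//.
  move=> r srt ktr; have [r0 r0r hr0] := stp r srt; exists r0 => // r' r0r' sr'.
  apply: (le_trans ktr); apply: sgn_step_le (hr0 r' r0r' sr') _.
  by rewrite (le_trans omm)// ler_wpM2l ?ltW ?(adapted_rho gA)// (lt_le_trans gt).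
move=> r srt h; apply/ler_addgt0Pr => e e0.
have [r1 rr1 hr1] := cont r e srt e0; have /andP[sr rt] := srt.
pose r' := Num.min ((r + r1) / 2) t.
have rr' : r < r' by rewrite lt_min midf_lt.
have r't : r' <= t by rewrite ge_min lexx orbT.
have r'r1 : r' < r1 by rewrite gt_min midf_lt.
have := hr1 r'; rewrite rr' r'r1 => /(_ isT r't).
have := h r'; rewrite rr' r't => /(_ isT) h1 h2; apply: (le_trans h1).
by rewrite -{1}[k r'](subrK (k r)) addrC (le_trans (adapted_D gA _ _))// lerD.
Qed.

End adapted_norm_theory.

Lemma nbhs_row {R : realType} {J : nat} (u : 'rV[R]_J) (P : set 'rV[R]_J) (e : R) :
  0 < e -> (forall v, `|u - v| < e -> P v) -> \forall v \near u, P v.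
Proof. by move=> e0 h; apply/(@nbhs_normP R 'rV[R]_J u); exists e. Qed.

(** * The uniform contraction factor *)

Section contraction.
Context {R : realType} {J N : nat} (D : esp_data R J N) (g : 'rV[R]_J -> R) (rho K : R).
Hypothesis gA : adapted_norm D g rho K.
Implicit Types (u v w : 'rV[R]_J) (k : R -> 'rV[R]_J) (P : set 'I_N).

Lemma adapted_lip u v : `|g u - g v| <= K * `|u - v|.
Proof.
rewrite (le_trans _ (adapted_le gA _))// ler_norml; apply/andP; split.
  by rewrite lerNl opprB lerBlDr (adaptedC gA) -{1}[v](subrK u) (adapted_D gA).
by rewrite lerBlDr -{1}[u](subrK v) (adapted_D gA).
Qed.

Lemma continuous_adapted : continuous g.
Proof.
move=> u; apply/(cvgrPdist_le (FF := nbhs_filter u)) => e e0.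
apply: (@nbhs_row _ _ _ _ (e / K)); first by rewrite divr_gt0 ?(adapted_K gA).
move=> v uv; rewrite (le_trans (adapted_lip _ _))// mulrC -ler_pdivlMr ?(adapted_K gA)//.
exact: ltW.
Qed.

(* Compactness of the unit sphere gives a gap, uniform in [v], between 0 and the
   nonzero values of [|dot nu (dir i)|]; the price is that [nu] is only nearly
   norming at [v]. *)
Lemma uniform_supp : exists2 th0 : R, 0 < th0 & forall v, g v = 1 ->
  exists nu, exists2 th, th0 <= th <= 1 / 4 & [/\ forall w, dot nu w <= g w,
    1 - th <= dot nu v &
    forall i, dot nu (dir D i) = 0 \/ 2 * th < rho * `|dot nu (dir D i)| ].
Proof.
pose S := [set v | g v = 1].
have cS : compact S.
  apply: bounded_closed_compact.
    exists K; split=> [|x Kx v /= gv]; first by rewrite num_real.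
    by rewrite (le_trans (adapted_ge gA v))// gv mulr1 ltW.
  by apply: (preimage_closed _ (@closed_eq _ 1)) => v _; exact: continuous_adapted.
pose Q (th0 : R) v := exists nu, exists2 th, th0 <= th <= 1 / 4 &
  [/\ forall w, dot nu w <= g w, 1 - th <= dot nu v &
    forall i, dot nu (dir D i) = 0 \/ 2 * th < rho * `|dot nu (dir D i)| ].
have /compact_near_coveringP cov := cS.
have h : forall x, S x -> \forall x' \near x & i \near 0^'+, Q i x'.
  move=> x gx; have [nu [nug nux]] := adapted_supp gA x.
  (* There are finitely many directions, so one threshold lies below all nonzero values. *)
  have near_th : \forall th \near 0^'+, forall i,
      dot nu (dir D i) = 0 \/ 2 * th < rho * `|dot nu (dir D i)|.
    apply: filter_forall => i; have [->|nui] := eqVneq (dot nu (dir D i)) 0.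
      by apply: filterE => th; left.
    have c0 : 0 < rho * `|dot nu (dir D i)| / 2.
      by rewrite divr_gt0// mulr_gt0 ?(adapted_rho gA)// normr_gt0.
    by apply: filterS (nbhs_right_lt c0) => th h; right; rewrite mulrC -ltr_pdivlMr.
  have /filter_ex[th [[hth th4] th0]] : \forall th \near 0^'+, ((forall i,
      dot nu (dir D i) = 0 \/ 2 * th < rho * `|dot nu (dir D i)|) /\ th <= 1 / 4) /\ 0 < th.
    have th4 : \forall th \near 0^'+, th <= 1 / 4 :> R by apply: nbhs_right_le; rewrite divr_gt0.
    by apply: filterS3 near_th th4 (nbhs_right_gt 0) => th.
  have nbx : \forall x' \near x, 1 - th <= dot nu x'.
    apply: (@nbhs_row _ _ _ _ (th / K)); first by rewrite divr_gt0 ?(adapted_K gA).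
    move=> x' xx'; rewrite -gx -nux lerBlDr -lerBlDl -dotBr (le_trans (nug _))//.
    rewrite (le_trans (adapted_le gA _))// mulrC -ler_pdivlMr ?(adapted_K gA)//.
    exact: ltW.
  have nbi : \forall i \near 0^'+, i <= th by exact: nbhs_right_le.
  exists ([set x' | 1 - th <= dot nu x'], [set i | i <= th]); first by split.
  by move=> [x' i] [/= h1 h2]; exists nu, th; rewrite ?h2.
have h' : (0 : R)^'+ (fun i => S `<=` Q i) := cov R (0 : R)^'+ Q (at_right_proper_filter 0) h.
have [th0 [hth0 th00]] := @filter_ex _ _ (at_right_proper_filter 0) _
  (@filterI _ _ (at_right_proper_filter 0) _ _ h' (nbhs_right_gt 0)).
by exists th0 => // v /hth0.
Qed.

(** The conditions on [q] hold when both paths touch each face of [P]: contact of the second path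
    bounds [dot (k q) (nrm D i)] above, contact of the first bounds it below. The factor 2 in
    [2 * om] allows for [g (k r)] being as small as [m / 2] on the way, which is where [th <= 1 / 4]
    enters. *)
Lemma uniform_contraction : exists2 al : R, 0 <= al < 1 &
  forall P om s t k m, s <= t -> resolving D g P om s t k -> lin D P (k t) ->
    g (k s) <= m -> 2 * om <= rho * m ->
    (forall i, P i -> (exists2 q, s <= q <= t & dot (k q) (nrm D i) <= om) /\
                      (exists2 q, s <= q <= t & - om <= dot (k q) (nrm D i))) ->
  g (k t) <= al * m.
Proof.
have [th0 th00 hth0] := uniform_supp; have rho0 := adapted_rho gA.
(* If the unit sphere is empty, [th0] is only known to be positive; hence the maximum with 0. *)
exists (Num.max 0 (1 - th0)); first by rewrite le_max lexx/= gt_max ltr01 ltrBlDr ltrDl.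
move=> P om s t k m st res lkt gs omm hit; rewrite leNgt; apply/negP => gt.
have m0 : 0 <= m by rewrite (le_trans _ gs)// (adapted_ge0 gA).
have omm' : om <= rho * m by have := mulr_ge0 (ltW rho0) m0; lra.
have gkm r : s <= r <= t -> g (k r) <= m.
  move=> /andP[sr rt]; apply: (resolving_le gA sr _ gs omm').
  have [h1 h2] := res; split.
    by move=> r' /andP[sr' r'r]; apply: h1; rewrite sr' (le_trans r'r).
  move=> r' e /andP[sr' r'r] e0.
  have [|//|r1 r'r1 h] := h2 r' e; first by rewrite sr' (lt_le_trans r'r).
  by exists r1 => // r'' hr'' r''r; apply: h => //; rewrite (le_trans r''r).
have gt0 : 0 < g (k t).
  by rewrite (le_lt_trans _ gt)// mulr_ge0// le_max lexx.
have mp : 0 < m by rewrite (lt_le_trans gt0)// gkm// st lexx.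
have gt' : (1 - th0) * m < g (k t).
  by rewrite (le_lt_trans _ gt)// ler_wpM2r// le_max lexx orbT.
have [|nu [th /andP[th0th th4] [nug nukt nui]]] := hth0 ((g (k t))^-1 *: k t).
  by rewrite (adapted_Z gA) gtr0_norm ?invr_gt0// mulVf// gt_eqF.
(* [g (k t)] loses at most the fraction [th0] of [m], and [nu] at most the fraction [th] of that;
   since [th0 <= th], the total loss is at most [2 * th]. *)
have {}nukt : (1 - 2 * th) * m <= dot nu (k t).
  move: nukt; rewrite dotZr mulrC ler_pdivlMr// => /(le_trans _); apply.
  have h1 : (1 - th) * ((1 - th0) * m) <= (1 - th) * g (k t).
    by rewrite ler_wpM2l ?ltW//; lra.
  have h2 : 0 <= m * (th * th0) by rewrite !mulr_ge0//; lra.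
  have h3 : 0 <= m * (th - th0) by rewrite !mulr_ge0//; lra.
  lra.
(* Being norming up to [2 * th], the functional satisfies [rho * dot nu (dir D i) <= 2 * th] on the
   relevant side; the gap from [uniform_supp] turns this into an exact sign. *)
have big r : s <= r <= t -> (1 - 2 * th) * m <= dot nu (k r) ->
    om <= rho * g (k r) /\ forall i, (dot (k r) (nrm D i) <= om -> dot nu (dir D i) <= 0) /\
      (- om <= dot (k r) (nrm D i) -> 0 <= dot nu (dir D i)).
  move=> srt h; have gm := gkm r srt.
  have h2 : m / 2 <= g (k r) by have := nug (k r); nra.
  have omg : om <= rho * g (k r) by nra.
  have gp : 0 < g (k r) by lra.
  split=> // i; split=> hi.
    have := supp_le gA nug (le_trans hi omg).
    case: (nui i) => [->//|]; case: (ler0P (dot nu (dir D i))) => // c0 hc hc'.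
    have : rho * g (k r) * dot nu (dir D i) <= 2 * th * g (k r) by nra.
    by rewrite mulrAC ler_pM2r// leNgt hc.
  have hi' : - (rho * g (k r)) <= dot (k r) (nrm D i) by rewrite (le_trans _ hi)// lerN2.
  have := supp_ge gA nug hi'.
  case: (nui i) => [->//|]; case: (ger0P (dot nu (dir D i))) => // c0 hc hc'.
  have : rho * g (k r) * - dot nu (dir D i) <= 2 * th * g (k r) by rewrite mulrN; nra.
  by rewrite mulrAC ler_pM2r// leNgt hc.
have back : forall r, s <= r <= t -> (1 - 2 * th) * m <= dot nu (k r).
  apply: backward_induction => //.
    move=> r srt hr; have [h1 _] := res; have [r0 r0r hr0] := h1 r srt.
    have srt' : s <= r <= t by case/andP: srt => /ltW -> ->.
    exists r0 => // r' r0r' sr'; apply: (le_trans hr).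
    have [a [e _ ap an]] := hr0 r' r0r' sr'; have [_ hb] := big r srt' hr.
    rewrite -subr_le0 -dotBr e dot_sumr; apply: sumr_le0 => i _; rewrite dotZr.
    have [hb1 hb2] := hb i; case: (ltgtP (a i) 0) => ai.
    - by apply: mulr_le0_ge0; [exact: ltW|exact/hb2/an].
    - by apply: mulr_ge0_le0; [exact: ltW|exact/hb1/ap].
    - by rewrite ai mul0r.
  move=> r srt h; apply/ler_addgt0Pr => e e0; have [_ cont] := res.
  have [r1 rr1 hr1] := cont r e srt e0; have /andP[sr rt] := srt.
  pose r' := Num.min ((r + r1) / 2) t.
  have rr' : r < r' by rewrite lt_min midf_lt.
  have r't : r' <= t by rewrite ge_min lexx orbT.
  have r'r1 : r' < r1 by rewrite gt_min midf_lt.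
  have := hr1 r'; rewrite rr' r'r1 => /(_ isT r't) h2.
  have := h r'; rewrite rr' r't => /(_ isT) h1; apply: (le_trans h1).
  rewrite -{1}[k r'](subrK (k r)) addrC dotDr lerD//.
  exact: le_trans (nug _) h2.
have [a [aP e]] := lkt.
have : dot nu (k t) = 0.
  rewrite e dot_sumr big1// => i _; rewrite dotZr.
  have [->|/aP Pi] := eqVneq (a i) 0; first by rewrite mul0r.
  have [[q sqt hq] [q' sq't hq']] := hit i Pi.
  have [_ /(_ i)[/(_ hq) h1 _]] := big q sqt (back q sqt).
  have [_ /(_ i)[_ /(_ hq') h2]] := big q' sq't (back q' sq't).
  by rewrite (_ : dot _ _ = 0) ?mulr0//; apply/eqP; rewrite eq_le h1 h2.
move=> h; move: nukt; rewrite h leNgt => /negP; apply.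
by rewrite mulr_gt0//; lra.
Qed.

End contraction.

(** * Active faces and the Lipschitz estimate for the ESP *)

Section esp_data_theory.
Context {R : realType} {J N : nat} (D : esp_data R J N).
Implicit Types (x y v w : 'rV[R]_J) (i : 'I_N) (P : set 'I_N).
Implicit Types (X Y Z : R -> 'rV[R]_J).

Lemma continuous_pathP (f : R -> 'rV[R]_J) : continuous_path f ->
  forall t, 0 <= t -> forall e : R, 0 < e ->
  exists2 d, 0 < d & forall r, 0 <= r -> `|r - t| < d -> `|f r - f t| <= e.
Proof.
move=> /subspace_continuousP cf t t0 e e0; have := cf t t0.
move=> /cvgrPdist_le/(_ e e0) /nbhs_ballP[d d0 hd]; exists d => // r r0 rt.
by rewrite distrC; apply: hd => //; rewrite -ball_normE /ball_ /= distrC.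
Qed.

Lemma continuous_path_shift (f h : R -> 'rV[R]_J) (e : R) :
  continuous_path f -> continuous_path h -> continuous_path (fun s => f s + e *: h s).
Proof.
move=> /subspace_continuousP cf /subspace_continuousP ch.
apply/subspace_continuousP => t t0; apply: cvgD; first exact: cf.
by apply: cvgZr; exact: ch.
Qed.

(** The equality alone puts [x] on the boundary: a move along [- dir D i] leaves the domain. *)
Lemma activeE x i : (forall j, dot (dir D j) (nrm D j) = 1) -> Gset D x ->
  active D x i <-> dot x (nrm D i) = Defs.cst D i.
Proof.
move=> dn1 Gx; split=> [[]//|xi]; split=> //; split; first exact: subset_closure.
move=> /interior_normP[r r0 hr].
pose c := r / (`|dir D i| + 1).
have c0 : 0 < c by rewrite divr_gt0// ltr_wpDl.
have /(_ i) : Gset D (x - c *: dir D i).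
  apply: hr; rewrite opprB addrC subrK normrZ gtr0_norm// /c mulrAC ler_pdivrMr ?ltr_wpDl//.
  by rewrite ler_pM2l// lerDl.
by rewrite dotBl dotZl dn1 mulr1 xi leNgt ltrBlDr ltrDl c0.
Qed.

Definition conic P : set 'rV[R]_J :=
  [set v | exists a : 'I_N -> R, [/\ forall i, 0 <= a i, forall i, a i != 0 -> P i &
    v = \sum_i a i *: dir D i]].

Lemma conic_lin P v : conic P v -> lin D P v.
Proof. by move=> [a [_ aP e]]; exists a. Qed.

Lemma conic_sum P n (a : 'I_n -> R) (w : 'I_n -> 'rV[R]_J) :
  (forall k, 0 <= a k) -> (forall k, conic P (w k)) -> conic P (\sum_k a k *: w k).
Proof.
move=> a0 Pw; elim/big_rec: _ => [|k v _ [b [b0 bP ->]]].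
  exists (fun=> 0); split=> // [i|]; first by rewrite eqxx.
  by rewrite big1// => i _; rewrite scale0r.
have [c [c0 cP ->]] := Pw k; exists (fun i => a k * c i + b i); split=> [i|i|].
- by rewrite addr_ge0// mulr_ge0.
- have [ci0|/cP//] := eqVneq (c i) 0; have [bi0|/bP//] := eqVneq (b i) 0.
  by rewrite ci0 bi0 mulr0 addr0 eqxx.
- rewrite scaler_sumr -big_split; apply: eq_bigr => i _.
  by rewrite scalerDl scalerA.
Qed.

Lemma conic_dir P i : P i -> conic P (dir D i).
Proof.
move=> Pi; exists (fun j => (j == i)%:R); split=> [j|j|].
- exact: ler0n.
- by have [->//|_] := eqVneq j i; rewrite eqxx.
- rewrite (bigD1 i)//= big1 ?addr0 ?eqxx ?scale1r// => j /negbTE ->.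
  by rewrite scale0r.
Qed.

Lemma conic_sub P P' v : P `<=` P' -> conic P v -> conic P' v.
Proof. by move=> PP' [a [a0 aP ->]]; exists a; split=> // i /aP /PP'. Qed.

Lemma dcone_conic x v : dcone D x v -> conic (active D x) v.
Proof.
by move=> [m [a [w [a0 wP ->]]]]; apply: conic_sum => // k; have [i ? <-] := wP k; exact: conic_dir.
Qed.

Lemma dcone_dir x i : active D x i -> dcone D x (dir D i).
Proof.
move=> xi; exists 1%N, (fun=> 1), (fun=> dir D i); split=> // [k|].
  by exists i.
by rewrite big_ord1 scale1r.
Qed.

Lemma dcone0 x : dcone D x 0.
Proof.
exists 0%N, (fun=> 0), (fun=> 0); split=> // [[]//|].
by rewrite big_ord0.
Qed.

Definition hit Z (U : set R) : set 'I_N := [set i | exists2 u, U u & active D (Z u) i].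

Lemma cone_hit Z (U : set R) v :
  cone (\bigcup_(u in U) dcone D (Z u)) v -> conic (hit Z U) v.
Proof.
move=> [m [a [w [a0 wP ->]]]]; apply: conic_sum => // k; have [u Uu /dcone_conic] := wP k.
by apply: conic_sub => i; exists u.
Qed.

Lemma span_hit Z (U : set R) v :
  Defs.span (\bigcup_(u in U) dcone D (Z u)) v -> lin D (hit Z U) v.
Proof.
move=> [m [a [w [wP ->]]]]; apply: lin_sum => k; have [u Uu /dcone_conic/conic_lin] := wP k.
by apply: lin_sub => i; exists u.
Qed.

Lemma hit_span Z (U : set R) v : U !=set0 ->
  lin D (hit Z U) v -> Defs.span (\bigcup_(u in U) dcone D (Z u)) v.
Proof.
(* Directions with coefficient 0 may belong to no visited face; they are replaced by 0, taken from
   the cone at [u]. *)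
move=> [u Uu] [a [aP ->]]; exists N, a, (fun i => if a i == 0 then 0 else dir D i); split=> [i|].
  case: eqP => [_|/eqP/aP[u' Uu' ui]]; last by exists u' => //; exact: dcone_dir.
  by exists u => //; exact: dcone0.
by apply: eq_bigr => i _; case: eqP => [->|//]; rewrite !scale0r.
Qed.

Lemma span_dcone x v : Defs.span (dcone D x) v <-> lin D (active D x) v.
Proof.
split=> [[m [a [w [wP ->]]]]|[a [aP ->]]].
  by apply: lin_sum => k; exact/conic_lin/dcone_conic.
exists N, a, (fun i => if a i == 0 then 0 else dir D i); split=> [i|].
  case: eqP => [_|/eqP/aP ui]; last exact: dcone_dir.
  exact: dcone0.
by apply: eq_bigr => i _; case: eqP => [->|//]; rewrite !scale0r.
Qed.

Lemma span_decomposition x : Defs.span (Hset D x `|` dcone D x) = setT ->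
  forall v, exists2 h, annih D (active D x) h & lin D (active D x) (v - h).
Proof.
move=> full v; have : (Defs.span (Hset D x `|` dcone D x)) v by rewrite full.
move=> [m [a [w [wP ->]]]]; elim/big_rec: _ => [|k u _ [h hP lh]].
  exists 0 => [i _|]; first exact: dot0l.
  by rewrite subrr; exact: lin0.
have [Hw|/dcone_conic/conic_lin Lw] := wP k.
  exists (a k *: w k + h) => [i xi|]; first by rewrite dotDl dotZl (Hw i xi) mulr0 add0r hP.
  by rewrite opprD addrACA subrr add0r.
by exists h => //; rewrite -addrA; apply: linD => //; exact: linZ.
Qed.

Hypothesis dn1 : forall i, dot (dir D i) (nrm D i) = 1.

(** Each of the finitely many inactive constraints is slack by a positive margin, which a small
    displacement cannot use up. *)
Lemma active_nbhs x : Gset D x ->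
  exists2 d, 0 < d & forall y, Gset D y -> `|y - x| <= d -> active D y `<=` active D x.
Proof.
move=> Gx.
have : \forall d \near (0 : R)^'+, forall i, forall y, Gset D y -> `|y - x| <= d ->
    active D y i -> active D x i.
  apply: filter_forall => i; have [xi|xi] := pselect (active D x i).
    exact: filterE.
  have gap : 0 < dot x (nrm D i) - Defs.cst D i.
    rewrite subr_gt0 lt_neqAle (Gx i) andbT eq_sym.
    by apply/eqP => h; apply: xi; apply/(activeE _ dn1 Gx).
  have [C C0 hC] := dot_le_norm (nrm D i).
  have C1 : 0 < C + 1 by rewrite ltr_wpDl.
  have e0 : 0 < (dot x (nrm D i) - Defs.cst D i) / (C + 1) / 2 by rewrite !divr_gt0.
  apply: filterS (nbhs_right_le e0) => d' d'd y Gy yx /(activeE _ dn1 Gy) yi.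
  have := le_trans yx d'd; rewrite mulrAC ler_pdivlMr// => h2.
  have := hC (x - y); rewrite dotBl yi gtr0_norm// distrC => h1.
  suff : False by [].
  have := normr_ge0 (y - x); lra.
move=> h; have [d [hd d0]] := @filter_ex _ _ (at_right_proper_filter 0) _
  (@filterI _ _ (at_right_proper_filter 0) _ _ h (nbhs_right_gt 0)).
by exists d => // y Gy yd i; exact: hd.
Qed.

Lemma active_usc Z t : continuous_path Z -> (forall r, 0 <= r -> Gset D (Z r)) -> 0 <= t ->
  exists2 d, 0 < d & forall r, 0 <= r -> `|r - t| < d -> active D (Z r) `<=` active D (Z t).
Proof.
move=> cZ GZ t0; have [e e0 he] := active_nbhs (GZ t t0).
have [d d0 hd] := continuous_pathP cZ t0 e0.
by exists d => // r r0 rt; apply: he; [exact: GZ|exact: hd].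
Qed.

Lemma esp_conic X Z Y s t : solves_ESP D X Z Y -> 0 <= s < t ->
  conic (hit Z [set u | s < u <= t]) (Y t - Y s).
Proof.
move=> [_ _ _ h] /andP[s0 st]; have [] := h t (le_trans s0 (ltW st)).
by move=> _ _ /(_ s); rewrite s0 st => /(_ isT); exact: cone_hit.
Qed.

Lemma esp_step X Z Y t : solves_ESP D X Z Y -> 0 < t ->
  exists2 r0, r0 < t & forall r, r0 <= r < t -> 0 <= r -> conic (active D (Z t)) (Y t - Y r).
Proof.
move=> ZY t0; have [cZ _ _ h] := ZY.
have GZ r : 0 <= r -> Gset D (Z r) by move=> /h[].
have [d d0 hd] := active_usc cZ GZ (ltW t0).
exists (t - d / 2); first by rewrite ltrBlDr ltrDl divr_gt0.
move=> r /andP[r0r rt] r0; have := @esp_conic _ _ _ r t ZY; rewrite r0 rt => /(_ isT).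
apply: conic_sub => i [u /= /andP[ru ut]]; apply: hd; first by rewrite (le_trans r0)// ltW.
by rewrite ler0_norm ?subr_le0//; lra.
Qed.

Variables (g : 'rV[R]_J -> R) (rho K : R).
Hypothesis gA : adapted_norm D g rho K.

(** Arbitrary cone elements [y1] and [y2] cover both increments ending at [r] and the initial values
    of the constraining terms; the factor [c] is 1 or [e^-1]. *)
Lemma esp_sgn P X1 Z1 Y1 X2 Z2 Y2 (r c om : R) (v w y1 y2 : 'rV[R]_J) :
  0 <= r -> 0 < c ->
  solves_ESP D X1 Z1 Y1 -> solves_ESP D X2 Z2 Y2 ->
  active D (Z1 r) `<=` P -> active D (Z2 r) `<=` P ->
  (forall i, P i -> `|dot (v - c *: (Z2 r - Z1 r)) (nrm D i)| <= om) ->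
  conic (active D (Z1 r)) y1 -> conic (active D (Z2 r)) y2 ->
  v - w = c *: (y2 - y1) -> sgn_step D P om v w.
Proof.
move=> r0 c0 [_ _ _ h1] [_ _ _ h2] P1 P2 om_ [a1 [a10 a1P ->]] [a2 [a20 a2P ->]] vw.
have {h1} [_ G1 _] := h1 r r0; have {h2} [_ G2 _] := h2 r r0.
exists (fun i => c * (a2 i - a1 i)); split=> [|i|i|i].
- rewrite vw -sumrB scaler_sumr; apply: eq_bigr => i _.
  by rewrite -scalerBl scalerA.
- rewrite mulf_eq0 negb_or => /andP[_]; have [a1i|/a1P/P1//] := eqVneq (a1 i) 0.
  by rewrite a1i subr0 => /a2P/P2.
- rewrite pmulr_rgt0// subr_gt0 => ai.
  have /a2P A2 : a2 i != 0 by rewrite gt_eqF// (le_lt_trans (a10 i)).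
  have := om_ i (P2 _ A2); rewrite ler_norml dotBl dotZl dotBl => /andP[_].
  move/(activeE _ dn1 G2): A2 => ->; have := G1 i => G1i.
  rewrite lerBlDr => /le_trans; apply; rewrite gerDl pmulr_rle0//; lra.
- rewrite pmulr_rlt0// subr_lt0 => ai.
  have /a1P A1 : a1 i != 0 by rewrite gt_eqF// (le_lt_trans (a20 i)).
  have := om_ i (P1 _ A1); rewrite ler_norml dotBl dotZl dotBl => /andP[+ _].
  move/(activeE _ dn1 G1): A1 => ->; have := G2 i => G2i.
  rewrite lerBrDr; apply: le_trans; rewrite lerDl pmulr_rge0//; lra.
Qed.

Lemma esp_resolving P X1 Z1 Y1 X2 Z2 Y2 (s t c om : R) (k : R -> 'rV[R]_J) :
  0 <= s -> 0 < c ->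
  solves_ESP D X1 Z1 Y1 -> solves_ESP D X2 Z2 Y2 ->
  (forall r, s <= r <= t -> active D (Z1 r) `<=` P /\ active D (Z2 r) `<=` P) ->
  (forall r i, s <= r <= t -> P i ->
    `|dot (k r - c *: (Z2 r - Z1 r)) (nrm D i)| <= om) ->
  (forall r r', k r - k r' = c *: ((Y2 r - Y2 r') - (Y1 r - Y1 r'))) ->
  resolving D g P om s t k.
Proof.
move=> s0 c0 ZY1 ZY2 aP om_ kE; split=> [r /andP[sr rt]|r e /andP[sr rt] e0].
  have [r1 r1r h1] := esp_step ZY1 (le_lt_trans s0 sr).
  have [r2 r2r h2] := esp_step ZY2 (le_lt_trans s0 sr).
  have srt : s <= r <= t by rewrite (ltW sr).
  exists (Num.max r1 r2); first by rewrite gt_max r1r.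
  move=> r' /andP[]; rewrite ge_max => /andP[r1r' r2r'] r'r sr'.
  have [aP1 aP2] := aP r srt.
  apply: (esp_sgn (ltW (le_lt_trans s0 sr)) c0 ZY1 ZY2 aP1 aP2 _ _ _ (kE r r')).
  - by move=> i; exact: om_.
  - by apply: h1; rewrite ?r1r' ?r'r// (le_trans s0).
  - by apply: h2; rewrite ?r2r' ?r'r// (le_trans s0).
have [_ c1 _ _] := ZY1; have [_ c2 _ _] := ZY2; have K0 := adapted_K gA.
have e1 : 0 < e / (K * c) / 2 by rewrite !divr_gt0// mulr_gt0.
have r0 : 0 <= r by rewrite (le_trans s0).
have [d1 d10 h1] := continuous_pathP c1 r0 e1.
have [d2 d20 h2] := continuous_pathP c2 r0 e1.
exists (r + Num.min d1 d2); first by rewrite ltrDl lt_min d10.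
move=> r' /andP[rr' r'd] r't; rewrite kE (adapted_Z gA) gtr0_norm//.
have r'0 : 0 <= r' by rewrite (le_trans r0)// ltW.
have rd : `|r' - r| < Num.min d1 d2 by rewrite gtr0_norm ?subr_gt0// ltrBlDl.
move: rd; rewrite lt_min => /andP[/(h1 _ r'0) n1 /(h2 _ r'0) n2].
rewrite mulrC -ler_pdivlMr// (le_trans (adapted_le gA _))// mulrC -ler_pdivlMr//.
rewrite (le_trans (ler_normB _ _))// (le_trans (lerD n2 n1))// -splitr.
by rewrite invfM mulrA mulrAC.
Qed.

(** [Y2 - Y1] differs from [Z2 - Z1] by the difference of the drivers, so [resolving_le] applies
    with [m = om / rho]. For equal drivers this is uniqueness for the ESP. *)
Lemma esp_lipschitz X1 Z1 Y1 X2 Z2 Y2 (t om : R) :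
  0 <= t -> solves_ESP D X1 Z1 Y1 -> solves_ESP D X2 Z2 Y2 ->
  (forall r i, 0 <= r <= t -> `|dot (X2 r - X1 r) (nrm D i)| <= om) ->
  0 <= om -> g (Y2 t - Y1 t) <= om / rho.
Proof.
move=> t0 ZY1 ZY2 omE om0; have rho0 := adapted_rho gA.
have omd r i : 0 <= r <= t ->
    `|dot ((Y2 r - Y1 r) - 1 *: (Z2 r - Z1 r)) (nrm D i)| <= om.
  move=> rt; rewrite scale1r; have /andP[r0 _] := rt.
  have [_ _ _ /(_ r r0)[-> _ _]] := ZY1; have [_ _ _ /(_ r r0)[-> _ _]] := ZY2.
  rewrite (_ : _ - _ = - (X2 r - X1 r)); first by rewrite dotNl normrN omE.
  by apply/rowP => j; rewrite !mxE; ring.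
have res : resolving D g setT om 0 t (fun r => Y2 r - Y1 r).
  apply: (esp_resolving (lexx 0) ltr01 ZY1 ZY2) => // [r i rt _|r r']; first exact: omd.
  by apply/rowP => j; rewrite !mxE; ring.
apply: (resolving_le gA t0 res); last by rewrite mulrC divfK// gt_eqF.
rewrite /=; have [|h] := leP (g (Y2 0 - Y1 0)) (om / rho); first by [].
(* The value at time 0 is treated as a step from 0, since [Y1 0] and [Y2 0] lie in the cones at
   [Z1 0] and [Z2 0]. *)
have : g (Y2 0 - Y1 0) <= g 0.
  apply: (@sgn_step_le _ _ _ _ _ _ _ gA setT om).
    have [_ _ /dcone_conic d1 _] := ZY1; have [_ _ /dcone_conic d2 _] := ZY2.
    apply: (@esp_sgn setT _ _ _ _ _ _ 0 1 om _ _ _ _ (lexx 0) ltr01 ZY1 ZY2 _ _ _ d1 d2) => //.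
      by move=> i _; apply: omd; rewrite lexx t0.
    by rewrite subr0 scale1r.
  by rewrite mulrC -ler_pdivrMr// ltW.
by rewrite (adapted0 gA) leNgt (le_lt_trans _ h)// divr_ge0// ltW.
Qed.

End esp_data_theory.

(** * Difference quotients and their limits along a filter *)

Section perturbation.
Context {R : realType} {J N : nat} (D : esp_data R J N).
Hypothesis dn1 : forall i, dot (dir D i) (nrm D i) = 1.
Variables (g : 'rV[R]_J -> R) (rho K : R).
Hypothesis gA : adapted_norm D g rho K.
Variables (X psi Z Y : R -> 'rV[R]_J) (ZE YE : R -> R -> 'rV[R]_J).
Hypotheses (ZY : solves_ESP D X Z Y) (cpsi : continuous_path psi).
Hypothesis ZYE : forall e, solves_ESP D (fun s => X s + e *: psi s) (ZE e) (YE e).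
Implicit Types (P : set 'I_N) (h v : 'rV[R]_J) (i : 'I_N).

Let rho0 : 0 < rho := adapted_rho gA.
Let K0 : 0 < K := adapted_K gA.

Lemma dot_le_normr i v : `|dot v (nrm D i)| <= K * K * `|v|.
Proof.
by rewrite (le_trans (adapted_nrm gA i v))// -mulrA ler_wpM2l ?(adapted_le gA)// ltW.
Qed.

Lemma path_bounded (f : R -> 'rV[R]_J) T : continuous_path f ->
  exists2 M, 0 < M & forall u, 0 <= u <= T -> `|f u| <= M.
Proof.
move=> cf; have cfT : {within `[0, T], continuous f}.
  by apply: continuous_subspaceW cf => u /=; rewrite in_itv /= => /andP[].
have [M M0 hM] := compact_norm_bound (continuous_compact cfT (@segment_compact R 0 T)).
by exists M => // u uT; apply: hM; exists u => //=; rewrite in_itv.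
Qed.

Lemma perturbation_lipschitz T : 0 <= T -> exists2 M, 0 < M &
  forall e u, 0 < e -> 0 <= u <= T -> `|ZE e u - Z u| <= e * M /\ `|YE e u - Y u| <= e * M.
Proof.
move=> T0; have [M M0 hM] := path_bounded T cpsi.
pose M1 := K * (K * K * M / rho).
have M10 : 0 < M1 by rewrite mulr_gt0// divr_gt0// !mulr_gt0.
exists (M + M1); first by rewrite addr_gt0.
move=> e u e0 uT; have /andP[u0 _] := uT.
have Yle : `|YE e u - Y u| <= e * M1.
  rewrite (le_trans (adapted_ge gA _))// /M1 mulrCA ler_pM2l//.
  rewrite mulrA; apply: (esp_lipschitz dn1 gA u0 ZY (ZYE e)).
    move=> r i /andP[r0 ru]; rewrite addrAC subrr add0r dotZl normrM gtr0_norm//.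
    rewrite ler_pM2l// (le_trans (dot_le_normr _ _))// ler_pM2l ?mulr_gt0//.
    by apply: hM; rewrite r0 (le_trans ru)//; case/andP: uT.
  by rewrite mulr_ge0 ?ltW// !mulr_gt0.
split; last by rewrite (le_trans Yle)// ler_pM2l// lerDr ltW.
have [_ _ _ /(_ u u0)[-> _ _]] := ZY; have [_ _ _ /(_ u u0)[-> _ _]] := ZYE e.
rewrite (_ : _ - _ = e *: psi u + (YE e u - Y u)); last by apply/rowP => j; rewrite !mxE; ring.
by rewrite (le_trans (ler_normD _ _))// mulrDr lerD// normrZ gtr0_norm// ler_pM2l// hM.
Qed.

(** For [i] outside [P], the slack of [Z] in the [i]-th constraint has a positive minimum on
    [[s, r]], while the perturbed path is uniformly within [e * M] of [Z]. *)
Lemma perturbation_active P s r : 0 <= s ->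
  (forall u, s <= u <= r -> active D (Z u) `<=` P) ->
  \forall e \near (0 : R)^'+, forall u, s <= u <= r -> active D (ZE e u) `<=` P.
Proof.
move=> s0 aP; have [sr|rs] := leP s r; last first.
  by apply: filterE => e u /andP[su ur]; have := le_lt_trans (le_trans su ur) rs; rewrite ltxx.
have r0 : 0 <= r by exact: le_trans sr.
have [M M0 hM] := perturbation_lipschitz r0.
have [cZ _ _ solZ] := ZY.
suff : \forall e \near (0 : R)^'+, forall i u, s <= u <= r -> active D (ZE e u) i -> P i.
  by apply: filterS => e h u sur i; exact: h.
apply: filter_forall => i; have [Pi|Pi] := pselect (P i); first exact: filterE.
have cf : {within `[s, r], continuous (fun u => dot (Z u) (nrm D i))}.
  have : {within `[s, r], continuous Z}.
    by apply: continuous_subspaceW cZ => u /=; rewrite in_itv /= => /andP[su _]; exact: le_trans su.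
  move=> /subspace_continuousP h; apply/subspace_continuousP => u hu.
  exact: (continuous_cvg _ (@continuous_dotr _ _ _ _) (h u hu)).
have [u0 u0sr hmin] := EVT_min sr cf.
have /andP[su0 u0r] : s <= u0 <= r by move: u0sr; rewrite in_itv.
have gap : 0 < dot (Z u0) (nrm D i) - Defs.cst D i.
  have [_ G0 _] := solZ u0 (le_trans s0 su0).
  rewrite subr_gt0 lt_neqAle (G0 i) andbT eq_sym; apply/eqP => h; apply: Pi.
  by apply: (aP u0); [rewrite su0|apply/(activeE _ dn1 G0)].
have c0 : 0 < K * K * M by rewrite !mulr_gt0.
have c1 : 0 < (dot (Z u0) (nrm D i) - Defs.cst D i) / (K * K * M) by rewrite divr_gt0.
apply: filterS2 (nbhs_right_lt c1) (nbhs_right_gt 0) => e ec e0 u /andP[su ur].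
have u0' : 0 <= u by exact: le_trans su.
have [_ _ _ /(_ u u0')[_ GE _]] := ZYE e.
move/(activeE _ dn1 GE) => ui; exfalso.
have := hmin u; rewrite in_itv /= su ur => /(_ isT) h1.
have [|h2 _] := hM e u e0; first by rewrite u0' ur.
have := dot_le_normr i (ZE e u - Z u); rewrite dotBl ui distrC => h3.
have h4 : K * K * `|ZE e u - Z u| <= K * K * (e * M) by rewrite ler_pM2l ?mulr_gt0.
move: ec; rewrite ltr_pdivlMr// => h5; have := ler_norm (dot (Z u) (nrm D i) - Defs.cst D i); lra.
Qed.

Variables (W : set_system R) (Dl : R -> 'rV[R]_J).
Context {PW : ProperFilter W}.
Hypothesis W0 : (0 : R)^'+ `<=` W.
Hypothesis DW : forall t, 0 <= t -> (fun e => e^-1 *: (ZE e t - Z t)) @ W --> Dl t.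

Lemma W_gt0 : \forall e \near W, 0 < e.
Proof. exact: (W0 (nbhs_right_gt 0)). Qed.

(** Increment of the limit of [(YE e - Y) / e], expressed through [Dl] so that no second limit has
    to be introduced. *)
Definition inc s r := Dl r - Dl s - (psi r - psi s).

Lemma inc_add s r t : inc s r + inc r t = inc s t.
Proof. by apply/rowP => j; rewrite !mxE; ring. Qed.

Lemma cvg_inc s r : 0 <= s -> 0 <= r ->
  (fun e => e^-1 *: ((YE e r - YE e s) - (Y r - Y s))) @ W --> inc s r.
Proof.
move=> s0 r0.
have h : (fun e => e^-1 *: (ZE e r - Z r) - e^-1 *: (ZE e s - Z s) - (psi r - psi s))
    @ W --> inc s r.
  by apply: cvgB; [apply: cvgB; exact: DW|exact: cvg_cst].
apply: cvg_trans h; apply: near_eq_cvg.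
apply: filterS W_gt0 => e e0 /=.
have [_ _ _ solZ] := ZY; have [_ _ _ solE] := ZYE e.
have [-> _ _] := solZ r r0; have [-> _ _] := solZ s s0.
have [-> _ _] := solE r r0; have [-> _ _] := solE s s0.
apply/rowP => j; rewrite !mxE; field; exact/lt0r_neq0.
Qed.

Lemma inc_lin P s r : 0 <= s <= r -> (forall u, s <= u <= r -> active D (Z u) `<=` P) ->
  lin D P (inc s r).
Proof.
move=> /andP[s0]; rewrite le_eqVlt => /predU1P[<- _|sr aP].
  by rewrite /inc !subrr; exact: lin0.
have r0 := le_trans s0 (ltW sr).
apply: (closed_cvg (lin D P) _ _ _ (cvg_inc s0 r0)); first exact: closed_lin.
apply: filterS (W0 (perturbation_active s0 aP)) => e he.
have hsub (z : R -> 'rV[R]_J) : (forall u, s <= u <= r -> active D (z u) `<=` P) ->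
    hit D z [set u | s < u <= r] `<=` P.
  by move=> h i [u /= /andP[/ltW su ur]]; apply: h; rewrite su.
have srP : 0 <= s < r by rewrite s0.
apply/linZ/linB; [apply: (lin_sub (hsub _ he))|apply: (lin_sub (hsub _ aP))].
  exact: conic_lin (esp_conic (ZYE e) srP).
exact: conic_lin (esp_conic ZY srP).
Qed.

(** Variation of [Y] is required rather than mere contact because it survives perturbation: [YE e]
    then varies too, on an interval where only face [i] can be responsible. *)
Definition pushed i s r := exists a b, [/\ s <= a, a < b, b <= r,
  forall u, a <= u <= b -> active D (Z u) `<=` [set i] & Y a <> Y b].

Lemma pushed_hit i s r : 0 <= s -> pushed i s r ->
  exists2 q, s <= q <= r & active D (Z q) i.
Proof.
move=> s0 [a [b [sa ab br aP Yab]]].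
have [c [_ cP e]] : conic D (hit D Z [set u | a < u <= b]) (Y b - Y a).
  by apply: esp_conic ZY _; rewrite ab (le_trans s0).
apply: contrapT => noq; apply: Yab; apply/esym/eqP; rewrite -subr_eq0 e big1// => j _.
have [->|/cP[u /= /andP[au ub] uj]] := eqVneq (c j) 0; first by rewrite scale0r.
exfalso; apply: noq; exists u; first by rewrite (le_trans sa (ltW au)) (le_trans ub).
by rewrite -(aP u _ j uj) ?(ltW au).
Qed.

Lemma pushed_hit_perturbed i s r : 0 <= s -> pushed i s r ->
  \forall e \near W, exists2 q, s <= q <= r & active D (ZE e q) i.
Proof.
move=> s0 [a [b [sa ab br aP Yab]]].
have a0 := le_trans s0 sa; have b0 := le_trans a0 (ltW ab).
have [M M0 hM] := perturbation_lipschitz b0.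
(* Below this threshold [e * (M + M)] is less than the variation of [Y] over [[a, b]], so [YE e]
   cannot be constant at the two ends. *)
have c0 : 0 < `|Y b - Y a| / (M + M).
  by rewrite divr_gt0 ?addr_gt0// normr_gt0 subr_eq0; apply/eqP => /esym.
apply: W0; apply: filterS3 (nbhs_right_lt c0) (nbhs_right_gt 0) (perturbation_active a0 aP).
move=> e ec e0 aPe; apply: contrapT => noq.
have [c [_ cP E]] : conic D (hit D (ZE e) [set u | a < u <= b]) (YE e b - YE e a).
  by apply: esp_conic (ZYE e) _; rewrite a0 ab.
have : YE e b - YE e a = 0.
  rewrite E big1// => j _.
  have [->|/cP[u /= /andP[au ub] uj]] := eqVneq (c j) 0; first by rewrite scale0r.
  exfalso; apply: noq; exists u; first by rewrite (le_trans sa (ltW au)) (le_trans ub).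
  by rewrite -(aPe u _ j uj) ?(ltW au).
move=> /eqP; rewrite subr_eq0 => /eqP Eab.
have [|_ h1] := hM e a e0; first by rewrite a0 ltW.
have [|_ h2] := hM e b e0; first by rewrite b0 lexx.
have : `|Y b - Y a| <= e * (M + M).
  rewrite (_ : Y b - Y a = (YE e a - Y a) - (YE e b - Y b)); last first.
    by rewrite Eab; apply/rowP => j; rewrite !mxE; ring.
  by rewrite (le_trans (ler_normB _ _))// mulrDr lerD.
by rewrite leNgt -ltr_pdivlMr ?addr_gt0// ec.
Qed.

(** Subtracting [h] is invisible to the normals indexed by [P], so the estimates act on the [lin]
    part of [Dl s] alone. The term [eta] absorbs the distance from the quotient at time [s] to its
    limit [Dl s]. *)
Lemma perturbation_resolving P s r h om eta : 0 <= s <= r ->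
  (forall u, s <= u <= r -> active D (Z u) `<=` P) -> annih D P h ->
  (forall u, s <= u <= r -> g (psi u - psi s) <= om) -> 0 < eta ->
  \forall e \near W,
    (forall u i, s <= u <= r -> P i ->
      `|dot ((Dl s - h + e^-1 *: ((YE e u - YE e s) - (Y u - Y s))) -
             e^-1 *: (ZE e u - Z u)) (nrm D i)| <= K * om + eta) /\
    resolving D g P (K * om + eta) s r
      (fun u => Dl s - h + e^-1 *: ((YE e u - YE e s) - (Y u - Y s))).
Proof.
move=> /andP[s0 sr] aP Ph psiom eta0; have r0 := le_trans s0 sr.
have c0 : 0 < eta / (K * K) by rewrite divr_gt0// mulr_gt0.
have /cvgrPdist_le/(_ _ c0) hD := DW s0.
apply: filterS3 hD W_gt0 (W0 (perturbation_active s0 aP)) => e hD e0 aPe.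
have key u i : s <= u <= r -> P i ->
      `|dot ((Dl s - h + e^-1 *: ((YE e u - YE e s) - (Y u - Y s))) -
             e^-1 *: (ZE e u - Z u)) (nrm D i)| <= K * om + eta.
  move=> /andP[su ur] Pi; have u0 := le_trans s0 su.
  have [_ _ _ solZ] := ZY; have [_ _ _ solE] := ZYE e.
  have [Zu _ _] := solZ u u0; have [Zs _ _] := solZ s s0.
  have [Eu _ _] := solE u u0; have [Es _ _] := solE s s0.
  rewrite (_ : _ - _ = (Dl s - e^-1 *: (ZE e s - Z s)) - h - (psi u - psi s)); last first.
    by rewrite Zu Zs Eu Es; apply/rowP => j; rewrite !mxE; field; exact/lt0r_neq0.
  rewrite dotBl dotBl (Ph i Pi) subr0 addrC (le_trans (ler_normD _ _))// normrN lerD//.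
    by rewrite (le_trans (adapted_nrm gA _ _))// ler_wpM2l ?(ltW K0)// psiom// su.
  by rewrite (le_trans (dot_le_normr _ _))// mulrC -ler_pdivlMr ?mulr_gt0.
split=> //.
apply: (@esp_resolving _ _ _ _ dn1 _ _ _ gA P _ _ _ _ _ _ s r e^-1 _ _ s0 _ ZY (ZYE e)) => //.
- by rewrite invr_gt0.
- by move=> u sur; split; [exact: aP|exact: aPe].
- by move=> u u'; apply/rowP => j; rewrite !mxE; ring.
Qed.

Lemma inc_le P s r h om : 0 <= s <= r ->
  (forall u, s <= u <= r -> active D (Z u) `<=` P) -> annih D P h ->
  (forall u, s <= u <= r -> g (psi u - psi s) <= om) ->
  g (Dl s - h + inc s r) <= Num.max (g (Dl s - h)) (K * om / rho).
Proof.
move=> /andP[s0 sr] aP Ph psiom; have r0 := le_trans s0 sr.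
apply/ler_addgt0Pr => e1 e10; pose eta := rho * e1.
have eta0 : 0 < eta by rewrite mulr_gt0.
have srP : 0 <= s <= r by rewrite s0.
have om0 : 0 <= K * om.
  rewrite mulr_ge0 ?(ltW K0)// (le_trans _ (psiom s _)) ?lexx//.
  exact: (adapted_ge0 gA).
have cont : (fun e => Dl s - h + e^-1 *: ((YE e r - YE e s) - (Y r - Y s))) @ W
    --> Dl s - h + inc s r by apply: cvgD; [exact: cvg_cst|exact: cvg_inc].
apply: (closed_cvg (fun v => g v <= _) _ _ _ cont).
  by apply: (preimage_closed _ (@closed_le _ _)) => v _; exact: (continuous_adapted gA).
apply: filterS (perturbation_resolving srP aP Ph psiom eta0) => e [_ res].
apply: (resolving_le gA sr res).
  rewrite !subrr scaler0 addr0 (@le_trans _ _ (Num.max (g (Dl s - h)) (K * om / rho)))//.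
    by rewrite le_max lexx.
  by rewrite lerDl ltW.
rewrite mulrDr lerD2r -ler_pdivrMl// mulrC.
by rewrite le_max lexx orbT.
Qed.

Lemma inc_contraction al P s r h om : 0 <= al ->
  (forall P om s t k m, s <= t -> resolving D g P om s t k -> lin D P (k t) ->
    g (k s) <= m -> 2 * om <= rho * m ->
    (forall i, P i -> (exists2 q, s <= q <= t & dot (k q) (nrm D i) <= om) /\
                      (exists2 q, s <= q <= t & - om <= dot (k q) (nrm D i))) ->
    g (k t) <= al * m) ->
  0 <= s <= r ->
  (forall u, s <= u <= r -> active D (Z u) `<=` P) -> annih D P h ->
  lin D P (Dl s - h) -> (forall i, P i -> pushed i s r) ->
  (forall u, s <= u <= r -> g (psi u - psi s) <= om) ->
  g (Dl s - h + inc s r) <= al * Num.max (g (Dl s - h)) (2 * (K * om) / rho).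
Proof.
move=> al0 contr /andP[s0 sr] aP Ph Lh push psiom; have r0 := le_trans s0 sr.
(* Chosen so that [2 * eta = rho * (e1 / (al + 1))]. Division by [al + 1] rather than [al] also
   covers [al = 0]. *)
apply/ler_addgt0Pr => e1 e10; pose eta := rho * (e1 / (al + 1)) / 2.
have al1 : 0 < al + 1 by rewrite ltr_wpDl.
have eta0 : 0 < eta by rewrite divr_gt0// mulr_gt0// divr_gt0.
have srP : 0 <= s <= r by rewrite s0.
have cont : (fun e => Dl s - h + e^-1 *: ((YE e r - YE e s) - (Y r - Y s))) @ W
    --> Dl s - h + inc s r by apply: cvgD; [exact: cvg_cst|exact: cvg_inc].
apply: (closed_cvg (fun v => g v <= _) _ _ _ cont).
  by apply: (preimage_closed _ (@closed_le _ _)) => v _; exact: (continuous_adapted gA).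
have hits : \forall e \near W, forall i, P i -> exists2 q, s <= q <= r & active D (ZE e q) i.
  apply: filter_forall => i; have [Pi|Pi] := pselect (P i); last exact: filterE.
  by apply: filterS (pushed_hit_perturbed s0 (push i Pi)).
apply: filterS3 (W_gt0) hits (filterI (perturbation_resolving srP aP Ph psiom eta0)
  (W0 (perturbation_active s0 aP))) => e e0 hitE [[key res] aPe].
set m := Num.max _ _; apply: (@le_trans _ _ (al * (m + e1 / (al + 1)))); last first.
  rewrite mulrDr lerD2l mulrA ler_pdivrMr// mulrC ler_wpM2l ?(ltW e10)//.
  by rewrite lerDl.
apply: (contr P (K * om + eta) s r _ _ sr res) => [||| i Pi].
- apply: linD => //; apply/linZ; move: sr; rewrite le_eqVlt => /predU1P[<-|sr'].
    by rewrite !subrr; exact: lin0.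
  have srP' : 0 <= s < r by rewrite s0.
  have hsub (z : R -> 'rV[R]_J) : (forall u, s <= u <= r -> active D (z u) `<=` P) ->
      hit D z [set u | s < u <= r] `<=` P.
    by move=> hh j [u /= /andP[/ltW su ur]]; apply: hh; rewrite su.
  apply/linB; [apply: (lin_sub (hsub _ aPe))|apply: (lin_sub (hsub _ aP))].
    exact: conic_lin (esp_conic (ZYE e) srP').
  exact: conic_lin (esp_conic ZY srP').
- rewrite !subrr scaler0 addr0 (@le_trans _ _ m)//; first by rewrite le_max lexx.
  by rewrite lerDl divr_ge0// ltW.
- rewrite (_ : 2 * (K * om + eta) = 2 * (K * om) + rho * (e1 / (al + 1))); last first.
    by rewrite /eta; field; rewrite gt_eqF.
  rewrite [leRHS]mulrDr lerD2r -ler_pdivrMl// mulrC.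
  by rewrite le_max lexx orbT.
have [_ _ _ solZ] := ZY; have [_ _ _ solE] := ZYE e.
split.
  have [q sqr qi] := hitE i Pi; exists q => //.
  have q0 : 0 <= q by case/andP: sqr => sq _; exact: le_trans sq.
  have := key q i sqr Pi; rewrite ler_norml dotBl dotZl dotBl => /andP[_].
  have [_ Gq _] := solZ q q0; have [_ GEq _] := solE q q0.
  move/(activeE _ dn1 GEq): qi => ->; have := Gq i => Gqi.
  rewrite lerBlDr => /le_trans; apply; rewrite gerDl pmulr_rle0 ?invr_gt0//; lra.
have [q sqr qi] := pushed_hit s0 (push i Pi); exists q => //.
have q0 : 0 <= q by case/andP: sqr => sq _; exact: le_trans sq.
have := key q i sqr Pi; rewrite ler_norml dotBl dotZl dotBl => /andP[+ _].
have [_ Gq _] := solZ q q0; have [_ GEq _] := solE q q0.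
move/(activeE _ dn1 Gq): qi => ->; have := GEq i => Gqi.
rewrite lerBrDr; apply: le_trans; rewrite lerDl pmulr_rge0 ?invr_gt0//; lra.
Qed.

(* The first contact of [Z] with a smooth face: no reflection of [Z] on [s, t],
   so only the perturbed path can be pushed there. *)
Lemma inc_first_hit i s t om : 0 <= s < t ->
  (forall u, s <= u <= t -> active D (Z u) `<=` [set i]) -> active D (Z t) i ->
  (forall u, s <= u <= t -> Y u = Y s) ->
  (forall u, s <= u <= t -> g (psi t - psi u) <= om) ->
  exists b, [/\ 0 <= b, inc s t = b *: dir D i, 0 <= dot (Dl t) (nrm D i) &
    0 < b -> dot (Dl t) (nrm D i) <= K * om].
Proof.
move=> /andP[s0 st] aP Zti Yc psiom; have t0 := le_trans s0 (ltW st).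
have stP : 0 <= s <= t by rewrite s0 ltW.
have [a [aP' E]] := inc_lin stP aP.
have {}E : inc s t = a i *: dir D i.
  rewrite E (bigD1 i)//= big1 ?addr0// => j /eqP ji.
  by have [->|/aP'/ji//] := eqVneq (a j) 0; rewrite scale0r.
have ai : a i = dot (inc s t) (nrm D i) by rewrite E dotZl dn1 mulr1.
have [cZ cY _ solZ] := ZY; have [_ Gt _] := solZ t t0.
have Zti' : dot (Z t) (nrm D i) = Defs.cst D i by apply/(activeE _ dn1 Gt).
have cvgdot : (fun e => dot (e^-1 *: (ZE e t - Z t)) (nrm D i)) @ W --> dot (Dl t) (nrm D i).
  exact: (continuous_cvg _ (@continuous_dotr _ _ _ _) (DW t0)).
have cvginc : (fun e => dot (e^-1 *: ((YE e t - YE e s) - (Y t - Y s))) (nrm D i)) @ W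
    --> dot (inc s t) (nrm D i).
  exact: (continuous_cvg _ (@continuous_dotr _ _ _ _) (cvg_inc s0 t0)).
have posE : \forall e \near W, 0 < e /\ conic D [set i] (YE e t - YE e s).
  apply: filterS2 W_gt0 (W0 (perturbation_active s0 aP)) => e e0 aPe; split=> //.
  have /(esp_conic (ZYE e)) : 0 <= s < t by rewrite s0.
  apply: conic_sub => j [u /= /andP[/ltW su ut]]; apply: aPe; by rewrite su.
have Yts : Y t - Y s = 0 by rewrite Yc ?subrr// lexx ltW.
exists (a i); split=> //.
- rewrite ai; apply: (closed_cvg [set x : R | 0 <= x] _ _ _ cvginc); first exact: closed_ge.
  apply: filterS posE => e [e0 [c [c0 cP ->]]]; rewrite /= Yts subr0 dotZl.
  rewrite mulr_ge0 ?invr_ge0 ?(ltW e0)// (bigD1 i)//= big1 => [|j /eqP ji].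
    by rewrite addr0 dotZl dn1 mulr1.
  by have [->|/cP/ji//] := eqVneq (c j) 0; rewrite scale0r.
- apply: (closed_cvg [set x : R | 0 <= x] _ _ _ cvgdot); first exact: closed_ge.
  apply: filterS W_gt0 => e e0; have [_ _ _ /(_ t t0)[_ GE _]] := ZYE e.
  by rewrite /= dotZl dotBl Zti' mulr_ge0 ?invr_ge0 ?(ltW e0)// subr_ge0 GE.
move=> b0; apply: (closed_cvg [set x : R | x <= K * om] _ _ _ cvgdot); first exact: closed_le.
have : \forall e \near W, 0 < dot (e^-1 *: ((YE e t - YE e s) - (Y t - Y s))) (nrm D i).
  by rewrite ai in b0; apply: (cvgr_gt _ cvginc).
apply: filterS3 W_gt0 (W0 (perturbation_active s0 aP)) => e e0 aPe.
rewrite Yts subr0 => push; rewrite /= leNgt; apply/negP; rewrite dotZl [ltRHS]mulrC.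
rewrite ltr_pdivlMr// => far.
(* By [far], the perturbed path is off face [i] at time [t]. While [YE e] is constant from [r] to
   [t], the difference [ZE e - Z] changes by [e *: (psi t - psi r)] only, so the face is out of
   reach at [r] too and [YE e] is constant just before [r]. *)
suff Ets : YE e t = YE e s by move: push; rewrite Ets subrr scaler0 dot0l ltxx.
have [_ cYE _ solE] := ZYE e.
suff : forall r, s <= r <= t -> YE e t = YE e r by apply; rewrite lexx ltW.
apply: backward_induction => [|//|r /andP[sr rt] Er|r /andP[sr rt] Er]; first exact: ltW.
  have r0 := le_lt_trans s0 sr.
  have [r1 r1r hr1] := esp_step dn1 (ZYE e) r0; exists r1 => // r' r1r' sr'.
  rewrite Er; have [c [_ cP E']] := hr1 r' r1r' (le_trans s0 sr').
  apply/eqP; rewrite -subr_eq0 E' big1// => j _.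
  have [->|/cP Ej] := eqVneq (c j) 0; first by rewrite scale0r.
  have srt : s <= r <= t by rewrite (ltW sr).
  have Ei := aPe r srt j Ej; rewrite Ei in Ej.
  have [Zr Gr _] := solZ r (ltW r0); have [ZEr GEr _] := solE r (ltW r0).
  have [Zt' _ _] := solZ t t0; have [ZEt _ _] := solE t t0.
  move/(activeE _ dn1 GEr): Ej => Ej.
  have psir := adapted_nrm gA i (psi t - psi r).
  have : ZE e t - Z t = ZE e r - Z r + e *: (psi t - psi r).
    rewrite Zt' ZEt Zr ZEr Er (Yc r srt) (Yc t) ?lexx ?(ltW st)//.
    by apply/rowP => l; rewrite !mxE; ring.
  move=> h; move: far; rewrite h dotDl dotZl dotBl Ej.
  have := Gr i; have := psiom r srt => h1 h2 far; exfalso.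
  have := ler_norm (dot (psi t - psi r) (nrm D i)) => h3.
  have h4 : K * g (psi t - psi r) <= K * om by rewrite ler_pM2l.
  have : e * dot (psi t - psi r) (nrm D i) <= e * (K * om).
    by rewrite ler_pM2l//; lra.
  lra.
apply/eqP; rewrite -subr_eq0 -normr_le0; apply/ler_addgt0Pr => e1 e10; rewrite add0r.
have r0 := le_trans s0 sr.
have [d d0 hd] := continuous_pathP cYE r0 e10.
pose r' := Num.min (r + d / 2) t.
have rr' : r < r' by rewrite lt_min rt andbT ltrDl divr_gt0.
have r't : r' <= t by rewrite ge_min lexx orbT.
rewrite (Er r') ?rr'//; apply: hd; first by rewrite (le_trans r0)// ltW.
rewrite gtr0_norm ?subr_gt0// ltrBlDl gt_min; apply/orP; left.
by rewrite ltrD2l ltr_pdivrMr// ltr_pMr// ltr1n.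
Qed.

(** The infimum of the admissible bounds is at most [al] times itself up to an arbitrarily small
    error, hence 0; no iterates need to be counted. *)
Lemma contraction_iter (Q : R -> Prop) (al : R) : 0 <= al < 1 ->
  (exists2 B, 0 <= B & Q B) ->
  (forall B eta, 0 <= B -> 0 < eta -> Q B -> Q (al * B + eta)) ->
  (forall B B', B <= B' -> Q B -> Q B') ->
  forall eta, 0 < eta -> Q eta.
Proof.
move=> /andP[al0 al1] [B0 B00 QB0] step mono eta eta0.
pose S := [set B | 0 <= B /\ Q B].
have infS : has_inf S by split; [exists B0; split|exists 0 => B []].
have b0 : 0 <= inf S by apply: lb_le_inf; [exists B0|move=> B []].
suff : inf S < eta.
  rewrite -subr_gt0 => /(inf_adherent)/(_ infS)[B [_ QB]]; rewrite addrC subrK => Beta.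
  exact: mono (ltW Beta) QB.
suff : inf S <= 0 by move=> /le_lt_trans; apply.
rewrite leNgt; apply/negP => bp.
pose x := (1 - al) * inf S / 4.
have x0 : 0 < x by rewrite divr_gt0// mulr_gt0// subr_gt0.
have [B [B0' QB] Bx] := inf_adherent x0 infS.
have : S (al * B + x).
  split; last exact: step.
  by apply: addr_ge0; [exact: mulr_ge0|exact: ltW].
move=> /(ge_inf infS.2); apply/negP; rewrite -ltNge.
have h1 : al * B <= al * (inf S + x) by rewrite ler_wpM2l// ltW.
have h2 : al * x <= x by rewrite ler_piMl ?ltW.
have : x * 4 = (1 - al) * inf S by rewrite /x divfK.
lra.
Qed.

Lemma psi_osc t : 0 <= t -> forall e, 0 < e -> exists2 d, 0 < d &
  forall r s, 0 <= r -> 0 <= s -> `|r - t| < d -> `|s - t| < d -> g (psi r - psi s) <= e.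
Proof.
move=> t0 e e0; have e1 : 0 < e / K / 2 by rewrite !divr_gt0.
have [d d0 hd] := continuous_pathP cpsi t0 e1; exists d => // r s r0 s0 rd sd.
rewrite (le_trans (adapted_le gA _))// mulrC -ler_pdivlMr//.
rewrite (_ : psi r - psi s = (psi r - psi t) - (psi s - psi t)); last first.
  by rewrite opprB addrA subrK.
by rewrite (le_trans (ler_normB _ _))// [leRHS]splitr lerD ?hd.
Qed.

Lemma Dl_bounded T : 0 <= T -> exists2 M, 0 <= M & forall r, 0 <= r <= T -> g (Dl r) <= M.
Proof.
move=> T0; have [M M0 hM] := perturbation_lipschitz T0.
exists (K * M); first by rewrite mulr_ge0 ?ltW.
move=> r /andP[r0 rT]; apply: (closed_cvg (fun v => g v <= _) _ _ _ (DW r0)).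
  by apply: (preimage_closed _ (@closed_le _ _)) => v _; exact: (continuous_adapted gA).
apply: filterS (W0 (nbhs_right_gt 0)) => e e0.
rewrite (le_trans (adapted_le gA _))// ler_pM2l// normrZ gtr0_norm ?invr_gt0//.
by rewrite ler_pdivrMl//; have [|] := hM e r e0 => //; rewrite r0.
Qed.

(** Bounds the component of [Dl r] in [lin]. Quantifying over all splittings, of which there is at
    most one by [annih_uniq], avoids choosing a projection. *)
Definition residual_le P r B := forall h, annih D P h -> lin D P (Dl r - h) -> g (Dl r - h) <= B.

Lemma residual_bound P r : residual_le P r (2 * g (Dl r)).
Proof.
move=> h Ph Lh; rewrite (le_trans (adaptedB gA _ _))// mulr2n mulrDl mul1r lerD//.
exact: (annih_le gA Ph).
Qed.

Lemma annih_uniq P h h' v : annih D P h -> annih D P h' ->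
  lin D P (v - h) -> lin D P (v - h') -> h = h'.
Proof.
move=> Ph Ph' Lh Lh'; apply/eqP; rewrite -subr_eq0; apply/eqP.
apply: (annih_lin0 gA (P := P)) => [i Pi|]; first by rewrite dotBl Ph// Ph'// subrr.
have -> : h - h' = (v - h') - (v - h) by apply/rowP => j; rewrite !mxE; ring.
exact: linB.
Qed.

(** * One-sided behaviour of the limit at a fixed time *)

Section local.
Variables (al t0 : R).
Hypotheses (al0 : 0 <= al) (al1 : al < 1) (t00 : 0 <= t0).
Hypothesis contr : forall P om s t (k : R -> 'rV[R]_J) m, s <= t ->
  resolving D g P om s t k -> lin D P (k t) ->
  g (k s) <= m -> 2 * om <= rho * m ->
  (forall i, P i -> (exists2 q, s <= q <= t & dot (k q) (nrm D i) <= om) /\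
                    (exists2 q, s <= q <= t & - om <= dot (k q) (nrm D i))) ->
  g (k t) <= al * m.
Local Notation P0 := (active D (Z t0)).
Let rK : 0 < 2 * K / rho.
Proof. by rewrite divr_gt0// mulr_gt0. Qed.
Hypothesis dec : forall v, exists2 h, annih D P0 h & lin D P0 (v - h).

Lemma active_window : exists2 d, 0 < d &
  forall r, 0 <= r -> `|r - t0| < d -> active D (Z r) `<=` P0.
Proof.
have [cZ _ _ h] := ZY; apply: (active_usc dn1 cZ _ t00).
by move=> r /h[].
Qed.

(** Since [inc] lies in [lin], the [annih] component of [Dl] follows that of [psi]. *)
Lemma dec_step s r h h' q : 0 <= s <= r ->
  (forall u, s <= u <= r -> active D (Z u) `<=` P0) ->
  annih D P0 h -> lin D P0 (Dl s - h) -> annih D P0 h' -> lin D P0 (Dl r - h') ->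
  annih D P0 q -> lin D P0 (psi r - psi s - q) ->
  h' = h + q /\ Dl r - h' = (Dl s - h + inc s r) + (psi r - psi s - q).
Proof.
move=> sr aP Ph Lh Ph' Lh' Pq Lq; have Li := inc_lin sr aP.
have E : Dl r - (h + q) = (Dl s - h + inc s r) + (psi r - psi s - q).
  by apply/rowP => j; rewrite !mxE; ring.
suff -> : h' = h + q by [].
apply: (annih_uniq (v := Dl r) Ph' _ Lh') => [i Pi|].
  by rewrite dotDl Ph// Pq// addr0.
by rewrite E; apply: linD => //; exact: linD.
Qed.

Lemma residual_step s r om B : 0 <= s <= r ->
  (forall u, s <= u <= r -> active D (Z u) `<=` P0) ->
  (forall u, s <= u <= r -> g (psi u - psi s) <= om) ->
  (forall i, P0 i -> pushed i s r) -> 0 <= B -> residual_le P0 s B ->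
  residual_le P0 r (al * B + (2 * K / rho + 2) * om).
Proof.
move=> sr aP psiom push B0 sB h' Ph' Lh'.
have om0 : 0 <= om.
  have /andP[s0 sr'] := sr.
  by rewrite (le_trans _ (psiom s _)) ?lexx ?sr'//; exact: (adapted_ge0 gA).
have psir : g (psi r - psi s) <= om.
  by apply: psiom; have /andP[_ ->] := sr; rewrite lexx.
have [h Ph Lh] := dec (Dl s); have [q Pq Lq] := dec (psi r - psi s).
have [_ ->] := dec_step sr aP Ph Lh Ph' Lh' Pq Lq.
(* [2 * K / rho] comes from the threshold in [inc_contraction], the additional 2 from the [lin] part
   of the increment of [psi]. *)
have -> : al * B + (2 * K / rho + 2) * om = al * B + 2 * K / rho * om + (om + om) by ring.
apply: le_trans (adapted_D gA _ _) _; apply: lerD; last first.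
  apply: le_trans (adaptedB gA _ _) _; apply: lerD => //.
  exact: le_trans (annih_le gA Pq Lq) psir.
rewrite (le_trans (inc_contraction al0 contr sr aP Ph Lh push psiom))//.
have c0 : 0 <= 2 * K / rho * om by rewrite mulr_ge0// ltW.
have -> : 2 * (K * om) / rho = 2 * K / rho * om by ring.
rewrite (@le_trans _ _ (al * (B + 2 * K / rho * om)))//.
  rewrite ler_wpM2l// ge_max; apply/andP; split; last by rewrite lerDr.
  by rewrite (le_trans (sB h Ph Lh))// lerDl.
by rewrite mulrDr lerD2l ler_piMl// ltW.
Qed.

(** The strict inequality [r < t0] makes pushes recur: after each one there is room for another, so
    the contraction can be iterated. *)
Definition left_rich := forall i, P0 i -> forall s, 0 <= s < t0 ->
  exists2 r, r < t0 & pushed i s r.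

Definition right_rich := forall i, P0 i -> forall r, t0 < r ->
  exists2 s, t0 < s & pushed i s r.

Lemma pushed_mono i s s' r r' : s' <= s -> r <= r' -> pushed i s r -> pushed i s' r'.
Proof.
move=> ss' rr' [a [b [sa ab br h1 h2]]]; exists a, b; split=> //.
  exact: le_trans sa.
exact: le_trans rr'.
Qed.

Lemma window eta : 0 < eta -> exists2 d, 0 < d & forall r, 0 <= r -> `|r - t0| < d ->
  active D (Z r) `<=` P0 /\ forall s, 0 <= s -> `|s - t0| < d ->
  (2 * K / rho + 2) * g (psi r - psi s) <= eta.
Proof.
move=> eta0; have [d1 d10 h1] := active_window.
have c0 : 0 < 2 * K / rho + 2 by rewrite addr_gt0.
have e0 : 0 < eta / (2 * K / rho + 2) by rewrite divr_gt0.
have [d2 d20 h2] := psi_osc t00 e0.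
exists (Num.min d1 d2); first by rewrite lt_min d10.
move=> r r0; rewrite lt_min => /andP[rd1 rd2]; split; first exact: h1.
move=> s s0; rewrite lt_min => /andP[_ sd2].
by rewrite mulrC -ler_pdivlMr//; exact: h2.
Qed.

Lemma residual_window s r B d eta : 0 < d -> 0 < eta ->
  (forall r, 0 <= r -> `|r - t0| < d ->
    active D (Z r) `<=` P0 /\ forall s, 0 <= s -> `|s - t0| < d ->
    (2 * K / rho + 2) * g (psi r - psi s) <= eta) ->
  0 <= s <= r -> `|s - t0| < d -> `|r - t0| < d ->
  (forall i, P0 i -> pushed i s r) -> 0 <= B -> residual_le P0 s B ->
  residual_le P0 r (al * B + eta).
Proof.
move=> d0 eta0 hd sr sd rd push B0 sB; have /andP[s0 sr'] := sr.
have inw u : s <= u <= r -> 0 <= u /\ `|u - t0| < d.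
  move=> /andP[su ur]; split; first exact: le_trans su.
  move: sd rd; rewrite !ltr_norml => /andP[h1 h2] /andP[h3 h4].
  by apply/andP; split; lra.
have c0 : 0 < 2 * K / rho + 2 by rewrite addr_gt0.
have -> : al * B + eta = al * B + (2 * K / rho + 2) * (eta / (2 * K / rho + 2)).
  by rewrite [X in _ = _ + X]mulrC divfK// gt_eqF.
apply: residual_step sB => // u /inw[u0 ud]; first by have [] := hd u u0 ud.
by have [_ /(_ s s0 sd)] := hd u u0 ud; rewrite mulrC -ler_pdivlMr.
Qed.

(** Once every active face has been pushed on [[s1, s2]], the improved bound holds at all later
    times up to and including [t0]. *)
Lemma left_residual : 0 < t0 -> left_rich -> forall eta, 0 < eta ->
  exists2 s, 0 <= s < t0 & forall r, s <= r <= t0 -> residual_le P0 r eta.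
Proof.
move=> t0p rich; apply: (@contraction_iter _ al); first by rewrite al0.
- have [M M0 hM] := Dl_bounded t00; exists (2 * M); first by rewrite mulr_ge0.
  exists 0; first by rewrite lexx.
  move=> r rt h Ph Lh; apply: (le_trans (residual_bound Ph Lh)).
  by rewrite ler_pM2l// hM.
- move=> B eta B0 eta0 [s /andP[s0 st] hs].
  have [d d0 hd] := window eta0.
  pose s1 := Num.max s (t0 - d / 2).
  have ss1 : s <= s1 by rewrite le_max lexx.
  have s1t : s1 < t0 by rewrite gt_max st ltrBlDr ltrDl divr_gt0.
  have s10 : 0 <= s1 by exact: le_trans ss1.
  have s1d : t0 - d / 2 <= s1 by rewrite le_max lexx orbT.
  have ind u : s1 <= u <= t0 -> `|u - t0| < d.
    by move=> /andP[s1u ut]; rewrite ler0_norm ?subr_le0//; lra.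
  have near_push : \forall r \near t0^'-, forall i, P0 i -> pushed i s1 r.
    apply: filter_forall => i; have [Pi|Pi] := pselect (P0 i); last exact: filterE.
    have [|r rt hr] := rich i Pi s1; first by rewrite s10.
    apply: filterS (nbhs_left_gt rt) => r' rr' _; exact: pushed_mono (lexx _) (ltW rr') hr.
  have [s2 [[push s1s2] s2t]] := @filter_ex _ _ (at_left_proper_filter t0) _
    (@filterI _ _ (at_left_proper_filter t0) _ _
      (@filterI _ _ (at_left_proper_filter t0) _ _ near_push (nbhs_left_gt s1t))
      (nbhs_left_lt t0 : \forall y \near t0^'-, y < t0)).
  exists s2; first by rewrite (le_trans s10 (ltW s1s2)).
  move=> r /andP[s2r rt].
  have s1r : s1 <= r by rewrite (le_trans _ s2r)// ltW.
  apply: (residual_window d0 eta0 hd (s := s1)) => //.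
  + by rewrite s10.
  + by apply: ind; rewrite lexx ltW.
  + by apply: ind; rewrite s1r.
  + by move=> i Pi; exact: pushed_mono (lexx _) s2r (push i Pi).
  + by apply: hs; rewrite ss1 ltW.
- move=> B B' BB' [s st hs]; exists s => // r rt h Ph Lh.
  exact: le_trans (hs r rt h Ph Lh) BB'.
Qed.

(** Pushes now accumulate at the left end: for each [r] the window starts at an [s2] between [t0]
    and [r], depending on [r], where the previous bound is already available. *)
Lemma right_residual : right_rich -> forall eta, 0 < eta ->
  exists2 s, t0 < s & forall r, t0 < r <= s -> residual_le P0 r eta.
Proof.
move=> rich; apply: (@contraction_iter _ al); first by rewrite al0.
- have t10 : 0 <= t0 + 1 by rewrite addr_ge0.
  have [M M0 hM] := Dl_bounded t10; exists (2 * M); first by rewrite mulr_ge0.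
  exists (t0 + 1); first by rewrite ltrDl.
  move=> r /andP[tr rt] h Ph Lh; apply: (le_trans (residual_bound Ph Lh)).
  by rewrite ler_pM2l// hM// rt (le_trans t00)// ltW.
- move=> B eta B0 eta0 [s ts hs].
  have [d d0 hd] := window eta0.
  exists (Num.min s (t0 + d / 2)); first by rewrite lt_min ts ltrDl divr_gt0.
  move=> r /andP[tr]; rewrite le_min => /andP[rs rd].
  have ind u : t0 < u <= r -> `|u - t0| < d.
    by move=> /andP[tu ur]; rewrite gtr0_norm ?subr_gt0//; lra.
  have near_push : \forall s' \near t0^'+, forall i, P0 i -> pushed i s' r.
    apply: filter_forall => i; have [Pi|Pi] := pselect (P0 i); last exact: filterE.
    have [s' ts' hs'] := rich i Pi r tr.
    apply: filterS (nbhs_right_lt ts') => s'' ss' _; exact: pushed_mono (ltW ss') (lexx _) hs'.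
  have [s2 [[push s2r] ts2]] := @filter_ex _ _ (at_right_proper_filter t0) _
    (@filterI _ _ (at_right_proper_filter t0) _ _
      (@filterI _ _ (at_right_proper_filter t0) _ _ near_push (nbhs_right_lt tr))
      (nbhs_right_gt t0)).
  apply: (residual_window d0 eta0 hd (s := s2)) => //.
  + by rewrite (le_trans t00) ltW.
  + by apply: ind; rewrite ts2 ltW.
  + by apply: ind; rewrite tr lexx.
  + by apply: hs; rewrite ts2 (le_trans _ rs)// ltW.
- move=> B B' BB' [s st hs]; exists s => // r rt h Ph Lh.
  exact: le_trans (hs r rt h Ph Lh) BB'.
Qed.

Lemma left_rich_annih : 0 < t0 -> left_rich -> annih D P0 (Dl t0).
Proof.
move=> t0p rich; have [h Ph Lh] := dec (Dl t0).
suff -> : Dl t0 = h by [].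
apply/eqP; rewrite -subr_eq0; apply/eqP/(adapted_eq0 gA)/eqP.
rewrite eq_le (adapted_ge0 gA) andbT; apply/ler_addgt0Pr => e e0; rewrite add0r.
have [s /andP[s0 st] hs] := left_residual t0p rich e0.
by apply: (hs t0) => //; rewrite lexx ltW.
Qed.

Lemma left_rich_cvg : 0 < t0 -> left_rich -> Dl @ t0^'- --> Dl t0.
Proof.
move=> t0p rich; apply/cvgrPdist_le => e e0.
have e1 : 0 < e / K / 2 by rewrite !divr_gt0.
have [s /andP[s0 st] hs] := left_residual t0p rich e1.
have [d d0 hd] := window e1.
have A0 := left_rich_annih t0p rich.
have st' : Num.max s (t0 - d) < t0 by rewrite gt_max st ltrBlDr ltrDl.
apply: filterS2 (nbhs_left_gt st') (nbhs_left_lt t0) => r; rewrite gt_max => /andP[sr dr] rt.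
have r0 : 0 <= r by rewrite (le_trans s0)// ltW.
have rd : `|r - t0| < d by rewrite ltr0_norm ?subr_lt0//; lra.
have rd' : `|t0 - t0| < d by rewrite subrr normr0.
have [h Ph Lh] := dec (Dl r); have [q Pq Lq] := dec (psi t0 - psi r).
have rt' : 0 <= r <= t0 by rewrite r0 ltW.
have aP u : r <= u <= t0 -> active D (Z u) `<=` P0.
  move=> /andP[ru ut]; have [|//] := hd u (le_trans r0 ru).
  by rewrite ler0_norm ?subr_le0//; lra.
have Lt : lin D P0 (Dl t0 - Dl t0) by rewrite subrr; exact: lin0.
have [E _] := dec_step rt' aP Ph Lh A0 Lt Pq Lq.
have -> : Dl t0 - Dl r = q - (Dl r - h) by rewrite E opprB addrA (addrC q).
rewrite (le_trans (adapted_ge gA _))// mulrC -ler_pdivlMr//.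
rewrite (le_trans (adaptedB gA _ _))// [leRHS]splitr lerD//; last first.
  by apply: hs => //; rewrite (ltW sr) ltW.
rewrite (le_trans (annih_le gA Pq Lq))//.
have [_ /(_ r r0 rd)] := hd t0 t00 rd'; apply: le_trans.
rewrite ler_peMl ?(adapted_ge0 gA)//.
by rewrite (@le_trans _ _ 2) ?ler1n// lerDr ltW.
Qed.

(** The [lin] component of [Dl t0] is zero, so [inc_le] keeps later increments of the order of the
    oscillation of [psi]. *)
Lemma annih_right_cvg : annih D P0 (Dl t0) -> Dl @ t0^'+ --> Dl t0.
Proof.
move=> A0; apply/cvgrPdist_le => e e0.
have e1 : 0 < e / K / 2 by rewrite !divr_gt0.
have [d d0 hd] := window e1.
have td : t0 < t0 + d by rewrite ltrDl.
apply: filterS2 (nbhs_right_lt td) (nbhs_right_gt t0) => r rd tr.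
have r0 : 0 <= r by rewrite (le_trans t00)// ltW.
have tt : `|t0 - t0| < d by rewrite subrr normr0.
have ind u : t0 <= u <= r -> 0 <= u /\ `|u - t0| < d.
  move=> /andP[tu ur]; split; first exact: le_trans tu.
  by rewrite ger0_norm ?subr_ge0//; lra.
have c0 : 0 < 2 * K / rho + 2 by rewrite addr_gt0.
pose om := (e / K / 2) / (2 * K / rho + 2).
have psiom u : t0 <= u <= r -> g (psi u - psi t0) <= om.
  move=> /ind[u0 ud]; rewrite /om ler_pdivlMr// mulrC.
  by have [_ /(_ t0 t00 tt)] := hd u u0 ud.
have tr' : 0 <= t0 <= r by rewrite t00 ltW.
have aP u : t0 <= u <= r -> active D (Z u) `<=` P0.
  by move=> /ind[u0 ud]; have [] := hd u u0 ud.
have := inc_le tr' aP A0 psiom; rewrite subrr add0r (adapted0 gA) => hinc.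
rewrite distrC (_ : Dl r - Dl t0 = inc t0 r + (psi r - psi t0)); last by rewrite subrK.
rewrite (le_trans (adapted_ge gA _))// mulrC -ler_pdivlMr//.
have om0 : 0 <= om by apply: divr_ge0; exact: ltW.
have psir : g (psi r - psi t0) <= om by apply: psiom; rewrite lexx ltW.
have hK : 0 <= K * om / rho.
  by apply: divr_ge0; [apply: mulr_ge0 => //|]; exact: ltW.
have {}hinc : g (inc t0 r) <= K * om / rho by rewrite (le_trans hinc)// ge_max hK lexx.
rewrite (le_trans (adapted_D gA _ _))// (le_trans (lerD hinc psir))//.
rewrite (@le_trans _ _ ((2 * K / rho + 2) * om))//.
  rewrite mulrDl; have -> : 2 * K / rho * om = K * om / rho + K * om / rho.
    by rewrite -mulr2n -mulr_natl; ring.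
  lra.
rewrite /om mulrC divfK ?gt_eqF// ler_pdivrMr// ler_peMr ?ler1n// divr_ge0// ltW//.
Qed.

(** The [lin] component of [Dl t0] is lost immediately after [t0]; this is how [Dl] can fail to be
    right continuous. *)
Lemma right_rich_cvg h : right_rich -> annih D P0 h -> lin D P0 (Dl t0 - h) ->
  Dl @ t0^'+ --> h.
Proof.
move=> rich Ph Lh; apply/cvgrPdist_le => e e0.
have e1 : 0 < e / K / 2 by rewrite !divr_gt0.
have [s ts hs] := right_residual rich e1.
have [d d0 hd] := window e1.
have st' : t0 < Num.min s (t0 + d) by rewrite lt_min ts ltrDl.
apply: filterS2 (nbhs_right_lt st') (nbhs_right_gt t0) => r; rewrite lt_min => /andP[rs rd] tr.
have r0 : 0 <= r by rewrite (le_trans t00)// ltW.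
have rd' : `|r - t0| < d by rewrite gtr0_norm ?subr_gt0//; lra.
have td : `|t0 - t0| < d by rewrite subrr normr0.
have [h' Ph' Lh'] := dec (Dl r); have [q Pq Lq] := dec (psi r - psi t0).
have tr' : 0 <= t0 <= r by rewrite t00 ltW.
have aP u : t0 <= u <= r -> active D (Z u) `<=` P0.
  move=> /andP[tu ur]; have [|//] := hd u (le_trans t00 tu).
  by rewrite ger0_norm ?subr_ge0//; lra.
have [E _] := dec_step tr' aP Ph Lh Ph' Lh' Pq Lq.
rewrite distrC; have -> : Dl r - h = q + (Dl r - h').
  by rewrite E; apply/rowP => j; rewrite !mxE; ring.
rewrite (le_trans (adapted_ge gA _))// mulrC -ler_pdivlMr//.
rewrite (le_trans (adapted_D gA _ _))// [leRHS]splitr lerD//; last first.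
  by apply: hs => //; rewrite tr ltW.
rewrite (le_trans (annih_le gA Pq Lq))//.
have [_ /(_ t0 t00 td)] := hd r r0 rd'; apply: le_trans.
rewrite ler_peMl ?(adapted_ge0 gA)//.
by rewrite (@le_trans _ _ 2) ?ler1n// lerDr ltW.
Qed.

End local.

End perturbation.

(** * One-sided limits on half-open intervals *)

Section half_open_intervals.
Context {R : realType} {J : nat}.
Implicit Types (T : \bar R) (f : R -> 'rV[R]_J) (t : R).

Lemma in_itv0_right T t : in_itv0 T t -> exists2 r, t < r & in_itv0 T r.
Proof.
move=> [t0]; case: T => [T||] tT; last by have := ltNge t%:E -oo%E; rewrite tT leNye.
  rewrite lte_fin in tT; exists ((t + T) / 2); first by rewrite midf_lt.
  by split; [rewrite divr_ge0// addr_ge0// ltW// (le_lt_trans t0)|rewrite lte_fin midf_lt].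
by exists (t + 1); [rewrite ltrDl|split; [rewrite addr_ge0|rewrite ltry]].
Qed.

Lemma in_itv0_le T s t : 0 <= s -> s <= t -> in_itv0 T t -> in_itv0 T s.
Proof.
move=> s0 st [_ tT]; split=> //; apply: le_lt_trans tT; by rewrite lee_fin.
Qed.

Lemma near_right_itv0 T t : in_itv0 T t -> \forall r \near t^'+, in_itv0 T r.
Proof.
move=> tT; have [r tr rT] := in_itv0_right tT; have [t0 _] := tT.
apply: filterS2 (nbhs_right_lt tr) (nbhs_right_gt t) => u ur tu.
exact: in_itv0_le (le_trans t0 (ltW tu)) (ltW ur) rT.
Qed.

Lemma near_left_itv0 T t : in_oitv0 T t -> \forall r \near t^'-, in_itv0 T r.
Proof.
move=> [t0 tT].
apply: filterS2 (nbhs_left_gt t0) (nbhs_left_lt t) => u u0 ut.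
by apply: (in_itv0_le (t := t)); rewrite ?ltW//; split=> //; exact: ltW.
Qed.

Lemma cvg_right_near (F : set_system 'rV[R]_J) f f' t :
  (\forall r \near t^'+, f r = f' r) -> f @ t^'+ --> F -> f' @ t^'+ --> F.
Proof. by move=> ff' /(cvg_trans _); apply; exact: near_eq_cvg. Qed.

Lemma cvg_left_near (F : set_system 'rV[R]_J) f f' t :
  (\forall r \near t^'-, f r = f' r) -> f @ t^'- --> F -> f' @ t^'- --> F.
Proof. by move=> ff' /(cvg_trans _); apply; exact: near_eq_cvg. Qed.

Lemma cvg_right_unique f (l l' : 'rV[R]_J) t : f @ t^'+ --> l -> f @ t^'+ --> l' -> l = l'.
Proof. exact: (cvg_unique (@norm_hausdorff _ _)). Qed.

Lemma cvg_left_lim f (l : 'rV[R]_J) t : f @ t^'- --> l -> lim (f @ t^'-) = l.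
Proof. exact: (cvg_lim (@norm_hausdorff _ _)). Qed.

Lemma right_limits_right f phi (l : 'rV[R]_J) t :
  (\forall r \near t^'+, f @ r^'+ --> phi r) -> f @ t^'+ --> l -> phi @ t^'+ --> l.
Proof.
move=> fphi /cvgrPdist_le fl; apply/cvgrPdist_le => e e0.
have /nbhs_ballP[d d0 hd] := fl e e0.
have td : t < t + d by rewrite ltrDl.
apply: filterS3 fphi (nbhs_right_lt td) (nbhs_right_gt t) => r fr rd tr.
apply: (@closed_cvg _ _ _ (at_right_proper_filter r) f [set v | `|l - v| <= e] _ _ _ fr).
  exact: (@closed_closed_ball_ R 'rV[R]_J l e).
apply: filterS2 (nbhs_right_lt rd) (nbhs_right_gt r) => u ud ru.
apply: hd; last exact: lt_trans ru.
by rewrite /ball /= ltr0_norm ?subr_lt0 ?(lt_trans tr)//; lra.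
Qed.

Lemma right_limits_left f phi (l : 'rV[R]_J) t :
  (\forall r \near t^'-, f @ r^'+ --> phi r) -> f @ t^'- --> l -> phi @ t^'- --> l.
Proof.
move=> fphi /cvgrPdist_le fl; apply/cvgrPdist_le => e e0.
have /nbhs_ballP[d d0 hd] := fl e e0.
have td : t - d < t by rewrite ltrBlDr ltrDl.
apply: filterS3 fphi (nbhs_left_gt td) (nbhs_left_lt t) => r fr rd tr.
apply: (@closed_cvg _ _ _ (at_right_proper_filter r) f [set v | `|l - v| <= e] _ _ _ fr).
  exact: (@closed_closed_ball_ R 'rV[R]_J l e).
apply: filterS2 (nbhs_right_lt tr) (nbhs_right_gt r) => u ud ru.
apply: hd => //.
by rewrite /ball /= gtr0_norm ?subr_gt0//; lra.
Qed.

End half_open_intervals.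

(** * Uniqueness, initial values and independent directions *)

Section derivative_problem.
Context {R : realType} {J N : nat} (D : esp_data R J N).
Hypothesis dn1 : forall i, dot (dir D i) (nrm D i) = 1.
Variables (g : 'rV[R]_J -> R) (rho K : R).
Hypothesis gA : adapted_norm D g rho K.
Implicit Types (X Y Z psi phi eta : R -> 'rV[R]_J) (i : 'I_N).

(** The difference [dl] lies in [annih] at each time, with increments in the span of the directions
    visited, so by [annih_le] its norm does not decrease going backwards; it vanishes at time 0 by
    [annih_lin0]. *)
Lemma derivative_problem_unique T X Z Y psi phi eta phi' eta' : solves_ESP D X Z Y ->
  solves_DP D T Z psi phi eta -> solves_DP D T Z psi phi' eta' ->
  forall t, in_itv0 T t -> phi' t = phi t /\ eta' t = eta t.
Proof.
move=> [cZ _ _ solZ] [[_ rphi] _ e0 sol] [[_ rphi'] _ e0' sol'] t tT.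
have [t0 _] := tT.
pose dl r := phi r - phi' r.
have dleta r : in_itv0 T r -> dl r = eta r - eta' r.
  move=> rT; rewrite /dl; have [-> _ _] := sol r rT; have [-> _ _] := sol' r rT.
  by apply/rowP => j; rewrite !mxE; ring.
have rT r : 0 <= r -> r <= t -> in_itv0 T r by move=> r0 rt; exact: in_itv0_le tT.
have Hdl r : in_itv0 T r -> annih D (active D (Z r)) (dl r).
  move=> rT' i ri; have [_ h _] := sol r rT'; have [_ h' _] := sol' r rT'.
  by rewrite dotBl (h i ri) (h' i ri) subrr.
have Ldl s r : in_itv0 T r -> 0 <= s < r ->
    lin D (hit D Z [set u | s < u <= r]) (dl r - dl s).
  move=> rT' sr; have /andP[s0 lt_sr] := sr.
  have sT : in_itv0 T s by apply: in_itv0_le rT' => //; exact: ltW.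
  have [_ _ /(_ s sr)/span_hit h] := sol r rT'.
  have [_ _ /(_ s sr)/span_hit h'] := sol' r rT'.
  rewrite !dleta// (_ : _ - _ = (eta r - eta s) - (eta' r - eta' s)); first exact: linB.
  by apply/rowP => j; rewrite !mxE; ring.
have dl0 : dl 0 = 0.
  apply: (annih_lin0 gA (P := active D (Z 0))); first exact/Hdl/rT.
  by rewrite dleta; [apply: linB; exact/span_dcone|exact: rT].
suff dlt : dl t = 0.
  have E : phi' t = phi t by apply/esym/eqP; rewrite -subr_eq0 -/(dl t) dlt.
  by split=> //; apply/esym/eqP; rewrite -subr_eq0 -dleta// dlt.
apply: (adapted_eq0 gA); apply/eqP; rewrite eq_le (adapted_ge0 gA) andbT.
rewrite -(adapted0 gA) -dl0.
suff : forall r, 0 <= r <= t -> g (dl t) <= g (dl r) by apply; rewrite lexx.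
apply: backward_induction => // r /andP[r0 rt].
  move=> h; have rT' := rT r (ltW r0) rt.
  have [d d0 hd] := active_usc dn1 cZ (fun u u0 => let: And3 _ G _ := solZ u u0 in G) (ltW r0).
  exists (r - d / 2); first by rewrite ltrBlDr ltrDl divr_gt0.
  move=> r' /andP[dr' r'r] r'0; apply: (le_trans h).
  apply: (annih_le gA (Hdl r rT')); rewrite -opprB; apply: linN.
  have := Ldl r' r rT'; rewrite r'0 r'r => /(_ isT); apply: lin_sub.
  move=> i [u /= /andP[r'u ur]]; apply: hd; first by rewrite (le_trans r'0)// ltW.
  by rewrite ler0_norm ?subr_le0//; lra.
move=> h; have rT' := rT r r0 (ltW rt).
have cdl : dl @ r^'+ --> dl r by apply: cvgB; [exact: rphi|exact: rphi'].
apply: (closed_cvg (fun v => g (dl t) <= g v) _ _ _ cdl).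
  by apply: (preimage_closed (f := g) _ (@closed_ge _ _)) => v _; exact: (continuous_adapted gA).
apply: filterS2 (nbhs_right_lt rt) (nbhs_right_gt r) => u ut ru.
by apply: h; rewrite ru ltW.
Qed.

Lemma const_solves_ESP (x z y : 'rV[R]_J) : Gset D z -> dcone D z y -> z = x + y ->
  solves_ESP D (fun=> x) (fun=> z) (fun=> y).
Proof.
move=> Gz dy zE; split=> //; try exact: cst_continuous.
move=> t t0; split=> // s _; rewrite subrr; exists 0%N, (fun=> 0), (fun=> 0).
by split=> // [[]//|]; rewrite big_ord0.
Qed.

(** The Lipschitz estimate at time 0 involves the drivers at time 0 only, so the solution may be
    compared with a constant one. *)
Lemma esp_initial X Z Y (z y : 'rV[R]_J) : solves_ESP D X Z Y ->
  Gset D z -> dcone D z y -> z = X 0 + y -> Z 0 = z.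
Proof.
move=> ZY Gz dy zE; have ZY' := const_solves_ESP Gz dy zE.
have h : g (Y 0 - y) <= 0 / rho.
  apply: (esp_lipschitz dn1 gA (lexx 0) ZY' ZY) => // r i.
  by rewrite -eq_le => /eqP <-; rewrite subrr dot0l normr0.
have [_ _ _ /(_ 0 (lexx 0))[-> _ _]] := ZY.
rewrite zE; congr (_ + _); apply/eqP; rewrite -subr_eq0; apply/eqP/(adapted_eq0 gA).
by apply/eqP; rewrite eq_le (adapted_ge0 gA) andbT (le_trans h)// mul0r.
Qed.

Lemma esp_unique X Z Y Z' Y' t : solves_ESP D X Z Y -> solves_ESP D X Z' Y' ->
  0 <= t -> Z' t = Z t.
Proof.
move=> ZY ZY' t0.
have h : g (Y' t - Y t) <= 0 / rho.
  apply: (esp_lipschitz dn1 gA t0 ZY ZY') => // r i _.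
  by rewrite subrr dot0l normr0.
have [_ _ _ /(_ t t0)[-> _ _]] := ZY; have [_ _ _ /(_ t t0)[-> _ _]] := ZY'.
congr (_ + _); apply/eqP; rewrite -subr_eq0; apply/eqP/(adapted_eq0 gA).
by apply/eqP; rewrite eq_le (adapted_ge0 gA) andbT (le_trans h)// mul0r.
Qed.

(* Near a point [x] of [G] the domain coincides with a cone with apex [x], so
   the projection is positively homogeneous there. *)
Lemma conic_projection (x v z0 y0 : 'rV[R]_J) e0 e : Gset D x -> Gset D z0 -> dcone D z0 y0 ->
  active D z0 `<=` active D x -> z0 = x + e0 *: v + y0 -> 0 < e <= e0 ->
  let z := x + (e / e0) *: (z0 - x) in
  [/\ Gset D z, dcone D z ((e / e0) *: y0) & z = x + e *: v + (e / e0) *: y0].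
Proof.
move=> Gx Gz0 dy0 z0x z0E /andP[ep ee0] z; have e0p := lt_le_trans ep ee0.
have a0 : 0 <= e / e0 by rewrite divr_ge0// ltW.
have a1 : e / e0 <= 1 by rewrite ler_pdivrMr// mul1r.
have zE i : dot z (nrm D i) = (1 - e / e0) * dot x (nrm D i) + e / e0 * dot z0 (nrm D i).
  by rewrite /z dotDl dotZl dotBl; ring.
have Gz : Gset D z.
  move=> i; rewrite zE; have := Gx i; have := Gz0 i => h1 h2.
  have h3 : (1 - e / e0) * Defs.cst D i <= (1 - e / e0) * dot x (nrm D i).
    by rewrite ler_wpM2l// subr_ge0.
  have h4 : e / e0 * Defs.cst D i <= e / e0 * dot z0 (nrm D i) by rewrite ler_wpM2l.
  lra.
split=> //.
  have [m [a [w [a0' wP ->]]]] := dy0.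
  exists m, (fun k => e / e0 * a k), w; split=> [k|k|].
  - by rewrite mulr_ge0.
  - have [i iz0 <-] := wP k; exists i => //; apply/(activeE _ dn1 Gz); rewrite zE.
    have /(activeE _ dn1 Gx) -> := z0x i iz0.
    by move/(activeE _ dn1 Gz0): iz0 => ->; ring.
  - by rewrite scaler_sumr; apply: eq_bigr => k _; rewrite scalerA.
rewrite /z z0E; apply/rowP => j; rewrite !mxE; field; exact: lt0r_neq0.
Qed.

(* Directions and normals are in duality: the matrix [dot (dir i) (nrm j)], with
   [i] and [j] active, is invertible, because a vector of its kernel yields an
   element of [lin] and [annih] at once. *)
Lemma free_span_full x :
  free [seq dir D i | i in [pred i | `[< active D x i >]]] ->
  Defs.span (Hset D x `|` dcone D x) = setT.
Proof.
pose P := active D x; pose A : pred 'I_N := [pred i | `[< P i >]].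
rewrite -/P -/A => freeA.
(* Completing by the identity on inactive indices keeps the matrix square over all of ['I_N]. *)
pose M : 'M[R]_N := \matrix_(i, j)
  if `[< P i >] && `[< P j >] then dot (dir D i) (nrm D j) else (i == j)%:R.
have Mker (c : 'rV[R]_N) : c *m M = 0 -> c = 0.
  move=> cM.
  have cout i : ~ P i -> c ord0 i = 0.
    move=> Pi; have := congr1 (fun B : 'rV[R]_N => B ord0 i) cM.
    rewrite !mxE (bigD1 i)//= mxE (asboolF Pi) andbF eqxx mulr1 big1 ?addr0// => j ji.
    by rewrite mxE (asboolF Pi) andbF (negbTE ji) mulr0.
  pose v := \sum_i c ord0 i *: dir D i.
  have cP i : c ord0 i != 0 -> P i by move=> /eqP ci; apply: contrapT => /cout.
  have v0 : v = 0.
    apply: (annih_lin0 gA (P := P)); last by exists (c ord0).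
    move=> j Pj; rewrite dot_suml.
    have := congr1 (fun B : 'rV[R]_N => B ord0 j) cM; rewrite !mxE => {2}<-.
    apply: eq_bigr => i _; rewrite dotZl mxE (asboolT Pj) andbT.
    by case: asboolP => [//|/cout ->]; rewrite !mul0r.
  apply/rowP => i; rewrite mxE; have [Pi|/cout//] := pselect (P i).
  have iA : i \in A by exact: asboolT.
  have /freeP fr : free (image_tuple (dir D) A) := freeA.
  have := fr (fun k => c ord0 (enum_val k)) _ (enum_rank_in iA i).
  rewrite enum_rankK_in//; apply.
  rewrite -[RHS]v0 /v (bigID (mem A))/= [X in _ = _ + X]big1 ?addr0; last first.
    move=> j; rewrite inE => /asboolPn/cout ->; by rewrite scale0r.
  rewrite [RHS]big_enum_val /=; apply: eq_bigr => k _; congr (_ *: _).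
  by rewrite /image_mem (nth_map i) -?cardE// (enum_val_nth i).
have Mu : M \in unitmx.
  rewrite -row_free_unit -kermx_eq0; apply/eqP/row_matrixP => i; rewrite row0.
  by apply: Mker; rewrite -row_mul mulmx_ker row0.
apply/seteqP; split=> // y _.
have [c cM] : exists c : 'rV[R]_N,
    c *m M = \row_j if `[< P j >] then dot y (nrm D j) else 0.
  by exists ((\row_j if `[< P j >] then dot y (nrm D j) else 0) *m invmx M); rewrite mulmxKV.
have cout i : ~ P i -> c ord0 i = 0.
  move=> Pi; have := congr1 (fun B : 'rV[R]_N => B ord0 i) cM.
  rewrite !mxE (asboolF Pi) (bigD1 i)//= mxE (asboolF Pi) andbF eqxx mulr1 big1 ?addr0// => j ji.
  by rewrite mxE (asboolF Pi) andbF (negbTE ji) mulr0.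
pose v := \sum_i c ord0 i *: dir D i.
have Hv : Hset D x (y - v).
  move=> j Pj; rewrite dotBl dot_suml.
  have := congr1 (fun B : 'rV[R]_N => B ord0 j) cM.
  rewrite !mxE (asboolT Pj) => <-; apply/eqP; rewrite subr_eq0; apply/eqP.
  apply: eq_bigr => i _; rewrite dotZl mxE (asboolT Pj) andbT.
  by case: asboolP => [//|/cout ->]; rewrite !mul0r.
(* Index 0 carries the part [y - v] in [Hset], the other indices the directions, with 0 in place of
   inactive ones. *)
exists N.+1, (fun k => if unlift ord0 k is Some i then c ord0 i else 1),
  (fun k => if unlift ord0 k is Some i then (if `[< P i >] then dir D i else 0) else y - v).
split=> [k|].
  case: unliftP => [i _|_]; last by left.
  by right; case: asboolP => [Pi|_]; [exact: dcone_dir|exact: dcone0].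
rewrite big_ord_recl unlift_none scale1r.
rewrite (eq_bigr (fun i => c ord0 i *: dir D i)); first by rewrite subrK.
move=> i _; rewrite liftK; case: asboolP => [//|/cout ->]; by rewrite !scale0r.
Qed.

End derivative_problem.

(** * Consequences of boundary jitter *)

Section jitter.
Context {R : realType} {J N : nat} (D : esp_data R J N).
Hypothesis dn1 : forall i, dot (dir D i) (nrm D i) = 1.
Variables (X Z Y : R -> 'rV[R]_J) (T : \bar R).
Hypotheses (ZY : solves_ESP D X Z Y) (jit : boundary_jitter D T Z Y).
Local Notation pushed := (pushed D Z Y).

Let cZ : continuous_path Z. Proof. by have [] := ZY. Qed.
Let cY : continuous_path Y. Proof. by have [] := ZY. Qed.
Let GZ r : 0 <= r -> Gset D (Z r).
Proof. by have [_ _ _ h] := ZY; move=> /h[]. Qed.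

Lemma smooth_active x i : active D x = [set i] -> smooth_part D x.
Proof.
move=> xi; have : active D x i by rewrite xi.
by move=> [bx _]; split=> //; exists i.
Qed.

Lemma pushed_sub i s r p q : s <= p -> p < q -> q <= r ->
  (forall u, p <= u <= q -> active D (Z u) `<=` [set i]) -> Y p <> Y q -> pushed i s r.
Proof. by move=> sp pq qr aP Ypq; exists p, q. Qed.

Lemma pushed_nonconst i s r p q : s <= p <= r -> s <= q <= r ->
  (forall u, s <= u <= r -> active D (Z u) `<=` [set i]) -> Y p <> Y q -> pushed i s r.
Proof.
move=> /andP[sp pr] /andP[sq qr] aP Ypq.
have aux p' q' : s <= p' -> p' < q' -> q' <= r -> Y p' <> Y q' -> pushed i s r.
  move=> sp' pq' qr' Ypq'; apply: (pushed_sub sp' pq' qr') => // u /andP[pu uq].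
  by apply: aP; rewrite (le_trans sp' pu) (le_trans uq qr').
case: (ltgtP p q) => [pq|qp|pq]; last by rewrite pq in Ypq.
  exact: aux Ypq.
by apply: aux qp pr _ => //; exact: nesym.
Qed.

Lemma jitter_nonconst t a b : in_itv0 T t -> smooth_part D (Z t) -> a < t -> t < b -> in_itv0 T b ->
  exists p, [/\ 0 < p, a < p < b & Y p <> Y t].
Proof.
move=> tT St at_ tb [_ bT]; have [J1 _ _ _] := jit.
apply: contrapT => h; apply: (J1 t tT St a b at_ tb bT).
exists (Y t) => r /andP[]; rewrite gt_max => /andP[ar r0] rb.
by apply: contrapT => Yr; apply: h; exists r; split=> //; rewrite ar.
Qed.

(** If [i] alone is active at [u], no other face is active nearby, and jitter makes [Y] vary
    arbitrarily close to [u]. *)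
Lemma pushed_at i s u r : 0 <= s -> s < u < r -> in_itv0 T r -> active D (Z u) = [set i] ->
  pushed i s r.
Proof.
move=> s0 /andP[su ur] rT ui; have u0 := le_lt_trans s0 su.
have [d d0 hd] := active_usc dn1 cZ GZ (ltW u0).
have uT : in_itv0 T u by apply: in_itv0_le rT; exact: ltW.
pose a := Num.max s (u - d / 2); pose b := Num.min r (u + d / 2).
have au : a < u by rewrite gt_max su ltrBlDr ltrDl divr_gt0.
have ub : u < b by rewrite lt_min ur ltrDl divr_gt0.
have bT : in_itv0 T b.
  by apply: in_itv0_le rT; [exact: ltW (lt_trans u0 ub)|rewrite ge_min lexx].
have [p [p0 /andP[ap pb] Yp]] := jitter_nonconst uT (smooth_active ui) au ub bT.
have sa : s <= a by rewrite le_max lexx.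
have br : b <= r by rewrite ge_min lexx.
apply: (pushed_mono sa br).
apply: (@pushed_nonconst i a b p u) => //; rewrite ?(ltW ap) ?(ltW pb) ?(ltW au) ?(ltW ub)//.
move=> v /andP[]; rewrite ge_max le_min => /andP[sv dv] /andP[vr vd].
rewrite -ui; apply: hd; first exact: le_trans sv.
by rewrite ltr_norml; apply/andP; split; lra.
Qed.

(** The only situation in which [left_rich] can fail, by [jitter_cases]. *)
Definition first_hit t := exists i s, [/\ active D (Z t) = [set i], 0 <= s < t,
  forall u, s <= u < t -> active D (Z u) `<=` set0 &
  forall u, s <= u <= t -> Y u = Y s].

Lemma jitter_start : in_itv0 T 0 -> right_rich D Z Y 0.
Proof.
move=> T0 i Pi r r0; have [c c0 cT] := in_itv0_right T0.
have [sm|nsm] := pselect (smooth_part D (Z 0)).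
  have [_ [j Z0j]] := sm; have ij : i = j by move: Pi; rewrite Z0j.
  subst j; have [d d0 hd] := active_usc dn1 cZ GZ (lexx 0).
  pose b := Num.min (Num.min r c) (d / 2).
  have b0 : 0 < b by rewrite !lt_min r0 c0 divr_gt0.
  have bT : in_itv0 T b by apply: in_itv0_le cT; [exact: ltW|rewrite !ge_min lexx orbT].
  have br : b <= r by rewrite !ge_min lexx.
  have bd : b <= d / 2 by rewrite !ge_min lexx orbT.
  have [p [p0 /andP[_ pb] Yp]] := jitter_nonconst T0 sm (ltrN10 R) b0 bT.
  have e0 : 0 < `|Y p - Y 0| / 2 by rewrite divr_gt0// normr_gt0 subr_eq0; apply/eqP.
  have [d' d'0 hd'] := continuous_pathP cY (lexx 0) e0.
  (* At [q] the path [Y] is within half of the distance from [Y 0] to [Y p] of [Y 0], hence differs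
     from [Y p]; the push on [[q, p]] starts strictly after 0, as [right_rich] demands. *)
  pose q := Num.min (p / 2) (d' / 2).
  have q0 : 0 < q by rewrite lt_min !divr_gt0.
  have qp : q < p by rewrite gt_min ltr_pdivrMr// ltr_pMr// ltr1n.
  exists q => //; apply: (@pushed_sub _ _ _ q p) => //; first exact: le_trans (ltW pb) br.
    move=> u /andP[qu up]; rewrite -Z0j; have u0 := le_trans (ltW q0) qu.
    apply: hd => //; rewrite subr0 ger0_norm//; lra.
  move=> Yqp; have := hd' q (ltW q0); rewrite subr0 gtr0_norm// Yqp => h.
  have : q < d' by rewrite gt_min [d' / 2 < d']ltr_pdivrMr// ltr_pMr// ltr1n orbT.
  move=> /h; have : 0 < `|Y p - Y 0| by rewrite normr_gt0 subr_eq0; apply/eqP.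
  lra.
have [_ _ J3 _] := jit.
have ns : nonsmooth_part D (Z 0) by split=> //; case: Pi.
pose b := Num.min r c.
have b0 : 0 < b by rewrite lt_min r0.
have bT : in_itv0 T b by apply: in_itv0_le cT; [exact: ltW|rewrite ge_min lexx orbT].
have [|u [/andP[u0 ub] ui]] := J3 ns i Pi b; first by split=> //; case: bT.
exists (u / 2); first by rewrite divr_gt0.
apply: (pushed_mono (lexx _) (_ : b <= r)); first by rewrite ge_min lexx.
apply: (pushed_at _ _ bT ui); first by rewrite divr_ge0// ltW.
by rewrite ub andbT ltr_pdivrMr// ltr_pMr// ltr1n.
Qed.

(** At a smooth point where pushes do not accumulate from the left, [Y] is constant just before [t],
    and by [pushed_at] the face is not even touched there. Jitter at [t] must then find the
    variation of [Y] after [t]. *)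
Lemma jitter_cases t : in_oitv0 T t ->
  left_rich D Z Y t \/ right_rich D Z Y t /\ first_hit t.
Proof.
move=> [t0 tT']; have tT : in_itv0 T t by split=> //; exact: ltW.
have [sm|nsm] := pselect (smooth_part D (Z t)); last first.
  left=> i Pi s /andP[s0 st]; have [_ _ _ J4] := jit.
  have ns : nonsmooth_part D (Z t) by split=> //; case: Pi.
  have [|u [/andP[su ut] ui]] := J4 t (conj t0 tT') ns i Pi ((t - s) / 2).
    by apply/andP; split; lra.
  exists ((u + t) / 2); first by rewrite midf_lt.
  apply: (pushed_at s0 _ _ ui); first by rewrite midf_lt// andbT; lra.
  by apply: in_itv0_le tT; [lra|rewrite ltW// midf_lt].
have [lr|nlr] := pselect (left_rich D Z Y t); [by left|right].
have [_ [i Zti]] := sm.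
have [s /andP[s0 st] hs] : exists2 s, 0 <= s < t & forall r, r < t -> ~ pushed i s r.
  apply: contrapT => h; apply: nlr => j; rewrite Zti => -> s s0t.
  apply: contrapT => h'; apply: h; exists s => // r rt push; apply: h'.
  by exists r.
have [d d0 hd] := active_usc dn1 cZ GZ (ltW t0).
pose s1 := Num.max ((s + t) / 2) (t - d / 2).
have ss1 : s < s1 by rewrite lt_max midf_lt.
have s1t : s1 < t by rewrite gt_max midf_lt// ltrBlDr ltrDl divr_gt0.
have s10 : 0 <= s1 by rewrite (le_trans s0)// ltW.
have aP u : s1 <= u <= t -> active D (Z u) `<=` [set i].
  move=> /andP[]; rewrite ge_max => /andP[su du] ut; rewrite -Zti; apply: hd; first lra.
  by rewrite ler0_norm ?subr_le0//; lra.
have Yc u : s1 <= u < t -> Y u = Y s1.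
  move=> /andP[su ut]; apply: contrapT => Yu.
  apply: (hs ((u + t) / 2)); first by rewrite midf_lt.
  have uu : u <= (u + t) / 2 by rewrite ltW// midf_lt.
  apply: (pushed_mono (ltW ss1) uu); apply: (@pushed_nonconst i s1 u u s1) => //.
  - by rewrite su lexx.
  - by rewrite su lexx.
  - by move=> v /andP[sv vu]; apply: aP; rewrite sv (le_trans vu)// ltW.
have Yt : Y t = Y s1.
  apply/eqP; rewrite -subr_eq0 -normr_le0; apply/ler_addgt0Pr => e e0; rewrite add0r.
  have [d' d'0 hd'] := continuous_pathP cY (ltW t0) e0.
  pose u := Num.max s1 (t - d' / 2).
  have su : s1 <= u by rewrite le_max lexx.
  have ut : u < t by rewrite gt_max s1t ltrBlDr ltrDl divr_gt0.
  have du : t - d' / 2 <= u by rewrite le_max lexx orbT.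
  rewrite -(Yc u) ?su// distrC; apply: hd'; first exact: le_trans su.
  by rewrite ltr0_norm ?subr_lt0//; lra.
split; last first.
  exists i, s1; split=> //; first by rewrite s10.
    move=> u /andP[su ut] j uj.
    have uj' : active D (Z u) = [set i].
      apply/seteqP; split; first by apply: aP; rewrite su ltW.
      move=> _ ->; suff -> : i = j by [].
      by have := aP u; rewrite su (ltW ut) => /(_ isT j uj) ->.
    have ut' : (u + t) / 2 < t by rewrite midf_lt.
    apply: (hs _ ut'); apply: (pushed_at s0 _ _ uj').
      by rewrite (lt_le_trans ss1 su) midf_lt.
    by apply: in_itv0_le tT; [rewrite divr_ge0// addr_ge0 ?(ltW t0)// (le_trans s10)|exact: ltW].
  move=> u /andP[su]; rewrite le_eqVlt => /predU1P[->//|ut]; apply: Yc.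
  by rewrite su.
move=> j; rewrite Zti => -> r tr; have [c tc cT] := in_itv0_right tT.
pose b := Num.min (Num.min r c) (t + d / 2).
have tb : t < b by rewrite !lt_min tr tc ltrDl divr_gt0.
have bT : in_itv0 T b.
  by apply: in_itv0_le cT; [exact: ltW (lt_trans t0 tb)|rewrite !ge_min lexx orbT].
have br : b <= r by rewrite !ge_min lexx.
have bd : b <= t + d / 2 by rewrite !ge_min lexx orbT.
have [p [p0 /andP[sp pb] Yp]] := jitter_nonconst tT sm s1t tb bT.
have tp : t < p.
  rewrite ltNge; apply/negP; rewrite le_eqVlt => /predU1P[pt|pt]; first by rewrite pt in Yp.
  by apply: Yp; rewrite Yt Yc// (ltW sp).
have e0 : 0 < `|Y p - Y t| / 2 by rewrite divr_gt0// normr_gt0 subr_eq0; apply/eqP.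
have [d' d'0 hd'] := continuous_pathP cY (ltW t0) e0.
pose q := Num.min ((t + p) / 2) (t + d' / 2).
have tq : t < q by rewrite lt_min midf_lt// ltrDl divr_gt0.
have qp : q < p by rewrite gt_min midf_lt.
have qd : q <= t + d' / 2 by rewrite ge_min lexx orbT.
exists q => //; apply: (@pushed_sub _ _ _ q p) => //; first exact: le_trans (ltW pb) br.
  move=> u /andP[qu up]; rewrite -Zti; apply: hd; first lra.
  rewrite gtr0_norm; lra.
have q0 : 0 <= q by lra.
move=> Yqp; have := hd' q q0; rewrite Yqp gtr0_norm ?subr_gt0// => h.
have : q - t < d' by lra.
move=> /h; have : 0 < `|Y p - Y t| by rewrite normr_gt0 subr_eq0; apply/eqP.
lra.
Qed.

End jitter.

(** Otherwise [F] and the complement of some preimage generate a proper filter, and an ultrafilter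
    refining it contradicts the hypothesis. *)
Lemma cvg_ultra {R : realType} {J : nat} (F : set_system R) (f : R -> 'rV[R]_J) (l : 'rV[R]_J) :
  ProperFilter F ->
  (forall W : set_system R, UltraFilter W -> F `<=` W -> f @ W --> l) -> f @ F --> l.
Proof.
move=> FF h A lA; apply: contrapT => nFA.
pose G := within (~` (f @^-1` A)) F.
have FG : Filter G by exact: within_filter.
have PG : ProperFilter G.
  apply: Build_ProperFilter_ex => //.
  move=> B GB; apply: contrapT => B0; apply: nFA.
  apply: (@filterS _ F _ _ _ _ GB) => e he; apply: contrapT => fA.
  by apply: B0; exists e; exact: he.
have [W [UW GW]] := ultraFilterLemma PG.
have FW : F `<=` W by move=> B FB; apply: GW; apply: (@filterS _ F _ _ _ _ FB) => e.
have WA : W (f @^-1` A) by exact: (h W UW FW).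
have WnA : W (~` (f @^-1` A)) by apply: GW; apply: (@filterE _ F) => e.
by have [e []] := @filter_ex _ W _ _ (filterI WA WnA).
Qed.

(** Closed balls are compact, and an ultrafilter converges to each of its cluster points. *)
Lemma ultra_bounded_cvg {R : realType} {J : nat} (W : set_system R) (f : R -> 'rV[R]_J) (M : R) :
  UltraFilter W -> (\forall e \near W, `|f e| <= M) -> exists l : 'rV[R]_J, f @ W --> l.
Proof.
move=> UW fM.
have cA : compact [set v : 'rV[R]_J | `|0 - v| <= M].
  apply: bounded_closed_compact; last exact: (@closed_closed_ball_ R 'rV[R]_J 0 M).
  exists M; split=> [|x Mx v /=]; first by rewrite num_real.
  by rewrite sub0r normrN => /le_trans; apply; exact: ltW.
have [|p [_ clp]] := cA (f @ W) _.
  by apply: filterS fM => e; rewrite /= sub0r normrN.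
exists p => U pU; have [//|WnU] := in_ultra_setVsetC (f @^-1` U) UW.
have [x [nUx Ux]] := clp (~` U) U WnU pU.
by [].
Qed.

(** * Limits along an ultrafilter solve the derivative problem *)

Section ultralimit.
Context {R : realType} {J N : nat} (D : esp_data R J N).
Hypothesis dn1 : forall i, dot (dir D i) (nrm D i) = 1.
Variables (g : 'rV[R]_J -> R) (rho K : R).
Hypothesis gA : adapted_norm D g rho K.
Variables (X psi Z Y : R -> 'rV[R]_J) (ZE YE : R -> R -> 'rV[R]_J).
Hypotheses (ZY : solves_ESP D X Z Y) (cpsi : continuous_path psi).
Hypothesis ZYE : forall e, solves_ESP D (fun s => X s + e *: psi s) (ZE e) (YE e).
Variables (W : set_system R) (Dl : R -> 'rV[R]_J).
Context {PW : ProperFilter W}.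
Hypothesis W0 : (0 : R)^'+ `<=` W.
Hypothesis DW : forall t, 0 <= t -> (fun e => e^-1 *: (ZE e t - Z t)) @ W --> Dl t.
Variable T : \bar R.
Hypothesis jit : boundary_jitter D T Z Y.
Hypothesis dec : forall t, in_itv0 T t ->
  forall v, exists2 h, annih D (active D (Z t)) h & lin D (active D (Z t)) (v - h).
Let inc_lin := @inc_lin R J N D dn1 g rho K gA X psi Z Y ZE YE ZY cpsi ZYE W Dl PW W0 DW.
Let inc_first_hit := @inc_first_hit R J N D dn1 g rho K gA X psi Z Y ZE YE ZY cpsi ZYE W Dl PW W0 DW.
Local Notation inc := (inc psi Dl).

Let K0 : 0 < K := adapted_K gA.

Lemma psi_right t : 0 <= t -> psi @ t^'+ --> psi t.
Proof.
move=> t0; apply/cvgrPdist_le => e e0; have [d d0 hd] := continuous_pathP cpsi t0 e0.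
have td : t < t + d by rewrite ltrDl.
apply: filterS2 (nbhs_right_lt td) (nbhs_right_gt t) => r rd tr.
by rewrite distrC; apply: hd; [rewrite (le_trans t0)// ltW|rewrite gtr0_norm ?subr_gt0//; lra].
Qed.

Lemma psi_left t : 0 < t -> psi @ t^'- --> psi t.
Proof.
move=> t0; apply/cvgrPdist_le => e e0; have [d d0 hd] := continuous_pathP cpsi (ltW t0) e0.
have td : t - d < t by rewrite ltrBlDr ltrDl.
apply: filterS3 (nbhs_left_gt t0) (nbhs_left_gt td) (nbhs_left_lt t) => r r0 rd rt.
by rewrite distrC; apply: hd; [exact: ltW|rewrite ltr0_norm ?subr_lt0//; lra].
Qed.

(** Until [t] no face is touched and [Dl] follows [psi]. At [t] it is reflected:
    [Dl t = l + b *: dir D i] with [0 <= b], and [Dl t] is orthogonal to [nrm D i] if [0 < b]. The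
    cases [b = 0] and [0 < b] are the two branches of [Theta]. *)
Lemma first_hit_left_limit t : in_oitv0 T t -> right_rich D Z Y t -> first_hit D Z Y t ->
  exists l, Dl @ t^'- --> l /\ exists i, active D (Z t) = [set i] /\
    ((l = Dl t /\ 0 <= dot l (nrm D i)) \/ (annih D (active D (Z t)) (Dl t) /\ dot l (nrm D i) < 0)).
Proof.
move=> [t0 tT'] rich [i [s [Zti /andP[s0 st] noact Yc]]].
have Ztii : active D (Z t) i by rewrite Zti.
have aP u : s <= u <= t -> active D (Z u) `<=` [set i].
  move=> /andP[su]; rewrite le_eqVlt => /predU1P[->|ut]; first by rewrite Zti.
  by move=> j uj; have := noact u; rewrite su ut => /(_ isT j uj).
have inc0 r r' : s <= r -> r <= r' -> r' < t -> inc r r' = 0.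
  move=> sr rr' r't; have h : 0 <= r <= r' by rewrite (le_trans s0).
  have [|a [a0 ->]] := inc_lin (P := set0) h.
    by move=> u /andP[ru ur']; apply: noact; rewrite (le_trans sr ru) (le_lt_trans ur').
  by rewrite big1// => j _; have [->|/a0[]] := eqVneq (a j) 0; rewrite scale0r.
pose l := Dl s + psi t - psi s.
exists l; split.
  have h : (fun r => Dl s + psi r - psi s) @ t^'- --> l.
    by apply: cvgB; [apply: cvgD; [exact: cvg_cst|exact: psi_left]|exact: cvg_cst].
  apply: cvg_left_near h.
  apply: filterS2 (nbhs_left_gt st) (nbhs_left_lt t) => r sr rt.
  have := inc0 s r (lexx _) (ltW sr) rt; rewrite /inc => /eqP.
  rewrite subr_eq0 => /eqP h; apply/esym/eqP; rewrite -subr_eq0; apply/eqP.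
  have -> : Dl r = (Dl r - Dl s) + Dl s by rewrite subrK.
  by rewrite h; apply/rowP => j; rewrite !mxE; ring.
have lE : Dl t - l = inc s t by apply/rowP => j; rewrite !mxE; ring.
exists i; split=> //.
(* As [inc] vanishes before [t], the interval can be shortened until [psi] oscillates by at most
   [om / K], without changing [inc s t]. *)
have hit_at om : 0 < om -> exists b, [/\ 0 <= b, inc s t = b *: dir D i,
    0 <= dot (Dl t) (nrm D i) & 0 < b -> dot (Dl t) (nrm D i) <= om].
  move=> om0; have e0 : 0 < om / K by rewrite divr_gt0.
  have [d d0 hd] := psi_osc gA cpsi (ltW t0) e0.
  pose s' := Num.max ((s + t) / 2) (t - d / 2).
  have ss' : s < s' by rewrite lt_max midf_lt.
  have s't : s' < t by rewrite gt_max midf_lt// ltrBlDr ltrDl divr_gt0.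
  have ds' : t - d / 2 <= s' by rewrite le_max lexx orbT.
  have s'0 : 0 <= s' by rewrite (le_trans s0)// ltW.
  have s't' : 0 <= s' < t by rewrite s'0.
  have [|||u /andP[s'u ut]|b [b0 E Dt0 Dt]] := @inc_first_hit i s' t (om / K) s't'.
  - by move=> u /andP[s'u ut]; apply: aP; rewrite ut (le_trans (ltW ss')).
  - by [].
  - move=> u /andP[s'u ut].
    by rewrite Yc ?ut ?(le_trans (ltW ss'))// (Yc s')// (ltW ss') ltW.
  - apply: hd; rewrite ?subrr ?normr0//; first exact: ltW.
      exact: le_trans s'u.
    by rewrite ler0_norm ?subr_le0//; lra.
  exists b; split=> //.
    by rewrite -(inc_add psi Dl s s' t) inc0 ?lexx ?(ltW ss')// add0r.
  by move=> /Dt; rewrite mulrC divfK// gt_eqF.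
have [b [b0 E Dt0 _]] := hit_at 1 ltr01.
have bE : b = dot (inc s t) (nrm D i) by rewrite E dotZl dn1 mulr1.
move: b0; rewrite le_eqVlt => /predU1P[b0|b0].
  have lD : l = Dl t by apply/esym/eqP; rewrite -subr_eq0 lE E -b0 scale0r.
  by left; rewrite lD.
right; have D0 : dot (Dl t) (nrm D i) = 0.
  apply/eqP; rewrite eq_le Dt0 andbT; apply/ler_addgt0Pr => e e0; rewrite add0r.
  have [b' [_ E' _]] := hit_at e e0; apply.
  by have := bE; rewrite E' dotZl dn1 mulr1 => <-.
split; first by move=> j; rewrite Zti => ->.
have -> : l = Dl t - inc s t by rewrite -lE opprB addrC subrK.
by rewrite dotBl D0 -bE sub0r oppr_lt0.
Qed.

Lemma Dl_right_limit t : in_itv0 T t -> exists ph, [/\ Dl @ t^'+ --> ph,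
  annih D (active D (Z t)) ph & lin D (active D (Z t)) (Dl t - ph)].
Proof.
move=> tT; have [al /andP[al0 al1] contr] := uniform_contraction gA.
have [t0 tT'] := tT.
have rr : right_rich D Z Y t -> exists ph, [/\ Dl @ t^'+ --> ph,
  annih D (active D (Z t)) ph & lin D (active D (Z t)) (Dl t - ph)].
  move=> rich; have [h Ph Lh] := dec tT (Dl t); exists h; split=> //.
  exact: (right_rich_cvg dn1 gA ZY cpsi ZYE W0 DW al0 al1 t0 contr (dec tT) rich Ph Lh).
move: t0; rewrite le_eqVlt => /predU1P[t0|t0].
  by apply: rr; rewrite -t0; apply: (jitter_start dn1 ZY jit); rewrite t0.
have [lr|[rich _]] := jitter_cases dn1 ZY jit (conj t0 tT' : in_oitv0 T t); last exact: rr.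
have A0 : annih D (active D (Z t)) (Dl t).
  exact: (left_rich_annih dn1 gA ZY cpsi ZYE W0 DW al0 al1 (ltW t0) contr (dec tT) t0 lr).
exists (Dl t); split; [|exact: A0|by rewrite subrr; exact: lin0].
exact: (annih_right_cvg dn1 gA ZY cpsi ZYE W0 DW (ltW t0) A0).
Qed.

Lemma Dl_left_limit t : in_oitv0 T t -> exists l, Dl @ t^'- --> l /\
  ((l = Dl t /\ annih D (active D (Z t)) (Dl t)) \/
   exists i, active D (Z t) = [set i] /\
    ((l = Dl t /\ 0 <= dot l (nrm D i)) \/ (annih D (active D (Z t)) (Dl t) /\ dot l (nrm D i) < 0))).
Proof.
move=> tT; have [t0 tT'] := tT; have tT0 : in_itv0 T t by split=> //; exact: ltW.
have [al /andP[al0 al1] contr] := uniform_contraction gA.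
have [lr|[rich fh]] := jitter_cases dn1 ZY jit tT.
  exists (Dl t); split.
    exact: (left_rich_cvg dn1 gA ZY cpsi ZYE W0 DW al0 al1 (ltW t0) contr (dec tT0) t0 lr).
  left; split=> //.
  exact: (left_rich_annih dn1 gA ZY cpsi ZYE W0 DW al0 al1 (ltW t0) contr (dec tT0) t0 lr).
have [l [hl h]] := first_hit_left_limit tT rich fh.
by exists l; split=> //; right.
Qed.

Lemma Dl_annih_right t : in_itv0 T t -> annih D (active D (Z t)) (Dl t) -> Dl @ t^'+ --> Dl t.
Proof. by move=> [t0 _] At; exact: (annih_right_cvg dn1 gA ZY cpsi ZYE W0 DW t0 At). Qed.

Lemma Dl_initial_lin : lin D (active D (Z 0)) (Dl 0 - psi 0).
Proof.
have c : (fun e => e^-1 *: (ZE e 0 - Z 0) - psi 0) @ W --> Dl 0 - psi 0.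
  by apply: cvgB; [exact: DW|exact: cvg_cst].
apply: (closed_cvg (lin D (active D (Z 0))) _ _ _ c); first exact: closed_lin.
have aP : forall u : R, 0 <= u <= 0 -> active D (Z u) `<=` active D (Z 0).
  by move=> u; rewrite -eq_le => /eqP <-.
have := W0 (perturbation_active dn1 gA ZY cpsi ZYE (lexx 0) aP).
apply: filterS2 (W_gt0 W0) => e e0 /(_ 0); rewrite lexx => /(_ isT) aPe.
have [_ _ dY /(_ 0 (lexx 0))[Z0 _ _]] := ZY.
have [_ _ dYE /(_ 0 (lexx 0))[ZE0 _ _]] := ZYE e.
have -> : e^-1 *: (ZE e 0 - Z 0) - psi 0 = e^-1 *: (YE e 0 - Y 0).
  by rewrite Z0 ZE0; apply/rowP => j; rewrite !mxE; field; exact: lt0r_neq0.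
apply/linZ/linB; first by apply: (lin_sub aPe); exact/conic_lin/dcone_conic.
exact/conic_lin/dcone_conic.
Qed.

Lemma derivative_process : exists phi, [/\ D_lr T Dl,
  solves_DP D T Z psi phi (fun t => phi t - psi t),
  forall t, in_itv0 T t -> Dl @ t^'+ --> phi t &
  forall t, in_oitv0 T t -> Dl t = Theta D Z phi t].
Proof.
(* The default [psi t] outside [[0, T)] matters for [T = 0]: [solves_DP] constrains [eta 0] in any
   case. *)
have exphi t : exists ph, (in_itv0 T t -> [/\ Dl @ t^'+ --> ph,
    annih D (active D (Z t)) ph & lin D (active D (Z t)) (Dl t - ph)]) /\
    (~ in_itv0 T t -> ph = psi t).
  have [tT|ntT] := pselect (in_itv0 T t); last by exists (psi t).
  by have [ph h] := Dl_right_limit tT; exists ph.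
have [phi hphi0] := choice exphi.
have hphi t : in_itv0 T t -> [/\ Dl @ t^'+ --> phi t,
    annih D (active D (Z t)) (phi t) & lin D (active D (Z t)) (Dl t - phi t)].
  by have [] := hphi0 t.
have Dphi t : in_itv0 T t -> Dl @ t^'+ --> phi t by move=> /hphi[].
have oitv t : in_oitv0 T t -> in_itv0 T t by move=> [t0 tT]; split=> //; exact: ltW.
have phi_right t : in_itv0 T t -> phi @ t^'+ --> phi t.
  move=> tT; apply: (right_limits_right _ (Dphi t tT)).
  by apply: filterS (near_right_itv0 tT) => r; exact: Dphi.
have phi_left t (l : 'rV[R]_J) : in_oitv0 T t -> Dl @ t^'- --> l -> phi @ t^'- --> l.
  move=> tT hl; apply: (right_limits_left _ hl).
  by apply: filterS (near_left_itv0 tT) => r; exact: Dphi.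
have phi_annih t : in_itv0 T t -> annih D (active D (Z t)) (Dl t) -> phi t = Dl t.
  move=> tT At; apply: (cvg_right_unique (Dphi t tT)).
  exact: Dl_annih_right.
exists phi; split=> //.
- split.
  + by move=> t /Dl_left_limit[l [hl _]]; apply/cvg_ex; exists l.
  + by move=> t /Dphi h; apply/cvg_ex; exists (phi t).
  + move=> t tT; have [l [hl h]] := Dl_left_limit tT.
    case: h => [[<- _]|[i [_ [[<- _]|[At _]]]]]; [by left|by left|right].
    exact: Dl_annih_right (oitv _ tT) At.
- have psiR t : in_itv0 T t -> psi @ t^'+ --> psi t by move=> [t0 _]; exact: psi_right.
  have eta_right t : in_itv0 T t -> (fun r => phi r - psi r) @ t^'+ --> phi t - psi t.
    by move=> tT; apply: cvgB; [exact: phi_right|exact: psiR].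
  split.
  + split=> //; split=> t tT; last by right; exact/phi_right/oitv.
      by have [l [/(phi_left _ _ tT) hl _]] := Dl_left_limit tT; apply/cvg_ex; exists l.
    by apply/cvg_ex; exists (phi t); exact: phi_right.
  + split=> //; split=> t tT; last by right; exact/eta_right/oitv.
      have [l [/(phi_left _ _ tT) hl _]] := Dl_left_limit tT; apply/cvg_ex; exists (l - psi t).
      by apply: cvgB => //; apply: psi_left; case: tT.
    by apply/cvg_ex; exists (phi t - psi t); exact: eta_right.
  + apply/span_dcone; have [T0|nT0] := pselect (in_itv0 T 0); last first.
      by have [_ ->//] := hphi0 0; rewrite subrr; exact: lin0.
    have [_ _ L0] := hphi 0 T0.
    rewrite (_ : _ - _ = (Dl 0 - psi 0) - (Dl 0 - phi 0)).
      by apply: linB => //; exact: Dl_initial_lin.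
    by apply/rowP => j; rewrite !mxE; ring.
  + move=> t tT; have [_ Ht Lt] := hphi t tT; split=> //; first by rewrite addrC subrK.
    move=> s /andP[s0 st]; apply: hit_span; first by exists t => /=; rewrite st lexx.
    have sT : in_itv0 T s by apply: in_itv0_le tT => //; exact: ltW.
    (* Approaching [s] through [r > s] keeps faces active only at [s] out of the span. *)
    have c : (fun r => phi t - psi t - (Dl r - psi r)) @ s^'+ --> phi t - psi t - (phi s - psi s).
      by apply: cvgB; [exact: cvg_cst|apply: cvgB; [exact: Dphi|exact: psiR]].
    apply: (closed_cvg (lin D _) _ _ _ c); first exact: closed_lin.
    apply: filterS2 (nbhs_right_lt st) (nbhs_right_gt s) => r rt sr.
    rewrite (_ : _ - _ = inc r t - (Dl t - phi t)); last by apply/rowP => j; rewrite !mxE; ring.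
    apply: linB.
      apply: inc_lin; first by rewrite ltW ?(le_lt_trans s0 sr)//= ltW.
      move=> u /andP[ru ut] i ui; exists u => //=; by rewrite ut (lt_le_trans sr).
    apply: lin_sub Lt => i ti; exists t => //=; by rewrite st lexx.
move=> t tT; have [l [hl h]] := Dl_left_limit tT.
have tT0 := oitv t tT.
rewrite /Theta (cvg_left_lim (phi_left t l tT hl)).
case: h => [[-> At]|[i [Zti [[<- l0]|[At l0]]]]].
(* Both branches of [Theta] equal [Dl t] here. *)
- by rewrite phi_annih//; case: ifP.
- rewrite asboolT//; split; first exact: smooth_active Zti.
  by exists i.
rewrite asboolF ?phi_annih// => -[_ [j [Ztj]]].
have -> : j = i.
  have tj : active D (Z t) j by rewrite Ztj.
  by move: tj; rewrite Zti.
by rewrite leNgt l0.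
Qed.

End ultralimit.

(** * The directional derivative at time 0 *)

Section initial_value.
Context {R : realType} {J N : nat} (D : esp_data R J N).
Hypothesis dn1 : forall i, dot (dir D i) (nrm D i) = 1.
Variables (g : 'rV[R]_J -> R) (rho K : R).
Hypothesis gA : adapted_norm D g rho K.
Variables (proj : 'rV[R]_J -> 'rV[R]_J) (X psi Z Y : R -> 'rV[R]_J) (ZE YE : R -> R -> 'rV[R]_J).
Hypotheses (pD : is_projection D proj) (GX : Gset D (X 0)).
Hypotheses (ZY : solves_ESP D X Z Y) (cpsi : continuous_path psi).
Hypothesis ZYE : forall e, solves_ESP D (fun s => X s + e *: psi s) (ZE e) (YE e).

(** By [esp_initial], [ZE e 0] is the projection of [X 0 + e *: psi 0]; by homogeneity of the
    projection near [X 0] the quotient is constant for small [e]. *)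
Lemma initial_quotient : exists c, \forall e \near (0 : R)^'+,
  e^-1 *: (ZE e 0 - Z 0) = c /\ proj_quot proj (X 0) (psi 0) e = c.
Proof.
have Z0 : Z 0 = X 0.
  by apply: (esp_initial dn1 gA ZY GX (dcone0 _ _)); rewrite addr0.
have projE e : proj (X 0 + e *: psi 0) = ZE e 0.
  have [Gp pid pout] := pD; apply/esym.
  apply: (esp_initial (y := proj (X 0 + e *: psi 0) - (X 0 + e *: psi 0)) dn1 gA (ZYE e)) => //.
    have [Gx|nGx] := pselect (Gset D (X 0 + e *: psi 0)); last exact: pout.
    by rewrite pid// subrr; exact: dcone0.
  by rewrite [RHS]addrC subrK.
have projX : proj (X 0) = X 0 by have [_ ->] := pD.
have [d d0 hd] := active_nbhs dn1 GX.
have [M M0 hM] := perturbation_lipschitz dn1 gA ZY cpsi ZYE (lexx 0).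
(* For [e0 = d / M] the perturbed initial point is within [d] of [X 0], so it has no active face
   beyond those of [X 0]. *)
pose e0 := d / M; have e00 : 0 < e0 by rewrite divr_gt0.
have [_ _ dy0 /(_ 0 (lexx 0))[z0E Gz0 _]] := ZYE e0.
have a0 : active D (ZE e0 0) `<=` active D (X 0).
  apply: hd => //; have [|h _] := hM e0 0 e00; first by rewrite lexx.
  by rewrite -Z0 (le_trans h)// /e0 divfK// gt_eqF.
exists (e0^-1 *: (ZE e0 0 - X 0)).
apply: filterS2 (nbhs_right_le e00) (nbhs_right_gt 0) => e ee0 ep.
have ee : 0 < e <= e0 by rewrite ep.
have [Gz dz zE] := conic_projection dn1 GX Gz0 dy0 a0 z0E ee.
rewrite /proj_quot projX projE Z0 (esp_initial dn1 gA (ZYE e) Gz dz zE).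
rewrite addrC addKr scalerA mulrA mulVf ?mul1r// gt_eqF//.
Qed.

End initial_value.

(** * Independence of the ultrafilter and conclusion *)

Unset Implicit Arguments.

Theorem theorem3p12 (R : realType) (J N : nat) (D : esp_data R J N)
    (proj : 'rV[R]_J -> 'rV[R]_J)
    (Gam : (R -> 'rV[R]_J) -> R -> 'rV[R]_J)
    (X Z Y : R -> 'rV[R]_J) :
  is_esp_data D ->
  set_B_condition D ->
  is_projection D proj ->
  is_ESM D Gam ->
  continuous_path X -> Gset D (X 0) ->
  solves_ESP D X Z Y ->
  boundary_jitter D (tau_W D Z) Z Y ->
  (forall psi : R -> 'rV[R]_J, continuous_path psi ->
    [/\ forall t, in_itv0 (tau_W D Z) t -> cvg (ESM_quot Gam X psi t @ 0^'+),
        D_lr (tau_W D Z) (ESM_deriv Gam X psi) &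
        exists phi eta : R -> 'rV[R]_J,
          [/\ solves_DP D (tau_W D Z) Z psi phi eta,
              forall phi' eta' : R -> 'rV[R]_J,
                solves_DP D (tau_W D Z) Z psi phi' eta' ->
                forall t, in_itv0 (tau_W D Z) t ->
                  phi' t = phi t /\ eta' t = eta t,
              forall t, in_itv0 (tau_W D Z) t ->
                ESM_deriv Gam X psi @ t^'+ --> phi t,
              cvg (proj_quot proj (X 0) (psi 0) @ 0^'+) /\
              ESM_deriv Gam X psi 0 = proj_deriv proj (X 0) (psi 0) &
              forall t, in_oitv0 (tau_W D Z) t ->
                ESM_deriv Gam X psi t = Theta D Z phi t]]) /\
  ((forall x, boundary (Gset D) x ->
     free [seq dir D i | i in [pred i | `[< active D x i >]]]) ->
   tau_W D Z = +oo%E).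
Proof.
move=> [_ dn1 _ _] setB pD ESM cX GX ZY jit.
have [g [rho [K gA]]] := set_B_adapted_norm dn1 setB.
split; last first.
  move=> fr; rewrite /tau_W (_ : [set t | 0 <= t /\ Wset D (Z t)] = set0) ?image_set0 ?ereal_inf0//.
  apply/seteqP; split=> // t [_ [[bZ _] nfull]]; apply: nfull.
  exact: (free_span_full gA (fr _ bZ)).
move=> psi cpsi; set T := tau_W D Z.
have exYE e : exists YE, solves_ESP D (fun s => X s + e *: psi s)
    (Gam (fun s => X s + e *: psi s)) YE.
  by apply: ESM; exact: continuous_path_shift.
have [YE ZYE] := choice exYE; pose ZE e := Gam (fun s => X s + e *: psi s).
have GamX t : 0 <= t -> Gam X t = Z t.
  by have [Y' ZY'] := ESM X cX; exact: (esp_unique dn1 gA ZY ZY').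
have quotE t e : 0 <= t -> ESM_quot Gam X psi t e = e^-1 *: (ZE e t - Z t).
  by move=> t0; rewrite /ESM_quot GamX.
(* Before [T] the point [Z t] avoids [Wset]. If the span is not full, at most one face [j] is
   active, and projecting along [dir D j] gives the splitting. *)
have dec t : in_itv0 T t ->
    forall v, exists2 h, annih D (active D (Z t)) h & lin D (active D (Z t)) (v - h).
  move=> [t0 tT] v.
  have nW : ~ Wset D (Z t).
    move=> WZ; move: tT; rewrite ltNge => /negP; apply.
    by apply: ereal_inf_lbound; exists t.
  have [full|nfull] := pselect (Defs.span (Hset D (Z t) `|` dcone D (Z t)) = setT).
    exact: span_decomposition.
  have nns : ~ nonsmooth_part D (Z t) by move=> ns; apply: nW.
  have [[i iZ]|nact] := pselect (exists i, active D (Z t) i); last first.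
    exists v => [i iZ|]; first by exfalso; apply: nact; exists i.
    by rewrite subrr; exact: lin0.
  have [_ [j Zj]] : smooth_part D (Z t).
    by apply: contrapT => nsm; apply: nns; split=> //; case: iZ.
  exists (v - dot v (nrm D j) *: dir D j).
    by rewrite Zj => _ ->; rewrite dotBl dotZl dn1 mulr1 subrr.
  by rewrite opprB addrC subrK; apply/linZ/lin_dir; rewrite Zj.
have exDl (W : set_system R) : UltraFilter W -> (0 : R)^'+ `<=` W -> exists Dl : R -> 'rV[R]_J,
    forall t, 0 <= t -> (fun e => e^-1 *: (ZE e t - Z t)) @ W --> Dl t.
  move=> UW W0.
  have exl t : exists l : 'rV[R]_J, 0 <= t -> (fun e => e^-1 *: (ZE e t - Z t)) @ W --> l;
    last by have [Dl hDl] := choice exl; exists Dl.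
  have [t0|nt0] := pselect (0 <= t); last by exists 0.
  have [M M0 hM] := perturbation_lipschitz dn1 gA ZY cpsi ZYE t0.
  have [|l hl] := @ultra_bounded_cvg _ _ W (fun e => e^-1 *: (ZE e t - Z t)) M UW.
    apply: filterS (W0 _ (nbhs_right_gt 0)) => e e0.
    rewrite normrZ gtr0_norm ?invr_gt0// ler_pdivrMl//.
    by have [|] := hM e t e0 => //; rewrite t0 lexx.
  by exists l.
have [c hc] := initial_quotient dn1 gA pD GX ZY cpsi ZYE.
have [W1 [UW1 W10]] := ultraFilterLemma (at_right_proper_filter (0 : R)).
have [D1 D1W] := exDl W1 UW1 W10.
have [phi [DlrD1 DP1 D1R D1Theta]] :=
  derivative_process dn1 gA ZY cpsi ZYE W10 D1W jit dec.
(* [Theta] determines the limit at positive times only; at time 0 the quotient is eventually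
   constant. *)
have Dl0 (W : set_system R) (Dl : R -> 'rV[R]_J) : ProperFilter W ->
    (0 : R)^'+ `<=` W -> (forall t, 0 <= t ->
    (fun e => e^-1 *: (ZE e t - Z t)) @ W --> Dl t) -> Dl 0 = c.
  move=> PW W0 DW; apply: (cvg_unique (@norm_hausdorff _ _) (DW 0 (lexx 0))).
  apply: cvg_near_cst; apply: filterS (W0 _ hc) => e [].
  by [].
have quot_cvg t : in_itv0 T t -> ESM_quot Gam X psi t @ 0^'+ --> D1 t.
  move=> tT; have [t0 tT'] := tT; apply: cvg_ultra => W UW W0.
  have [Dl DlW] := exDl W UW W0.
  have [phi' [_ DP' _ DlTheta]] := derivative_process dn1 gA ZY cpsi ZYE W0 DlW jit dec.
  suff -> : D1 t = Dl t.
    have -> : ESM_quot Gam X psi t = (fun e => e^-1 *: (ZE e t - Z t)).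
      by apply/funext => e; exact: quotE.
    exact: DlW.
  move: t0; rewrite le_eqVlt => /predU1P[<-|t0]; first by rewrite (Dl0 W1)// (Dl0 W).
  have tT0 : in_oitv0 T t by [].
  (* Both limits are [Theta] of a solution of the derivative problem, and the two solutions agree on
     [[0, T)], hence so do their left limits at [t]. *)
  rewrite D1Theta// DlTheta//.
  have phiE r : in_itv0 T r -> phi' r = phi r.
    by move=> rT; have [] := derivative_problem_unique dn1 gA ZY DP1 DP' rT.
  rewrite /Theta phiE// (_ : lim (phi' @ t^'-) = lim (phi @ t^'-))//.
  have [[[cl _ _] _] _ _ _] := DP1; have /cvg_ex[l hl] := cl t tT0.
  rewrite (cvg_left_lim hl); apply/cvg_left_lim; apply: cvg_left_near hl.
  by apply: filterS (near_left_itv0 tT0) => r /phiE ->.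
have derivE t : in_itv0 T t -> ESM_deriv Gam X psi t = D1 t.
  by move=> /quot_cvg h; exact: (cvg_lim (@norm_hausdorff _ _) h).
have oitv t : in_oitv0 T t -> in_itv0 T t by move=> [t0 tT]; split=> //; exact: ltW.
split.
- by move=> t /quot_cvg h; apply/cvg_ex; exists (D1 t).
- have [cl cr lr] := DlrD1.
  have toR t (l : 'rV[R]_J) : in_itv0 T t -> D1 @ t^'+ --> l -> ESM_deriv Gam X psi @ t^'+ --> l.
    by move=> tT; apply: cvg_right_near; apply: filterS (near_right_itv0 tT) => r /derivE.
  have toL t (l : 'rV[R]_J) : in_oitv0 T t -> D1 @ t^'- --> l -> ESM_deriv Gam X psi @ t^'- --> l.
    by move=> tT; apply: cvg_left_near; apply: filterS (near_left_itv0 tT) => r /derivE.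
  split=> t tT.
  + by have /cvg_ex[l /(toL _ _ tT) hl] := cl t tT; apply/cvg_ex; exists l.
  + by have /cvg_ex[l /(toR _ _ tT) hl] := cr t tT; apply/cvg_ex; exists l.
  + rewrite derivE; last exact: oitv.
    by case: (lr t tT) => h; [left; exact: toL|right; exact/toR/h/oitv].
exists phi, (fun t => phi t - psi t); split=> //.
- by move=> phi' eta' DP' t tT; exact: (derivative_problem_unique dn1 gA ZY DP1 DP' tT).
- move=> t tT; apply: cvg_right_near (D1R t tT).
  by apply: filterS (near_right_itv0 tT) => r /derivE.
- have pc : proj_quot proj (X 0) (psi 0) @ 0^'+ --> c.
    by apply: cvg_near_cst; apply: filterS hc => e [].
  have qc : ESM_quot Gam X psi 0 @ 0^'+ --> c.
    by apply: cvg_near_cst; apply: filterS hc => e []; rewrite quotE.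
  split; first by apply/cvg_ex; exists c.
  rewrite /ESM_deriv /proj_deriv (cvg_lim (@norm_hausdorff _ _) pc).
  exact: (cvg_lim (@norm_hausdorff _ _) qc).
by move=> t tT; rewrite derivE ?D1Theta//; exact: oitv.
Qed.
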